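(* Let $(z_n)$ be a sequence of distinct complex numbers in $\mathbb{D}$. Let $\psi\colon [1,+\infty)\to \mathbb{R}_+$ be a nondecreasing unbounded function satisfying $\psi(2x)=O(\psi(x))$ as $x\to+\infty$, let $\rho^*=\rho^*[\psi]$ be its Pólya order, let $s\ge [\rho^*]+1$ be an integer, and let $P$ and $B_n$ be the canonical product with parameter $s$ and the associated functions described in the context. Assume that $$\exists C>0\ \ \forall z\in\mathbb{D}:\quad n_z\Bigl(\frac{1-|z|}{2}\Bigr)\le C\,\psi\Bigl(\frac{1}{1-|z|}\Bigr),$$ and that at least one of the following three conditions holds: (a) $\exists C>0\ \forall n\in\mathbb{N}:\quad N_{z_n}\Bigl(\frac{1-|z_n|}{2}\Bigr)\le C\,\tilde\psi\Bigl(\frac{1}{1-|z_n|}\Bigr)$; (b) $\exists C>0\ \forall n\in\mathbb{N}:\quad -\log\bigl((1-|z_n|)|P'(z_n)|\bigr)\le C\,\tilde\psi\Bigl(\frac{1}{1-|z_n|}\Bigr)$; (c) $\exists C>0\ \forall n\in\mathbb{N}:\quad -\log|B_n(z_n)|\le C\,\tilde\psi\Bigl(\frac{1}{1-|z_n|}\Bigr)$. Then for every sequence $(b_n)$ of complex numbers satisfying $$\exists C>0\ \forall n\in\mathbb{N}:\quad \log|b_n|\le C\,\tilde\psi\Bigl(\frac{1}{1-|z_n|}\Bigr)$$ there exists an analytic function $f$ in $\mathbb{D}$ such that $f(z_n)=b_n$ for all $n\in\mathbb{N}$ and $$\exists C>0\ \forall r\in(0,1):\quad \log M(r,f)\le 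C\,\tilde\psi\Bigl(\frac{1}{1-r}\Bigr).$$
   Context: $\mathbb{D}=\{z\in\mathbb{C}:|z|<1\}$, and $[x]$ denotes the integer part of $x$. For $f$ analytic in $\mathbb{D}$ and $r\in(0,1)$, $M(r,f)=\max\{|f(z)|:|z|=r\}$. For the sequence $(z_k)$ and $\zeta\in\mathbb{D}$, $n_\zeta(t)=\sum_{|z_k-\zeta|\le t}1$ is the number of members of the sequence with $|z_k-\zeta|\le t$, and $$N_\zeta(r)=\int_0^r\frac{(n_\zeta(t)-1)^+}{t}\,dt,\qquad x^+=\max\{x,0\}.$$ For a nondecreasing $\psi\colon[1,+\infty)\to\mathbb{R}_+$, $\tilde\psi(x)=\int_1^x\frac{\psi(t)}{t}\,dt$. The Pólya order $\rho^*[\psi]$ is the number characterized by the condition that for every $\rho>\rho^*[\psi]$ one has $\psi(Cx)\le C^{\rho}\psi(x)$ for all sufficiently large $x$ and $C$ (i.e. as $x,C\to\infty$); that is, it is the infimum of all $\rho$ with this property. It is finite when $\psi(2x)=O(\psi(x))$ as $x\to+\infty$. The canonical product is $$P(z)=\prod_{n=1}^\infty E\Bigl(\frac{1-|z_n|^2}{1-\bar z_n z},s\Bigr),\qquad E(w,s)=(1-w)\exp\Bigl\{w+\frac{w^2}{2}+\dots+\frac{w^s}{s}\Bigr\},\quad s\in\mathbb{N}.$$ It is analytic in $\mathbb{D}$ with zero sequence $(z_n)$ provided $\sum_n(1-|z_n|)^{s+1}<\infty$. For each $n$, $$B_n(z)=P(z)\Big/E\Bigl(\frac{1-|z_n|^2}{1-\bar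 z_n z},s\Bigr),$$ that is, the product $P$ with its $n$-th factor removed. *)

(* Defs.v *)
From HB Require Import structures.
From mathcomp Require Import all_boot all_order all_algebra.
From mathcomp Require Import all_classical all_reals all_analysis.
From mathcomp Require Import complex.
Set Implicit Arguments.
Unset Strict Implicit.
Unset Printing Implicit Defensive.
Import Order.TTheory GRing.Theory Num.Theory.
Import numFieldNormedType.Exports.
Import ComplexField.
Local Open Scope classical_set_scope.
Local Open Scope ring_scope.
Local Open Scope complex_scope.

(* R[i] as a normed space over itself; numFieldNormedType.Exports provides this
   only for variables of the number structures. *)
HB.instance Definition _ (R : realType) := PseudoPointedMetric.copy R[i] R[i]^o.
HB.instance Definition _ (R : realType) := NormedModule.copy R[i] R[i]^o.

Section definitions.
Context {R : realType}.
Implicit Types (z w zeta : R[i]) (a : nat -> R[i]) (psi : R -> R) (f : R[i] -> R[i]).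

(* The modulus as an element of R: the library norm `|w| lives in R[i]
   (it is equal to (cmod w)%:C). *)
Definition cmod w : R := complex.Re `|w|.

Definition in_disk w : Prop := cmod w < 1.

Definition cexp w : R[i] :=
  (expR (complex.Re w))%:C * (cos (complex.Im w) +i* sin (complex.Im w)).

(* Complex differentiability at every point of the disk. Functions are total;
   since the disk is open, values outside of it are irrelevant. *)
Definition analytic_in_disk f : Prop :=
  forall w, in_disk w -> derivable f w 1.

(* M(r,f), extended-real valued; for f continuous on the circle |w| = r the
   supremum is the maximum of |f|. *)
Definition max_modulus (r : R) f : \bar R :=
  ereal_sup [set (cmod (f w))%:E | w in [set w | cmod w = r]].

(* n_zeta(t), equal to +oo when infinitely many terms lie in the closed disk. *)
Definition ncount a zeta (t : R) : \bar R :=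
  counting [set k : nat | cmod (a k - zeta) <= t].

Definition Ncount a zeta (r : R) : \bar R :=
  (\int[lebesgue_measure]_(t in `[0%R, r])
     (maxe (ncount a zeta t - 1) 0 * (t^-1)%:E))%E.

Definition psi_tilde psi (x : R) : R :=
  \int[lebesgue_measure]_(t in `[1%R, x]) (psi t / t).

(* The set is nonempty when psi (2x) = O(psi x), and bounded below by 0 when
   psi is moreover nondecreasing and unbounded, so that inf is then genuine. *)
Definition polya_order psi : R :=
  inf [set rho : R | \forall x \near +oo & C \near +oo,
                       psi (C * x) <= C `^ rho * psi x].

(* E(w, s). *)
Definition primary_factor w (s : nat) : R[i] :=
  (1 - w) * cexp (\sum_(1 <= j < s.+1) w ^+ j / j%:R).

Definition canonical_factor a (s n : nat) z : R[i] :=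
  primary_factor ((1 - (cmod (a n) ^+ 2)%:C) / (1 - conjc (a n) * z)) s.

Definition canonical_product a (s : nat) z : R[i] :=
  limn (fun m : nat => \prod_(0 <= k < m) canonical_factor a s k z).

(* B_n: the n-th factor is omitted rather than divided out, so that the value
   at a n is meaningful. *)
Definition canonical_product_without a (s n : nat) z : R[i] :=
  limn (fun m : nat =>
    \prod_(0 <= k < m | k != n) canonical_factor a s k z).

End definitions.

(* Main.v *)
(* Write T for psi_tilde, T_z for T(1/(1-|z|)), T_n for T_{z_n}, and
   w_k(z) = (1 - |z_k|^2) / (1 - conj z_k z).

   The density condition and rho* < s give
     sum_k |w_k(z)|^(s+1) <= C (T_z + 1)                                    (1)
   by counting the points in dyadic boxes.  As |E(w, s) - 1| <= C |w|^(s+1) for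
   |w| <= 2, every subproduct of P is at most exp(C (T_z + 1)).  Each of
   (a), (b), (c) yields |B_n(z_n)| >= exp(-C (T_n + 1)): in case (a) because
   1 - w_k(z_n) is comparable to min(1, |z_k - z_n| / (1 - |z_n|)) for the k
   with w_k(z_n) not small, the number of which is controlled by (1).  Then
     f = sum_n b_n B_n / B_n(z_n) w_n^(k_n)  with  k_n ~ C (T_n + 1)
   interpolates, and |f(z)| <= exp(C (T_z + 1)), since w_n^(k_n) beats the other
   factors of the n-th term unless 1 - |z_n| is at least comparable to 1 - |z|.
   Multiplying f by a power of z (or, when 0 is one of the points, solving for
   (f - f(0)) / z) removes the additive constant.

   Analyticity of limits is obtained without Cauchy's formula: a bound on the
   divided differences of order at most two passes to pointwise limits, is
   submultiplicative, and implies differentiability. *)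
Require Import Defs.
From mathcomp Require Import all_boot all_order all_algebra.
From mathcomp Require Import all_classical all_reals all_analysis.
From mathcomp Require Import complex.
From mathcomp Require Import measurable_realfun.
From mathcomp Require Import ring lra.
Import Order.TTheory GRing.Theory Num.Theory.
Import numFieldNormedType.Exports.
Local Open Scope classical_set_scope.
Local Open Scope ring_scope.

Set Implicit Arguments.
Unset Strict Implicit.
Unset Printing Implicit Defensive.

(** * Complex modulus *)

(** Three obstacles shape the argument. A point at the origin has constant weight 1, so its factor
    is constantly 0 and [P] vanishes identically; the interpolating products omit that point, and
    its value is prescribed separately at the end. The target bound has no additive constant
    although T(1) = 0, so |f| <= 1 is required wherever T vanishes, while every estimate produces T
    + 1; the data are therefore modified at the end, which is harmless because the constant of the
    interpolation lemma does not depend on them. Finally |w_n(z)| may reach 2, so its powers need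
    not be small. If |w_n(z)| <= 1/e, a power larger than what cancels the coefficients leaves
    exp(-T_n), summable because an unbounded psi makes T outgrow every multiple of log. If |w_n(z)|
    > 1/e, then 1 - |z| <= 8 (1 - |z_n|), and doubling gives T_n <= C (T_z + 1). The same dichotomy,
    run on divided-difference bounds of the weights, gives analyticity of the sum. Second
    differences enter because they make the difference quotients Lipschitz, hence Cauchy. *)

Section Cmod.
Variable R : realType.
Implicit Types (x y z w : R[i]) (r : R).

Lemma norm_cmod w : `|w| = (cmod w)%:C%C.
Proof. by rewrite /cmod normc_def. Qed.

Lemma cmod_ge0 w : 0 <= cmod w.
Proof. by rewrite -ler0c -norm_cmod normr_ge0. Qed.

Lemma cmodM z w : cmod (z * w) = cmod z * cmod w.
Proof. by apply: complexI; rewrite rmorphM /= -!norm_cmod normrM. Qed.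

Lemma cmodM_le z w (a b : R) :
  cmod z <= a -> cmod w <= b -> cmod (z * w) <= a * b.
Proof. by move=> za wb; rewrite cmodM ler_pM ?cmod_ge0. Qed.

Lemma cmod0 : cmod (0 : R[i]) = 0.
Proof. by rewrite /cmod normr0. Qed.

Lemma cmod1 : cmod (1 : R[i]) = 1.
Proof. by rewrite /cmod normr1. Qed.

Lemma cmodN w : cmod (- w) = cmod w.
Proof. by rewrite /cmod normrN. Qed.

Lemma cmodC z w : cmod (z - w) = cmod (w - z).
Proof. by rewrite /cmod distrC. Qed.

Lemma cmodX w n : cmod (w ^+ n) = cmod w ^+ n.
Proof. by apply: complexI; rewrite rmorphXn /= -!norm_cmod normrX. Qed.

Lemma cmodV w : cmod w^-1 = (cmod w)^-1.
Proof. by apply: complexI; rewrite fmorphV /= -!norm_cmod normfV. Qed.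

Lemma cmodD z w : cmod (z + w) <= cmod z + cmod w.
Proof. by rewrite -lecR rmorphD /= -!norm_cmod ler_normD. Qed.

Lemma cmodB z w : cmod (z - w) <= cmod z + cmod w.
Proof. by rewrite -(cmodN w) cmodD. Qed.

Lemma cmod_eq0 w : (cmod w == 0) = (w == 0).
Proof.
by rewrite -(normr_eq0 w) norm_cmod -(inj_eq (@complexI R)).
Qed.

Lemma cmod_gt0 w : (0 < cmod w) = (w != 0).
Proof. by rewrite lt_def cmod_ge0 andbT cmod_eq0. Qed.

Lemma cmodR r : cmod r%:C%C = `|r|.
Proof. by rewrite /cmod normc_def /= expr0n addr0 sqrtr_sqr. Qed.

Lemma cmod_nat n : cmod (n%:R : R[i]) = n%:R.
Proof. by rewrite -(rmorph_nat (real_complex R)) cmodR normr_nat. Qed.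

Lemma cmodJ w : cmod (conjc w) = cmod w.
Proof. by rewrite /cmod normcJ. Qed.

Lemma cmod_sqr w : cmod w ^+ 2 = complex.Re w ^+ 2 + complex.Im w ^+ 2.
Proof.
by rewrite /cmod normc_def /= sqr_sqrtr // addr_ge0 ?sqr_ge0.
Qed.

Lemma Re_le_cmod w : `|complex.Re w| <= cmod w.
Proof. by rewrite -lecR -norm_cmod normc_ge_Re. Qed.

Lemma Im_le_cmod w : `|complex.Im w| <= cmod w.
Proof.
rewrite -(@ler_pXn2r _ 2) ?nnegrE ?cmod_ge0 //.
by rewrite real_normK ?num_real // cmod_sqr lerDr sqr_ge0.
Qed.

Lemma cmod_le_ReIm w : cmod w <= `|complex.Re w| + `|complex.Im w|.
Proof.
rewrite -(@ler_pXn2r _ 2) ?nnegrE ?cmod_ge0 ?addr_ge0 //.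
rewrite cmod_sqr sqrrD !real_normK ?num_real //.
by rewrite lerD2r lerDl mulrn_wge0 // mulr_ge0.
Qed.

Lemma in_disk_inv_ge1 z : in_disk z -> 1 <= (1 - cmod z)^-1.
Proof. by rewrite /in_disk => z1; rewrite invf_ge1 ?subr_gt0 // gerBl cmod_ge0. Qed.

Lemma cmod_sum (I : Type) (s : seq I) (P : pred I) (F : I -> R[i]) :
  cmod (\sum_(i <- s | P i) F i) <= \sum_(i <- s | P i) cmod (F i).
Proof.
elim/big_ind2 : _ => //; first by rewrite cmod0.
by move=> x1 x2 y1 y2 h1 h2; apply: (le_trans (cmodD _ _)); apply: lerD.
Qed.

Lemma cmod_prod (I : Type) (s : seq I) (P : pred I) (F : I -> R[i]) :
  cmod (\prod_(i <- s | P i) F i) = \prod_(i <- s | P i) cmod (F i).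
Proof. by apply: (big_morph _ cmodM cmod1). Qed.

Lemma ler_cmod_dist z w : `|cmod z - cmod w| <= cmod (z - w).
Proof.
have a1 := cmodD (z - w) w; have a2 := cmodD (w - z) z.
rewrite !subrK in a1 a2; rewrite cmodC in a2.
rewrite ler_norml; apply/andP; split; last by lra.
by rewrite (cmodC z w); rewrite cmodC in a2; lra.
Qed.

Lemma cvg_cmodP (u : nat -> R[i]) (l : R[i]) :
  (u @ \oo --> l) <->
  (forall e : R, 0 < e -> \forall n \near \oo, cmod (l - u n) < e).
Proof.
split.
  move=> /cvgrPdist_lt h e e0.
  have := h e%:C%C; rewrite ltcR => /(_ e0).
  by apply: filterS => n; rewrite norm_cmod ltcR.
move=> h; apply/cvgrPdist_lt => e e0.
have /complex_realP [r er] : e \is Num.real by rewrite gtr0_real.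
rewrite er ltcR in e0 *.
by apply: filterS (h _ e0) => n; rewrite norm_cmod ltcR.
Qed.

Lemma cvg_cmod (u : nat -> R[i]) (l : R[i]) :
  u @ \oo --> l -> cmod (u n) @[n --> \oo] --> cmod l.
Proof.
move=> /cvg_cmodP h; apply/cvgrPdist_lt => e e0.
apply: filterS (h _ e0) => n; apply: le_lt_trans; exact: ler_cmod_dist.
Qed.

Lemma cvgn_cmod_le (u : nat -> R[i]) (l : R[i]) (M : R) :
  u @ \oo --> l -> (forall n, cmod (u n) <= M) -> cmod l <= M.
Proof.
move=> ul uM; have ul' := cvg_cmod ul.
rewrite -(cvg_lim _ ul') //; apply: limr_le; first by apply/cvg_ex; eexists; exact: ul'.
by apply: nearW.
Qed.

Lemma cvgn_summable_increments (v g : nat -> R) (B : R) :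
  (forall n, `|v n.+1 - v n| <= g n) ->
  (forall m, \sum_(0 <= k < m) g k <= B) -> cvgn v.
Proof.
move=> vg gB.
have -> : v = (fun n => v 0%N + series (fun k => v k.+1 - v k) n).
  by apply/funext => n; rewrite /series /= telescope_sumr // addrC subrK.
apply: is_cvgD; first exact: is_cvg_cst.
apply: normed_cvg; apply: nondecreasing_is_cvgn.
  apply: (nondecreasing_series (P := xpredT) (m := 0)) => n _ _; exact: normr_ge0.
exists B => _ [n _ <-] /=; rewrite (le_trans _ (gB n)) //.
by apply: ler_sum => k _.
Qed.

Lemma cvgn_cmod_summable (u : nat -> R[i]) (g : nat -> R) (B : R) :
  (forall n, cmod (u n.+1 - u n) <= g n) ->
  (forall m, \sum_(0 <= k < m) g k <= B) -> cvgn u.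
Proof.
move=> ug gB.
have /cvg_ex[a ha] : cvgn (fun n => complex.Re (u n)).
  apply: (cvgn_summable_increments _ gB) => n; apply: le_trans (ug n).
  by apply: le_trans (Re_le_cmod _); case: (u n) => ? ?; case: (u n.+1).
have /cvg_ex[b hb] : cvgn (fun n => complex.Im (u n)).
  apply: (cvgn_summable_increments _ gB) => n; apply: le_trans (ug n).
  by apply: le_trans (Im_le_cmod _); case: (u n) => ? ?; case: (u n.+1).
apply/cvg_ex; exists (Complex a b); apply/cvg_cmodP => e e0.
have e2 : 0 < e / 2 by lra.
move/cvgrPdist_lt : ha => /(_ _ e2) ha.
move/cvgrPdist_lt : hb => /(_ _ e2) hb.
near=> n.
apply: le_lt_trans (cmod_le_ReIm _) _.
have h1 : `|a - complex.Re (u n)| < e / 2 by near: n.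
have h2 : `|b - complex.Im (u n)| < e / 2 by near: n.
by move: h1 h2; case: (u n) => x y /= h1 h2; lra.
Unshelve. all: by end_near. Qed.

Lemma derivable_cmodP (f : R[i] -> R[i]) (w d : R[i]) :
  (forall e : R, 0 < e -> exists2 del : R, 0 < del & forall h, h != 0 ->
    cmod h < del -> cmod (d - (f (h + w) - f w) / h) < e) ->
  derivable f w 1 /\ derive1 f w = d.
Proof.
move=> fd.
have c : (fun h => h^-1 *: (f (h *: 1 + w) - f w)) @ (0 : R[i])^' --> d.
  apply/cvgrPdist_lt => e e0.
  have /complex_realP [r er] : e \is Num.real by rewrite gtr0_real.
  rewrite er ltcR in e0 *.
  have [del del0 hd] := fd _ e0.
  rewrite near_withinE /= near_simpl; apply/nbhs_ballP.
  exists del%:C%C => /=; first by rewrite ltcR.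
  move=> h; rewrite /ball /= sub0r normrN norm_cmod ltcR => hdel h0.
  by rewrite /GRing.scale /= norm_cmod ltcR mulr1 mulrC; apply: hd.
split; first by apply/cvg_ex; exists d.
rewrite /derive1.
apply: (@cvg_lim _ (@norm_hausdorff _ R[i])).
by under eq_fun do rewrite -[X in f (X + _)]mulr1.
Qed.

End Cmod.

(** * Divided differences *)

Section DividedDifferences.
Variable R : realType.
Implicit Types (f g : R[i] -> R[i]) (U : set R[i]) (x y z : R[i]) (M : R).

(* Both are 0 when two of the points coincide. *)
Definition dd1 f x y := (f x - f y) / (x - y).
Definition dd2 f x y z :=
  if [|| x == y, y == z | x == z] then 0
  else (dd1 f x y - dd1 f y z) / (x - z).

(* [M] dominates the sum of the suprema over [U] of [f] and of its first two
   divided differences.  This norm is submultiplicative, and bounds on it pass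
   to pointwise limits. *)
Definition dd_bounded U f M := forall x0 x1 y1 x2 y2 z2,
  U x0 -> U x1 -> U y1 -> U x2 -> U y2 -> U z2 ->
  cmod (f x0) + cmod (dd1 f x1 y1) + cmod (dd2 f x2 y2 z2) <= M.

Lemma dd1xx f x : dd1 f x x = 0.
Proof. by rewrite /dd1 subrr mul0r. Qed.

Lemma dd2xx f x : dd2 f x x x = 0.
Proof. by rewrite /dd2 eqxx. Qed.

Lemma dd_bounded_cmod U f M x : dd_bounded U f M -> U x -> cmod (f x) <= M.
Proof.
move=> h Ux; have := h x x x x x x Ux Ux Ux Ux Ux Ux.
by rewrite dd1xx dd2xx cmod0 !addr0.
Qed.

Lemma dd_bounded_dd1 U f M x y : dd_bounded U f M -> U x -> U y ->
  cmod (dd1 f x y) <= M.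
Proof.
move=> h Ux Uy; have := h x x y x x x Ux Ux Uy Ux Ux Ux.
by rewrite dd2xx cmod0 addr0; have := cmod_ge0 (f x); lra.
Qed.

Lemma dd_bounded_dd2 U f M x y z : dd_bounded U f M -> U x -> U y -> U z ->
  cmod (dd2 f x y z) <= M.
Proof.
move=> h Ux Uy Uz; have := h x x x x y z Ux Ux Ux Ux Uy Uz.
by rewrite dd1xx cmod0 addr0; have := cmod_ge0 (f x); lra.
Qed.

(** On a singleton every divided difference is 0, so bounds in this norm specialise to plain bounds
    on the modulus; pointwise estimates for the primary factors are obtained in this way. *)
Lemma dd_bounded1 f x M : cmod (f x) <= M -> dd_bounded [set x] f M.
Proof.
move=> h x0 x1 y1 x2 y2 z2 -> -> -> -> -> ->.
by rewrite dd1xx dd2xx cmod0 !addr0.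
Qed.

Lemma dd_bounded_le U f M M' : M <= M' -> dd_bounded U f M -> dd_bounded U f M'.
Proof. by move=> MM h x0 x1 y1 x2 y2 z2 *; apply: le_trans MM; apply: h. Qed.

Lemma dd_boundedD U f g M M' : dd_bounded U f M -> dd_bounded U g M' ->
  dd_bounded U (fun x => f x + g x) (M + M').
Proof.
move=> hf hg x0 x1 y1 x2 y2 z2 u1 u2 u3 u4 u5 u6.
have := hf _ _ _ _ _ _ u1 u2 u3 u4 u5 u6.
have := hg _ _ _ _ _ _ u1 u2 u3 u4 u5 u6.
have -> : dd1 (fun x => f x + g x) x1 y1 = dd1 f x1 y1 + dd1 g x1 y1.
  by rewrite /dd1; ring.
have -> : dd2 (fun x => f x + g x) x2 y2 z2 = dd2 f x2 y2 z2 + dd2 g x2 y2 z2.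
  by rewrite /dd2; case: ifP => _; [rewrite addr0|rewrite /dd1; ring].
have := cmodD (f x0) (g x0); have := cmodD (dd1 f x1 y1) (dd1 g x1 y1).
have := cmodD (dd2 f x2 y2 z2) (dd2 g x2 y2 z2).
lra.
Qed.

Lemma dd_bounded_cst U c : dd_bounded U (fun=> c) (cmod c).
Proof.
move=> x0 x1 y1 x2 y2 z2 _ _ _ _ _ _.
rewrite /dd2 /dd1 !subrr !mul0r; case: ifP => _;
by rewrite ?subrr ?mul0r cmod0 !addr0.
Qed.

Lemma dd1M f g x y : dd1 (fun x => f x * g x) x y = dd1 f x y * g y + f x * dd1 g x y.
Proof. by rewrite /dd1; ring. Qed.

(** The conditional matters for x = z with y different: there [dd2] is 0 by convention, while the
    product of first differences need not be. *)
Lemma dd2M f g x y z : dd2 (fun x => f x * g x) x y z =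
  dd2 f x y z * g z + dd1 f x y * (if [|| x == y, y == z | x == z] then 0 else dd1 g y z)
  + f x * dd2 g x y z.
Proof.
rewrite /dd2; case: ifP => [_|]; first by rewrite !(mul0r, mulr0) !addr0.
move=> /negbT; rewrite !negb_or => /and3P[xy yz xz].
have xy' : x - y != 0 by rewrite subr_eq0.
have yz' : y - z != 0 by rewrite subr_eq0.
have xz' : x - z != 0 by rewrite subr_eq0.
by rewrite /dd1; field; rewrite xz' xy' yz'.
Qed.

Let max_case (a b : R) : {c | a <= c /\ b <= c & c = a \/ c = b}.
Proof.
by case: (leP a b) => [ab|/ltW ba]; [exists b|exists a] => //; [right|left].
Qed.

(** The Leibniz rules bound the three terms by F0 G0, F1 G0 + F0 G1 and F2 G0 + F1 G1 + F0 G2. These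
    are distinct terms of the expansion of (F0 + F1 + F2) (G0 + G1 + G2), and the remaining ones are
    nonnegative. *)
Lemma dd_boundedM U f g M M' : dd_bounded U f M -> dd_bounded U g M' ->
  dd_bounded U (fun x => f x * g x) (M * M').
Proof.
move=> hf hg x0 x1 y1 x2 y2 z2 u1 u2 u3 u4 u5 u6.
(* Maxima over the finitely many arguments that occur replace suprema; each is attained, so [hf] and
   [hg] apply to them. *)
have [c [c1 c2] cE] := max_case (cmod (f x1)) (cmod (f x2)).
have [F0 [F01 F02] F0E] := max_case (cmod (f x0)) c.
have [F1 [F11 F12] F1E] := max_case (cmod (dd1 f x1 y1)) (cmod (dd1 f x2 y2)).
have [d [d1 d2] dE] := max_case (cmod (g y1)) (cmod (g z2)).
have [G0 [G01 G02] G0E] := max_case (cmod (g x0)) d.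
have [G1 [G11 G12] G1E] := max_case (cmod (dd1 g x1 y1)) (cmod (dd1 g y2 z2)).
set F2 := cmod (dd2 f x2 y2 z2); set G2 := cmod (dd2 g x2 y2 z2).
have FM : F0 + F1 + F2 <= M.
  by case: F0E => ->; case: F1E => ->; (try case: cE => ->); apply: hf.
have GM : G0 + G1 + G2 <= M'.
  by case: G0E => ->; case: G1E => ->; (try case: dE => ->); apply: hg.
have F00 : 0 <= F0 by apply: le_trans (cmod_ge0 _) F01.
have F10 : 0 <= F1 by apply: le_trans (cmod_ge0 _) F11.
have F20 : 0 <= F2 by apply: cmod_ge0.
have G00 : 0 <= G0 by apply: le_trans (cmod_ge0 _) G01.
have G10 : 0 <= G1 by apply: le_trans (cmod_ge0 _) G11.
have G20 : 0 <= G2 by apply: cmod_ge0.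
have FG : (F0 + F1 + F2) * (G0 + G1 + G2) <= M * M'.
  by apply: ler_pM => //; rewrite !addr_ge0.
apply: le_trans FG.
have e0 : cmod (f x0 * g x0) <= F0 * G0 by apply: cmodM_le.
have e1 : cmod (dd1 (fun x => f x * g x) x1 y1) <= F1 * G0 + F0 * G1.
  rewrite dd1M; apply: (le_trans (cmodD _ _)); apply: lerD; apply: cmodM_le => //.
    exact: le_trans d1 G02.
  exact: le_trans c1 F02.
have e2 : cmod (dd2 (fun x => f x * g x) x2 y2 z2) <= F2 * G0 + F1 * G1 + F0 * G2.
  rewrite dd2M; apply: (le_trans (cmodD _ _)); apply: lerD; last first.
    by apply: cmodM_le => //; apply: le_trans c2 F02.
  apply: (le_trans (cmodD _ _)); apply: lerD; apply: cmodM_le => //.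
    exact: le_trans d2 G02.
  by case: ifP => // _; rewrite cmod0.
apply: (le_trans (lerD (lerD e0 e1) e2)); rewrite -subr_ge0.
rewrite [leRHS](_ : _ = F1 * G2 + F2 * G1 + F2 * G2); last by ring.
by rewrite !addr_ge0 // mulr_ge0.
Qed.

Lemma dd_bounded_ge0 U f M : U !=set0 -> dd_bounded U f M -> 0 <= M.
Proof. by move=> [x Ux] /dd_bounded_cmod /(_ Ux); apply: le_trans (cmod_ge0 _). Qed.

Lemma dd_boundedX U f M n : dd_bounded U f M ->
  dd_bounded U (fun x => f x ^+ n) (M ^+ n).
Proof.
move=> h; elim: n => [|n ih].
  by under eq_fun do rewrite expr0; rewrite expr0 -(cmod1 R); apply: dd_bounded_cst.
by rewrite exprS; under eq_fun do rewrite exprS; apply: dd_boundedM.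
Qed.

Lemma dd_bounded_sum (I : Type) (r : seq I) (P : pred I) U (f : I -> R[i] -> R[i])
    (M : I -> R) : (forall i, P i -> dd_bounded U (f i) (M i)) ->
  dd_bounded U (fun x => \sum_(i <- r | P i) f i x) (\sum_(i <- r | P i) M i).
Proof.
move=> h; elim: r => [|i r ih].
  under eq_fun do rewrite big_nil.
  by rewrite big_nil -(cmod0 R); apply: dd_bounded_cst.
under eq_fun do rewrite big_cons.
by rewrite big_cons; case: ifP => Pi //; apply: dd_boundedD => //; apply: h.
Qed.

Lemma dd_bounded_prod (I : Type) (r : seq I) (P : pred I) U (f : I -> R[i] -> R[i])
    (M : I -> R) : (forall i, P i -> dd_bounded U (f i) (M i)) ->
  dd_bounded U (fun x => \prod_(i <- r | P i) f i x) (\prod_(i <- r | P i) M i).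
Proof.
move=> h; elim: r => [|i r ih].
  under eq_fun do rewrite big_nil.
  by rewrite big_nil -(cmod1 R); apply: dd_bounded_cst.
under eq_fun do rewrite big_cons.
by rewrite big_cons; case: ifP => Pi //; apply: dd_boundedM => //; apply: h.
Qed.

Lemma dd_bounded_ext U f g M : (forall x, U x -> f x = g x) ->
  dd_bounded U f M -> dd_bounded U g M.
Proof.
move=> fg h x0 x1 y1 x2 y2 z2 u1 u2 u3 u4 u5 u6.
have := h _ _ _ _ _ _ u1 u2 u3 u4 u5 u6.
by rewrite /dd2 /dd1 !fg.
Qed.

(** The bounds may vary with n because the polynomial approximations of E(., s) satisfy the sharp
    bound only in the limit. *)
Lemma dd_bounded_lim U (F : nat -> R[i] -> R[i]) f (M : nat -> R) (l : R) :
  (forall x, U x -> (F n x) @[n --> \oo] --> f x) ->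
  (forall n, dd_bounded U (F n) (M n)) -> M @ \oo --> l ->
  dd_bounded U f l.
Proof.
move=> Ff FM Ml x0 x1 y1 x2 y2 z2 u1 u2 u3 u4 u5 u6.
have c1 : dd1 (F n) x1 y1 @[n --> \oo] --> dd1 f x1 y1.
  by apply: cvgMl; apply: cvgB; apply: Ff.
have c2 : dd2 (F n) x2 y2 z2 @[n --> \oo] --> dd2 f x2 y2 z2.
  rewrite /dd2; case: ifP => _; first exact: cvg_cst.
  by apply: cvgMl; apply: cvgB; apply: cvgMl; apply: cvgB; apply: Ff.
have c : (fun n => cmod (F n x0) + cmod (dd1 (F n) x1 y1) + cmod (dd2 (F n) x2 y2 z2)) @ \oo
   --> cmod (f x0) + cmod (dd1 f x1 y1) + cmod (dd2 f x2 y2 z2).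
  exact: (cvgD (cvgD (cvg_cmod (Ff _ u1)) (cvg_cmod c1)) (cvg_cmod c2)).
rewrite -(cvg_lim _ c) // -(cvg_lim _ Ml) //.
apply: ler_lim; [by apply/cvg_ex; eexists; exact: c|by apply/cvg_ex; eexists; exact: Ml|].
by apply: nearW => n; apply: FM.
Qed.

Lemma dd1C f x y : dd1 f x y = dd1 f y x.
Proof. by rewrite /dd1 -(opprB (f y)) -(opprB y) invrN mulrNN. Qed.

Lemma dd1_lipschitz U f M x y z : dd_bounded U f M -> U x -> U y -> U z ->
  x != y -> z != y -> cmod (dd1 f x y - dd1 f z y) <= M * cmod (x - z).
Proof.
move=> h Ux Uy Uz xy zy; have [->|xz] := eqVneq x z.
  by rewrite !subrr cmod0 mulr0.
have := dd_bounded_dd2 h Ux Uy Uz; rewrite /dd2 (negPf xy) (negPf xz) eq_sym (negPf zy) /=.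
rewrite (dd1C f y z) cmodM cmodV ler_pdivrMr //.
by rewrite cmod_gt0 subr_eq0.
Qed.

(** By [dd1_lipschitz] the difference quotient at c is M-Lipschitz in the increment away from 0, so
    it has a limit at 0. *)
Lemma dd_bounded_derivable f (c : R[i]) (rho M : R) : 0 < rho ->
  dd_bounded [set x | cmod (x - c) < rho] f M -> derivable f c 1.
Proof.
move=> rho0 h; set U := [set x | _] in h.
have Uc : U c by rewrite /U /= subrr cmod0.
have M0 : 0 <= M by apply: dd_bounded_ge0 h; exists c.
(* The limit is first found along a geometric sequence of real increments, for which the Lipschitz
   bounds telescope, and then transferred to all increments. *)
pose r n : R := rho / 2 ^+ n.+1.
have r0 n : 0 < r n by rewrite divr_gt0 ?exprn_gt0.
pose hh n : R[i] := (r n)%:C%C.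
have cr n : cmod (hh n) = r n by rewrite cmodR gtr0_norm.
have Ur n : U (hh n + c).
  rewrite /U /= addrK cr /r ltr_pdivrMr ?exprn_gt0 // ltr_pMr //.
  by rewrite exprn_egt1 // ltr1n.
have nc k : k != 0 -> k + c != c by move=> k0; rewrite -subr_eq0 addrK.
have hh0 n : hh n != 0 by rewrite -cmod_gt0 cr.
have UD k : cmod k < rho -> U (k + c) by rewrite /U /= addrK.
pose q k := dd1 f (k + c) c.
have qq k l : k != 0 -> l != 0 -> cmod k < rho -> cmod l < rho ->
    cmod (q k - q l) <= M * cmod (k - l).
  move=> k0 l0 kr lr; rewrite (le_trans (dd1_lipschitz h _ _ _ _ _)) ?nc //;
    try exact: UD.
  by rewrite opprD addrACA subrr addr0.
have hr n : cmod (hh n) < rho by have := Ur n; rewrite /U /= addrK.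
have /cvg_ex [d qd] : cvgn (q \o hh).
  apply: (@cvgn_cmod_summable R (q \o hh) (fun n => M * (r n - r n.+1)) (M * r 0%N)) => [n|m].
    apply: le_trans (qq _ _ (hh0 _) (hh0 _) (hr _) (hr _)) _.
    rewrite cmodC -rmorphB cmodR ger0_norm //.
    rewrite subr_ge0 /r (exprS _ n.+1) invfM mulrCA ler_piMl ?(ltW (r0 n)) //.
    by rewrite invf_le1 ?ler1n.
  rewrite -mulr_sumr ler_wpM2l //.
  under eq_bigr do rewrite -opprB.
  by rewrite sumrN telescope_sumr // opprB; have := r0 m; lra.
have rn0 : r @ \oo --> 0.
  rewrite -(mulr0 rho); apply: cvgMr.
  rewrite (_ : (fun n => _) = geometric (1 / 2) (1 / 2)); last first.
    by apply/funext => n; rewrite /geometric /= -exprVn exprS mul1r.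
  by apply: cvg_geometric; rewrite ger0_norm //; lra.
suff fd : forall e : R, 0 < e -> exists2 del : R, 0 < del & forall k, k != 0 ->
    cmod k < del -> cmod (d - (f (k + c) - f c) / k) < e.
  by have [] := derivable_cmodP fd.
move=> e e0; exists (Num.min rho (e / (4 * (M + 1)))).
  by rewrite lt_min rho0 /= divr_gt0 // mulr_gt0 //; lra.
move=> k k0; rewrite lt_min => /andP[kr ke].
move/cvg_cmodP : qd => /(_ (e / 4)) qd.
have e4 : 0 < e / 4 by lra.
have e4' : 0 < e / (4 * (M + 1)) by rewrite divr_gt0 // mulr_gt0 //; lra.
have [N _ hN] := filterI (qd e4) (proj1 (@cvgrPdist_lt _ _ _ _ _ _ _) rn0 _ e4').
have [/= h1 h2] := hN N (leqnn N); rewrite sub0r normrN gtr0_norm // in h2.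
have h3 := qq _ _ (hh0 N) k0 (hr N) kr.
have h4 := cmodB (hh N) k; rewrite cr in h4.
have -> : (f (k + c) - f c) / k = q k by rewrite /q /dd1 addrK.
have h5 := cmodD (d - q (hh N)) (q (hh N) - q k).
rewrite addrA subrK in h5.
have h6 : M * cmod (hh N - k) <= M * (2 * (e / (4 * (M + 1)))).
  by rewrite ler_wpM2l //; lra.
have h7 : M * (2 * (e / (4 * (M + 1)))) <= e / 2.
  rewrite (_ : M * _ = e / 2 * (M / (M + 1))); last by field; lra.
  by rewrite ler_piMr //; [lra|rewrite ler_pdivrMr; lra].
by move: h1; rewrite /=; lra.
Qed.

End DividedDifferences.

(** * The weights (1 - |a|^2) / (1 - conj a z) *)

Section DiskWeight.
Variable R : realType.
Implicit Types (a z : R[i]).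

Definition disk_weight a z : R[i] := (1 - (cmod a ^+ 2)%:C%C) / (1 - conjc a * z).

Lemma canonical_factorE (a : nat -> R[i]) s n z :
  canonical_factor a s n z = primary_factor (disk_weight (a n) z) s.
Proof. by []. Qed.

Lemma disk_weight_num a : in_disk a ->
  cmod (1 - (cmod a ^+ 2)%:C%C : R[i]) = 1 - cmod a ^+ 2.
Proof.
rewrite /in_disk => a1; rewrite -[1]/(1%:C%C) -rmorphB cmodR ger0_norm //.
by rewrite subr_ge0 expr_le1 ?cmod_ge0 // ltW.
Qed.

Lemma disk_den_ge_l a z : in_disk a -> cmod z <= 1 -> 1 - cmod a <= cmod (1 - conjc a * z).
Proof.
move=> a1 z1; have := cmodD (1 - conjc a * z) (conjc a * z).
rewrite subrK cmod1 cmodM cmodJ.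
have : cmod a * cmod z <= cmod a by rewrite ler_piMr ?cmod_ge0.
lra.
Qed.

Lemma disk_den_ge_r a z : in_disk a -> cmod z <= 1 -> 1 - cmod z <= cmod (1 - conjc a * z).
Proof.
move=> a1 z1; have := cmodD (1 - conjc a * z) (conjc a * z).
rewrite subrK cmod1 cmodM cmodJ.
have : cmod a * cmod z <= cmod z by rewrite ler_piMl ?cmod_ge0 // ltW.
lra.
Qed.

Lemma disk_den_ge_dist a z : in_disk a -> cmod z <= 1 ->
  cmod (a - z) <= cmod (1 - conjc a * z).
Proof.
move=> a1 z1; rewrite -(@ler_pXn2r _ 2) ?nnegrE ?cmod_ge0 // -subr_ge0.
have -> : cmod (1 - conjc a * z) ^+ 2 - cmod (a - z) ^+ 2 =
          (1 - cmod a ^+ 2) * (1 - cmod z ^+ 2).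
  rewrite !cmod_sqr; case: a {a1} => a b; case: z {z1} => x y /=.
  ring.
by rewrite mulr_ge0 // subr_ge0 expr_le1 ?cmod_ge0 // ltW.
Qed.

Lemma disk_den_neq0 a z : in_disk a -> cmod z <= 1 -> 1 - conjc a * z != 0.
Proof.
move=> a1 z1; rewrite -cmod_gt0; apply: lt_le_trans (disk_den_ge_l a1 z1).
by rewrite subr_gt0.
Qed.

Lemma disk_weight_diag a : in_disk a -> disk_weight a a = 1.
Proof.
move=> a1; rewrite /disk_weight.
have -> : (cmod a ^+ 2)%:C%C = conjc a * a.
  by rewrite cmod_sqr add_Re2_Im2 sqr_normc mulrC.
by rewrite divff // disk_den_neq0 // ltW.
Qed.

Lemma one_sub_disk_weight a z : in_disk a -> cmod z <= 1 ->
  1 - disk_weight a z = conjc a * (a - z) / (1 - conjc a * z).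
Proof.
move=> a1 z1; rewrite /disk_weight.
have -> : (cmod a ^+ 2)%:C%C = conjc a * a.
  by rewrite cmod_sqr add_Re2_Im2 sqr_normc mulrC.
by field; rewrite disk_den_neq0.
Qed.

Lemma cmod_disk_weight a z : in_disk a ->
  cmod (disk_weight a z) = (1 - cmod a ^+ 2) / cmod (1 - conjc a * z).
Proof. by move=> a1; rewrite /disk_weight cmodM cmodV disk_weight_num. Qed.

Lemma disk_weight_num_le a : in_disk a -> 1 - cmod a ^+ 2 <= 2 * (1 - cmod a).
Proof. by rewrite /in_disk; have := cmod_ge0 a; nra. Qed.

Lemma cmod_disk_weight_le2 a z : in_disk a -> cmod z <= 1 -> cmod (disk_weight a z) <= 2.
Proof.
move=> a1 z1; rewrite cmod_disk_weight // ler_pdivrMr ?cmod_gt0 ?disk_den_neq0 //.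
apply: (le_trans (disk_weight_num_le a1)); rewrite ler_wpM2l //.
exact: disk_den_ge_l.
Qed.

(** With u = 1 / (1 - conj a z), the divided differences are conj a u(x) u(y) and (conj a)^2 u(x)
    u(y) u(z). The three terms are at most del^-1, del^-2 and del^-3, together at most 3 / del^3.
    The factor 1 - |a| is kept since the convergence of the products on the smaller disk rests on
    it. *)
Lemma dd_bounded_disk_weight a (del : R) : in_disk a -> 0 < del -> del <= 1 ->
  dd_bounded [set z | cmod z <= 1 - del] (disk_weight a) (6 * (1 - cmod a) / del ^+ 3).
Proof.
move=> a1 d0 d1; rewrite /disk_weight.
have -> : 6 * (1 - cmod a) / del ^+ 3 = 2 * (1 - cmod a) * (3 / del ^+ 3) by lra.
apply: (@dd_boundedM _ _ (fun=> 1 - (cmod a ^+ 2)%:C%C) (fun z => (1 - conjc a * z)^-1)).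
  apply: (@dd_bounded_le _ _ _ (cmod (1 - (cmod a ^+ 2)%:C%C : R[i]))); last exact: dd_bounded_cst.
  by rewrite disk_weight_num // disk_weight_num_le.
set U := [set z | _]; pose u z := (1 - conjc a * z)^-1; rewrite -/u.
have U1 z : U z -> cmod z <= 1 by rewrite /U /=; lra.
have dn z : U z -> 1 - conjc a * z != 0 by move=> /U1; apply: disk_den_neq0.
have uU z : U z -> cmod (u z) <= del^-1.
  move=> Uz; rewrite /u cmodV lef_pV2 ?posrE ?cmod_gt0 ?dn //.
  apply: le_trans (disk_den_ge_r a1 (U1 _ Uz)).
  by move: Uz; rewrite /U /=; lra.
have id1 : 1 <= del^-1 by rewrite invf_ge1.
have id2 : del^-1 ^+ 2 <= del^-1 ^+ 3.
  by rewrite (exprS _ 2) ler_peMl // exprn_ge0 // invr_ge0 ltW.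
have id3 : del^-1 <= del^-1 ^+ 2 by rewrite expr2 ler_peMl // invr_ge0 ltW.
have ca1 : cmod (conjc a) <= 1 by rewrite cmodJ ltW.
have iv0 : 0 <= del^-1 by rewrite invr_ge0 ltW.
move=> x0 x1 y1 x2 y2 z2 u1 u2 u3 u4 u5 u6.
have e1 : cmod (dd1 u x1 y1) <= del^-1 ^+ 2.
  have [->|xy] := eqVneq x1 y1; first by rewrite dd1xx cmod0 exprn_ge0.
  have -> : dd1 u x1 y1 = conjc a * (u x1 * u y1).
    by rewrite /dd1 /u; field; rewrite ?dn // subr_eq0.
  rewrite -[leRHS]mul1r expr2.
  by apply: cmodM_le => //; apply: cmodM_le; apply: uU.
have e2 : cmod (dd2 u x2 y2 z2) <= del^-1 ^+ 3.
  rewrite /dd2; case: ifP => [_|]; first by rewrite cmod0 exprn_ge0.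
  move=> /negbT; rewrite !negb_or => /and3P[xy yz xz].
  have -> : (dd1 u x2 y2 - dd1 u y2 z2) / (x2 - z2) =
      conjc a * conjc a * (u x2 * (u y2 * u z2)).
    by rewrite /dd1 /u; field; rewrite ?dn // !subr_eq0 xz yz xy.
  rewrite (_ : del^-1 ^+ 3 = 1 * 1 * (del^-1 * (del^-1 * del^-1))); last by ring.
  by apply: cmodM_le; apply: cmodM_le => //; [|apply: cmodM_le]; apply: uU.
have e0 := uU _ u1.
rewrite exprVn in e1 e2 id2 id3.
rewrite -exprVn in e1 id2 id3 *.
by rewrite -exprVn in e2 *; lra.
Qed.

End DiskWeight.

(** * The primary factors *)

Section PolyMajorant.
Variable R : realType.
Implicit Types (p q : {poly R[i]}) (t M : R) (n : nat).

Definition cabs q : {poly R} := \poly_(i < size q) cmod q`_i.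

(** The value at t of the majorant with coefficients |q_i|. It is submultiplicative in q, and by
    [dd_bounded_horner] it transports norm bounds through composition with q. *)
Definition pnorm q t : R := (cabs q).[t].

Lemma coef_cabs q i : (cabs q)`_i = cmod q`_i.
Proof.
rewrite coef_poly; case: ltnP => // h.
by rewrite nth_default ?cmod0.
Qed.

Lemma le_horner_coef (p q : {poly R}) t : 0 <= t -> (forall i, p`_i <= q`_i) -> p.[t] <= q.[t].
Proof.
move=> t0 pq.
rewrite (horner_coef_wide t (leq_maxl (size p) (size q))).
rewrite (horner_coef_wide t (leq_maxr (size p) (size q))).
by apply: ler_sum => i _; rewrite ler_wpM2r ?exprn_ge0.
Qed.

Lemma le_horner_arg (p : {poly R}) t M : 0 <= t -> t <= M -> (forall i, 0 <= p`_i) -> p.[t] <= p.[M].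
Proof.
move=> t0 tM p0; rewrite !horner_coef; apply: ler_sum => i _.
by rewrite ler_wpM2l // lerXn2r // nnegrE // (le_trans t0).
Qed.

Lemma pnorm_ge0 q t : 0 <= t -> 0 <= pnorm q t.
Proof.
move=> t0; rewrite -[leLHS](horner0 t); apply: le_horner_coef => // i.
by rewrite coef0 coef_cabs cmod_ge0.
Qed.

Lemma pnormM p q t : 0 <= t -> pnorm (p * q) t <= pnorm p t * pnorm q t.
Proof.
move=> t0; rewrite /pnorm -hornerM; apply: le_horner_coef => // i.
rewrite coef_cabs !coefM; apply: (le_trans (cmod_sum _ _ _)).
by apply: ler_sum => j _; rewrite cmodM !coef_cabs.
Qed.

Lemma pnormD p q t : 0 <= t -> pnorm (p + q) t <= pnorm p t + pnorm q t.
Proof.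
move=> t0; rewrite /pnorm -hornerD; apply: le_horner_coef => // i.
by rewrite coefD !coef_cabs coefD cmodD.
Qed.

Lemma pnormZ c p t : pnorm (c *: p) t = cmod c * pnorm p t.
Proof.
rewrite /pnorm -hornerZ; congr horner; apply/polyP => i.
by rewrite coefZ !coef_cabs coefZ cmodM.
Qed.

Lemma pnorm1 t : pnorm 1 t = 1.
Proof.
rewrite /pnorm (_ : cabs 1 = 1) ?hornerC //; apply/polyP => i.
by rewrite coef_cabs !coef1; case: eqP; rewrite ?cmod1 ?cmod0.
Qed.

Lemma pnormN p t : pnorm (- p) t = pnorm p t.
Proof. by rewrite /pnorm; congr horner; apply/polyP => i; rewrite !coef_cabs coefN cmodN. Qed.

Lemma pnormpX t : pnorm 'X t = t.
Proof.
rewrite /pnorm (_ : cabs 'X = 'X) ?hornerX //; apply/polyP => i.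
by rewrite coef_cabs !coefX; case: eqP; rewrite ?cmod1 ?cmod0.
Qed.

Lemma pnormX p t n : 0 <= t -> pnorm (p ^+ n) t <= pnorm p t ^+ n.
Proof.
move=> t0; elim: n => [|n ih]; first by rewrite !expr0 pnorm1.
rewrite !exprS; apply: (le_trans (pnormM _ _ t0)).
by rewrite ler_wpM2l // pnorm_ge0.
Qed.

Lemma cmod_coef_pnorm q i : cmod q`_i <= pnorm q 1.
Proof.
rewrite /pnorm -coef_cabs horner_coef.
have [h|h] := ltnP i (size (cabs q)); last first.
  by rewrite nth_default // sumr_ge0 // => j _; rewrite coef_cabs expr1n mulr1 cmod_ge0.
rewrite (bigD1 (Ordinal h)) //= expr1n mulr1 lerDl sumr_ge0 // => j _.
by rewrite coef_cabs expr1n mulr1 cmod_ge0.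
Qed.

Lemma dd_bounded_horner U (w : R[i] -> R[i]) M q : dd_bounded U w M ->
  dd_bounded U (fun z => q.[w z]) (pnorm q M).
Proof.
move=> h; under eq_fun do rewrite horner_coef.
have le : (size (cabs q) <= size q)%N by apply: size_poly.
rewrite /pnorm (horner_coef_wide _ le).
apply: dd_bounded_sum => i _; rewrite coef_cabs.
exact: (dd_boundedM (dd_bounded_cst q`_i) (dd_boundedX i h)).
Qed.

End PolyMajorant.

(** * The complex exponential as a limit of powers *)

Section Cexp.
Variable R : realType.
Implicit Types (w z : R[i]).

Lemma cexpD z w : cexp (z + w) = cexp z * cexp w.
Proof.
case: z => a b; case: w => c d; rewrite /cexp /= expRD cosD sinD.
by apply/eqP; rewrite eq_complex /=; apply/andP; split; apply/eqP; ring.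
Qed.

Lemma cexp0 : cexp (0 : R[i]) = 1.
Proof. by rewrite /cexp /= expR0 cos0 sin0 mul1r. Qed.

Lemma cexpMn w n : cexp (w *+ n) = cexp w ^+ n.
Proof.
elim: n => [|n ih]; first by rewrite mulr0n cexp0.
by rewrite mulrS cexpD ih exprS.
Qed.

Lemma cmod_cexp w : cmod (cexp w) = expR (complex.Re w).
Proof.
rewrite /cexp cmodM cmodR ger0_norm ?expR_ge0 //.
rewrite (_ : cmod (_ +i* _)%C = 1) ?mulr1 //.
apply/eqP; rewrite -(@eqrXn2 _ 2) ?cmod_ge0 // cmod_sqr /= expr1n.
by rewrite cos2Dsin2.
Qed.

(** The derivative at t = 0 of exp(t w), taken along t = 1 / (n + 1) and computed separately on the
    real and imaginary parts, since [cexp] is built from real functions. *)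
Lemma cexp_quotient_cvg w :
  n.+1%:R * (cexp (w / n.+1%:R) - 1) @[n --> \oo] --> w.
Proof.
case: w => x y.
have dseq (g : R -> R) (d : R) : is_derive (0:R) 1 g d ->
    n.+1%:R * (g (n.+1%:R^-1) - g 0) @[n --> \oo] --> d.
  move=> gd; have [dg <-] := gd.
  have hn0 : harmonic @ \oo --> (0 : R) by apply: cvg_harmonic.
  have hN0 n : harmonic n != 0 :> R by rewrite /harmonic invr_neq0.
  have c : (fun h => h^-1 *: (g (h *: 1 + 0) - g 0)) @ (0 : R)^' --> 'D_1 g 0 by exact: dg.
  have := (proj1 (cvgr_dnbhsP _ _ _)) c _ (conj hN0 hn0).
  rewrite /harmonic /GRing.scale /=.
  by under eq_fun do rewrite invrK mulr1 addr0.
have c1 : n.+1%:R * (expR (x * n.+1%:R^-1) * cos (y * n.+1%:R^-1) - 1) @[n --> \oo] --> x.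
  pose g t := expR (x * t) * cos (y * t).
  have g0 : g 0 = 1 by rewrite /g !mulr0 expR0 cos0 mulr1.
  have := dseq g x; rewrite g0; apply.
  apply: is_derive_eq; rewrite !mulr0 expR0 cos0 sin0 /GRing.scale /=.
  by ring.
have c2 : n.+1%:R * (expR (x * n.+1%:R^-1) * sin (y * n.+1%:R^-1)) @[n --> \oo] --> y.
  pose g t := expR (x * t) * sin (y * t).
  have g0 : g 0 = 0 by rewrite /g !mulr0 expR0 sin0 mulr0.
  have := dseq g y; rewrite g0.
  under eq_fun do rewrite subr0.
  apply; apply: is_derive_eq; rewrite !mulr0 expR0 cos0 sin0 /GRing.scale /=.
  by ring.
apply/cvg_cmodP => e e0.
have e2 : 0 < e / 2 by lra.
move/cvgrPdist_lt : c1 => /(_ _ e2) c1.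
move/cvgrPdist_lt : c2 => /(_ _ e2) c2.
near=> n.
apply: le_lt_trans (cmod_le_ReIm _) _.
have h1 : `|x - n.+1%:R * (expR (x * n.+1%:R^-1) * cos (y * n.+1%:R^-1) - 1)| < e / 2 by near: n.
have h2 : `|y - n.+1%:R * (expR (x * n.+1%:R^-1) * sin (y * n.+1%:R^-1))| < e / 2 by near: n.
have -> : (x +i* y)%C / n.+1%:R = (x * n.+1%:R^-1 +i* (y * n.+1%:R^-1))%C.
  rewrite -(rmorph_nat (real_complex R)) -fmorphV /=.
  by apply/eqP; rewrite eq_complex /= !mulr0 subr0 add0r !eqxx.
rewrite /cexp /= -(rmorph_nat (real_complex R)) /=.
  by rewrite !mul0r ?subr0 ?addr0; lra.
Unshelve. all: by end_near. Qed.

(** With N = n + 1, a = exp(w / N) and b = 1 + w / N, both moduli are at most exp(|w| / N).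
    Factoring gives |a^N - b^N| <= N |a - b| exp(|w|), and N (a - b) = N (a - 1) - w tends to 0. *)
Lemma cexp_lim w : (1 + w / n.+1%:R) ^+ n.+1 @[n --> \oo] --> cexp w.
Proof.
apply/cvg_cmodP => e e0.
pose K := expR (cmod w).
have K0 : 0 < K by apply: expR_gt0.
have /cvg_cmodP cq := @cexp_quotient_cvg w.
move: (cq _ (divr_gt0 e0 K0)); apply: filterS => n.
set b := 1 + _; set a := cexp _ => h.
have N0 : n.+1%:R != 0 :> R[i] by rewrite pnatr_eq0.
have -> : cexp w = a ^+ n.+1 by rewrite -cexpMn -(mulr_natr (w / _)) divfK.
pose k := expR (cmod w / n.+1%:R).
have ak : cmod a <= k.
  rewrite cmod_cexp ler_expR -(cmod_nat R n.+1) -cmodV -cmodM.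
  exact: le_trans (ler_norm _) (Re_le_cmod _).
have bk : cmod b <= k.
  apply: (le_trans (cmodD _ _)); rewrite cmod1 cmodM cmodV cmod_nat.
  by apply: expR_ge1Dx.
have kK : k ^+ n <= K.
  rewrite -expRM_natl ler_expR mulrCA ler_piMr ?cmod_ge0 //.
  by rewrite ler_pdivrMr // mul1r ler_nat.
have ab : a - b = (n.+1%:R * (a - 1) - w) / n.+1%:R by rewrite /b; field.
rewrite subrXX cmodM ab cmodM cmodV cmod_nat -(cmodC w).
have S : cmod (\sum_(i < n.+1) a ^+ (n.+1.-1 - i) * b ^+ i) <= n.+1%:R * K.
  apply: (le_trans (cmod_sum _ _ _)).
  rewrite -[n.+1 in leRHS]card_ord -sumr_const mulr_suml; apply: ler_sum => i _.
  rewrite mul1r; apply: le_trans kK.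
  have -> : k ^+ n = k ^+ (n - i) * k ^+ i by rewrite -exprD subnK // -ltnS.
  by apply: cmodM_le; rewrite cmodX lerXn2r // ?nnegrE ?cmod_ge0 ?expR_ge0.
rewrite ltr_pdivlMr // in h.
apply: le_lt_trans h; rewrite -mulrA ler_wpM2l ?cmod_ge0 //.
by rewrite mulrC ler_pdivrMr // mulrC.
Qed.

End Cexp.

(** * The order of vanishing of E(w, s) - 1 at w = 0 *)

Section PrimaryFactor.
Variable R : realType.
Implicit Types (p q : {poly R[i]}) (t M X : R) (n s : nat).

Definition logpoly s : {poly R[i]} := \sum_(1 <= j < s.+1) (j%:R^-1) *: 'X^j.

Lemma natrV_mulrn n : n.+1%:R^-1 *+ n.+1 = 1 :> R[i].
Proof. by rewrite -(mulr_natr (_^-1)) mulVf // pnatr_eq0. Qed.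

Lemma horner_logpoly s (w : R[i]) : (logpoly s).[w] = \sum_(1 <= j < s.+1) w ^+ j / j%:R.
Proof.
rewrite /logpoly horner_sum; apply: eq_bigr => j _.
by rewrite hornerZ hornerXn mulrC.
Qed.

(** This cancellation is behind E(w, s) = 1 + O(w^(s+1)): it says that (1 - X) exp(p) has derivative
    - X^s exp(p), where p is [logpoly s], the truncation of -log(1 - X). *)
Lemma deriv_logpoly s : (1 - 'X) * (logpoly s)^`() = 1 - 'X^s.
Proof.
have -> : (logpoly s)^`() = \sum_(i < s) 'X^i.
  rewrite /logpoly big_add1 /= big_mkord raddf_sum /=; apply: eq_bigr => j _.
  by rewrite derivZ derivXn /= -scalerMnr scalerMnl natrV_mulrn scale1r.
by rewrite -[LHS]opprK -mulNr opprB -subrX1 opprB.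
Qed.

(* Polynomial approximation of E(., s) with exp p replaced by (1 + p / N)^N. *)
Definition primary_poly s n : {poly R[i]} :=
  (1 - 'X) * (1 + n.+1%:R^-1 *: logpoly s) ^+ n.+1.

Lemma horner_primary_poly_cvg s (w : R[i]) :
  (primary_poly s n).[w] @[n --> \oo] --> primary_factor w s.
Proof.
rewrite /primary_factor /primary_poly.
under eq_fun do rewrite hornerM horner_exp !hornerE.
apply: cvgMr; rewrite -horner_logpoly.
under eq_fun do rewrite mulrC.
exact: cexp_lim.
Qed.

Lemma pnorm_binom1 p t n : 0 <= t ->
  pnorm (1 + n.+1%:R^-1 *: p) t <= expR (pnorm p t / n.+1%:R).
Proof.
move=> t0; apply: (le_trans (pnormD _ _ t0)).
rewrite pnorm1 pnormZ cmodV cmod_nat mulrC; exact: expR_ge1Dx.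
Qed.

Lemma pnorm_binom p t n : 0 <= t ->
  pnorm (1 + n.+1%:R^-1 *: p) t ^+ n.+1 <= expR (pnorm p t).
Proof.
move=> t0; set k := pnorm p t.
apply: (@le_trans _ _ (expR (k / n.+1%:R) ^+ n.+1)).
  by rewrite lerXn2r ?nnegrE ?pnorm_ge0 ?expR_ge0 // pnorm_binom1.
by rewrite -expRM_natl mulrC divfK.
Qed.

Lemma pnorm_primary_poly s n t : 0 <= t ->
  pnorm (primary_poly s n) t <= (1 + t) * expR (pnorm (logpoly s) t).
Proof.
move=> t0; apply: (le_trans (pnormM _ _ t0)).
rewrite ler_pM ?pnorm_ge0 //.
  by apply: (le_trans (pnormD _ _ t0)); rewrite pnormN pnormpX pnorm1.
apply: le_trans (pnormX _ _ t0) _; exact: pnorm_binom.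
Qed.

Lemma coef0_primary_poly s n : (primary_poly s n)`_0 = 1.
Proof.
rewrite -horner_coef0 /primary_poly hornerM horner_exp !hornerE horner_logpoly.
rewrite big_nat big1; first by rewrite subr0 mulr0 addr0 expr1n mul1r.
by move=> j /andP[j1 _]; rewrite expr0n eqn0Ngt j1 mul0r.
Qed.

(** For the approximation the cancellation is not exact. With N = n + 1 and r = 1 + p / N, the
    derivative is - X^s r^n - (p / N) r^n; the first term has no coefficient of index below s, and
    those of the second are O(1 / N). *)
Lemma coef_primary_poly s n i : (i < s)%N ->
  cmod (primary_poly s n)`_i.+1 <=
  pnorm (logpoly s) 1 * expR (pnorm (logpoly s) 1) / n.+1%:R.
Proof.
move=> si; set p := logpoly s; set k := pnorm p 1.
have -> : k * expR k / n.+1%:R = n.+1%:R^-1 * k * expR k by ring.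
set r := (1 + n.+1%:R^-1 *: p).
have D : (primary_poly s n)^`() = - ((n.+1%:R^-1 *: p) * r ^+ n) - 'X^s * r ^+ n.
  rewrite /primary_poly derivM derivB derivC derivX sub0r deriv_exp.
  rewrite derivD derivC add0r derivZ -/r /= -/p.
  rewrite [X in (_ + _ * X)](_ : _ = p^`() * r ^+ n); last first.
    by rewrite -mulrnAl scalerMnl natrV_mulrn scale1r.
  rewrite mulrA deriv_logpoly exprS (_ : -1 * (r * _) = - (1 + n.+1%:R^-1 *: p) * r ^+ n); last by rewrite mulN1r mulNr.
  by set x := (_ *: p); ring.
have := coef_deriv (primary_poly s n) i.
rewrite D coefB coefXnM si subr0 => E.
have h1 : cmod (primary_poly s n)`_i.+1 <= cmod ((primary_poly s n)`_i.+1 *+ i.+1).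
  rewrite -mulr_natr cmodM cmod_nat ler_peMr ?cmod_ge0 // ler1n //.
apply: (le_trans h1); rewrite -E coefN cmodN.
apply: (le_trans (cmod_coef_pnorm _ _)).
apply: (le_trans (pnormM _ _ ler01)); rewrite pnormZ cmodV cmod_nat.
rewrite ler_wpM2l // ?mulr_ge0 ?pnorm_ge0 ?invr_ge0 //.
have r1 : 1 <= expR (k / n.+1%:R).
  rewrite -expR0 ler_expR divr_ge0 // pnorm_ge0 //.
apply: (le_trans (pnormX _ _ ler01)).
have h : pnorm r 1 <= expR (k / n.+1%:R) by exact: pnorm_binom1.
apply: (@le_trans _ _ (expR (k / n.+1%:R) ^+ n)).
  by rewrite lerXn2r ?nnegrE ?pnorm_ge0 ?expR_ge0.
apply: (@le_trans _ _ (expR (k / n.+1%:R) ^+ n.+1)).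
  by rewrite exprS ler_peMl // exprn_ge0 // expR_ge0.
by rewrite -expRM_natl mulrC divfK.
Qed.

Definition primary_const s X : R := (1 + X) * expR (pnorm (logpoly s) X).

(** Obtaining M^(s+1) in the divided-difference norm, and not only for the modulus, lets whole
    products be bounded in that norm. The majorant is split at degree s + 1: the low part is O(1 /
    n) and disappears in the limit. *)
Lemma dd_bounded_primary_factor s X M (U : set R[i]) (w : R[i] -> R[i]) :
  1 <= X -> 0 <= M -> M <= X -> dd_bounded U w M ->
  dd_bounded U (fun z => primary_factor (w z) s - 1) (primary_const s X * M ^+ s.+1).
Proof.
move=> X1 M0 MX h.
have X0 : 0 <= X by lra.
pose kap := pnorm (logpoly s) 1 * expR (pnorm (logpoly s) 1).
have kap0 : 0 <= kap by rewrite mulr_ge0 ?pnorm_ge0 ?expR_ge0.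
pose S := (\poly_(i < s.+1) (1 : R)).[M].
have main n : pnorm (primary_poly s n - 1) M <=
    kap / n.+1%:R * S + primary_const s X * M ^+ s.+1.
  (* The part of the majorant of degree at least s + 1, divided by X^(s+1). Its value at M is at
     most its value at X, where X >= 1 allows the removed power to be restored. *)
  pose r2 := drop_poly s.+1 (cabs (primary_poly s n)).
  have r2X : r2.[M] <= primary_const s X.
    apply: le_trans (pnorm_primary_poly s n X0).
    have r20 i : 0 <= r2`_i by rewrite coef_drop_poly coef_cabs cmod_ge0.
    apply: (le_trans (le_horner_arg M0 MX r20)).
    have r2X0 : 0 <= r2.[X].
      by rewrite horner_coef sumr_ge0 // => i _; rewrite mulr_ge0 // exprn_ge0.
    have st1 : r2.[X] <= ('X^(s.+1) * r2).[X].
      by rewrite hornerM hornerXn ler_peMl // exprn_ege1.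
    apply: (le_trans st1); apply: le_horner_coef => // i; rewrite coefXnM.
    case: ltnP => si; first by rewrite coef_cabs cmod_ge0.
    by rewrite coef_drop_poly subnK.
  apply: (@le_trans _ _ ((kap / n.+1%:R) *: (\poly_(i < s.+1) (1 : R)) + 'X^(s.+1) * r2).[M]).
    apply: le_horner_coef => // i.
    rewrite coef_cabs coefB coef1 coefD coefZ coef_poly coefXnM.
    case: i => [|i].
      by rewrite coef0_primary_poly subrr cmod0 /= addr0 mulr1 divr_ge0.
    rewrite subr0 ltnS; case: ltnP => si.
      by rewrite mulr1 addr0; apply: coef_primary_poly.
    by rewrite mulr0 add0r coef_drop_poly coef_cabs subnK.
  rewrite hornerD hornerZ hornerM hornerXn lerD2l mulrC.
  by rewrite ler_wpM2r // exprn_ge0.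
apply: (@dd_bounded_lim _ _ (fun n z => (primary_poly s n - 1).[w z]) _
  (fun n => kap / n.+1%:R * S + primary_const s X * M ^+ s.+1)).
- move=> x _; rewrite /=; under eq_fun do rewrite hornerD hornerN hornerC.
  exact: (cvgB (@horner_primary_poly_cvg s (w x)) (cvg_cst _)).
- by move=> n; exact: dd_bounded_le (main n) (dd_bounded_horner _ h).
- rewrite -[X in _ --> X]add0r; apply: cvgD; last exact: cvg_cst.
  rewrite -(mul0r S); apply: cvgMl; rewrite -(mulr0 kap); apply: cvgMr.
  exact: cvg_harmonic.
Qed.

Lemma primary_factor_sub1 s X (w : R[i]) : 1 <= X -> cmod w <= X ->
  cmod (primary_factor w s - 1) <= primary_const s X * cmod w ^+ s.+1.
Proof.
move=> X1 wX.
have h : dd_bounded [set w] id (cmod w) by apply: dd_bounded1.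
by apply: (dd_bounded_cmod (dd_bounded_primary_factor s X1 (cmod_ge0 w) wX h)).
Qed.

Lemma primary_factor1 s : primary_factor (1 : R[i]) s = 0.
Proof. by rewrite /primary_factor subrr mul0r. Qed.

Lemma Re_logpoly_le s X (w : R[i]) : cmod w <= X ->
  `|complex.Re (\sum_(1 <= j < s.+1) w ^+ j / j%:R)| <= pnorm (logpoly s) X.
Proof.
move=> wX; rewrite -horner_logpoly; apply: (le_trans (Re_le_cmod _)).
have h : dd_bounded [set w] id (cmod w) by apply: dd_bounded1.
apply: (le_trans (dd_bounded_cmod (dd_bounded_horner (logpoly s) h) erefl)).
by apply: le_horner_arg => // [|i]; rewrite ?coef_cabs cmod_ge0.
Qed.

Lemma cmod_primary_factor s (w : R[i]) : cmod (primary_factor w s) =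
  cmod (1 - w) * expR (complex.Re (\sum_(1 <= j < s.+1) w ^+ j / j%:R)).
Proof. by rewrite /primary_factor cmodM cmod_cexp. Qed.

Lemma primary_factor_ge s X (w : R[i]) : cmod w <= X ->
  cmod (1 - w) * expR (- pnorm (logpoly s) X) <= cmod (primary_factor w s).
Proof.
move=> /(Re_logpoly_le s); rewrite ler_norml => /andP[h _].
by rewrite cmod_primary_factor ler_wpM2l ?cmod_ge0 // ler_expR.
Qed.

Lemma primary_factor_le s X (w : R[i]) : cmod w <= X ->
  cmod (primary_factor w s) <= cmod (1 - w) * expR (pnorm (logpoly s) X).
Proof.
move=> /(Re_logpoly_le s); rewrite ler_norml => /andP[_ h].
by rewrite cmod_primary_factor ler_wpM2l ?cmod_ge0 // ler_expR.
Qed.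

End PrimaryFactor.

(** * Growth of psi *)

Section Growth.
Variable R : realType.

Definition dylog (x : R) : nat := trunc_log 2 (Num.truncn x).

Lemma dylogP (x : R) : 1 <= x -> 2 ^+ dylog x <= x < 2 ^+ (dylog x).+1.
Proof.
move=> x1.
have /andP[h1 h2] := truncn_itv (le_trans ler01 x1).
have t0 : (0 < Num.truncn x)%N.
  by rewrite lt0n; apply/eqP => t0; rewrite t0 in h2; lra.
have /andP[g1 g2] := trunc_log_bounds (isT : (1 < 2)%N) t0.
apply/andP; split.
  by apply: le_trans h1; rewrite -natrX ler_nat.
by apply: lt_le_trans h2 _; rewrite -natrX ler_nat.
Qed.

Variable psi : R -> R.
Hypothesis psi_ge0 : forall x, 1 <= x -> 0 <= psi x.
Hypothesis psi_nd : {in `[1, +oo[ &, {homo psi : x y / x <= y}}.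

Lemma psi_le x y : 1 <= x -> x <= y -> psi x <= psi y.
Proof. by move=> x1 xy; apply: psi_nd; rewrite // in_itv /= andbT //; lra. Qed.

Local Notation mu := (@lebesgue_measure R).

Lemma psi_integrable a b : 1 <= a -> mu.-integrable `[a, b] (EFin \o (fun t => psi t / t)).
Proof.
move=> a1; apply: measurable_bounded_integrable => //=.
- rewrite lebesgue_measure_itv /=.
  by case: ifPn => // _; rewrite -EFinB ltry.
(* Both factors are monotone only on [1, +oo[; precomposition with max 1 makes them monotone on the
   line, hence measurable. *)
- apply: measurable_funM; last first.
    apply: (@eq_measurable_fun _ _ _ _ _ (fun t : R => (Num.max 1 t)^-1)).
      move=> t; rewrite inE /= in_itv /= => /andP[at1 _].
      by rewrite max_r //; lra.
    apply: nonincreasing_measurable => // x y xy.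
    by rewrite lef_pV2 ?posrE ?lt_max ?ltr01 // ge_max !le_max lexx xy orbT.
  apply: (@eq_measurable_fun _ _ _ _ _ (fun t : R => psi (Num.max 1 t))).
    move=> t; rewrite inE /= in_itv /= => /andP[at1 _].
    by rewrite max_r //; lra.
  apply: nondecreasing_measurable => // x y xy.
  apply: psi_le; first by rewrite le_max lexx.
  by rewrite ge_max !le_max lexx xy orbT.
- exists (psi (Num.max 1 b)); split; rewrite ?num_real // => M Mb x /=.
  rewrite in_itv /= => /andP[ax xb].
  have x1 : 1 <= x by lra.
  rewrite ger0_norm; last by rewrite divr_ge0 ?psi_ge0 //; lra.
  apply: le_trans (ltW Mb).
  apply: (@le_trans _ _ (psi x)).
    by rewrite ler_pdivrMr ?ler_peMr ?psi_ge0 //; lra.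
  by apply: psi_le => //; rewrite le_max xb orbT.
Qed.

Lemma Rintegral_itv_cst a b (c : R) : a <= b -> \int[mu]_(t in `]a, b]) c = c * (b - a).
Proof.
move=> ab; rewrite Rintegral_cst //; congr (c * _).
transitivity (fine (if (a%:E < b%:E)%E then b%:E - a%:E else 0)%E).
  congr fine; exact: (lebesgue_measure_itv `]a, b]).
rewrite lte_fin; case: ltP => [_|ba]; first by rewrite -EFinB.
by rewrite (_ : b = a) ?subrr // ; apply/eqP; rewrite eq_le ab ba.
Qed.

Lemma psi_tilde_sub x y : 1 <= x -> x <= y ->
  psi_tilde psi y - psi_tilde psi x = \int[mu]_(t in `]x, y]) (psi t / t).
Proof.
move=> x1 xy; rewrite /psi_tilde Rintegral_itvB ?bnd_simp //.
exact: psi_integrable.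
Qed.

Let psi_integrable_oc x y : 1 <= x -> mu.-integrable `]x, y] (EFin \o (fun t => psi t / t)).
Proof.
move=> x1; apply: integrableS (psi_integrable y x1) => //.
by apply: subset_itv; rewrite bnd_simp.
Qed.

Let cst_integrable x y (c : R) : mu.-integrable `]x, y] (EFin \o (fun=> c)).
Proof.
apply: measurable_bounded_integrable => //=.
  by rewrite lebesgue_measure_itv /=; case: ifPn => // _; rewrite -EFinB ltry.
exact: bounded_cst.
Qed.

Lemma psi_tilde_lower x y : 1 <= x -> x <= y ->
  psi x * (y - x) / y <= psi_tilde psi y - psi_tilde psi x.
Proof.
move=> x1 xy; rewrite psi_tilde_sub //.
have -> : psi x * (y - x) / y = psi x / y * (y - x) by ring.
rewrite -Rintegral_itv_cst //; apply: le_Rintegral => //; first exact: psi_integrable_oc.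
move=> t /=; rewrite in_itv /= => /andP[xt ty].
rewrite ler_pM ?psi_ge0 ?invr_ge0 //; try lra.
  by apply: psi_le => //; lra.
by rewrite lef_pV2 ?posrE //; lra.
Qed.

Lemma psi_tilde_upper x y : 1 <= x -> x <= y ->
  psi_tilde psi y - psi_tilde psi x <= psi y * (y - x) / x.
Proof.
move=> x1 xy; rewrite psi_tilde_sub //.
have -> : psi y * (y - x) / x = psi y / x * (y - x) by ring.
rewrite -Rintegral_itv_cst //; apply: le_Rintegral => //; first exact: psi_integrable_oc.
move=> t /=; rewrite in_itv /= => /andP[xt ty].
rewrite ler_pM ?psi_ge0 ?invr_ge0 //; try lra.
  by apply: psi_le => //; lra.
by rewrite lef_pV2 ?posrE //; lra.
Qed.

Lemma psi_tilde1 : psi_tilde psi 1 = 0.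
Proof. by rewrite /psi_tilde set_itv1 Rintegral_set1. Qed.

Lemma psi_tilde_le x y : 1 <= x -> x <= y -> psi_tilde psi x <= psi_tilde psi y.
Proof.
move=> x1 xy; have := psi_tilde_lower x1 xy.
have : 0 <= psi x * (y - x) / y by rewrite divr_ge0 ?mulr_ge0 ?psi_ge0 //; lra.
lra.
Qed.

Lemma psi_tilde_ge0 x : 1 <= x -> 0 <= psi_tilde psi x.
Proof. by move=> x1; rewrite -psi_tilde1 psi_tilde_le. Qed.

Hypothesis psi_unbounded : forall A : R, exists2 x, 1 <= x & A < psi x.
Hypothesis psi_doubling : exists2 K : R, 0 < K &
     \forall x \near +oo, psi (2 * x) <= K * psi x.

(** The summand 1 covers the bounded range below the threshold of the asymptotic condition, where
    psi may vanish. *)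
Lemma psi_double : exists2 K, 1 <= K & forall x, 1 <= x -> psi (2 * x) <= K * (psi x + 1).
Proof.
have [K K0 [A [_ hA]]] := psi_doubling.
pose B := Num.max 1 (A + 1).
have B1 : 1 <= B by rewrite le_max lexx.
exists (1 + K + psi (2 * B)) => [|x x1].
  by have : 0 <= psi (2 * B); [apply: psi_ge0; lra|lra].
have p0 := psi_ge0 x1; have pB : 0 <= psi (2 * B) by apply: psi_ge0; lra.
have [xB|Bx] := leP x B.
  have : psi (2 * x) <= psi (2 * B) by apply: psi_le; lra.
  nra.
have : psi (2 * x) <= K * psi x by apply: hA; move: Bx; rewrite gt_max => /andP[]; lra.
nra.
Qed.

(** The increment T(2x) - T(x) is at most psi(2x), which two doublings compare with psi(x / 2); the
    latter is at most 2 (T(x) - T(x / 2)). For x <= 2, where x / 2 may leave the domain, psi(4)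
    serves as a bound. *)
Lemma psi_tilde_double : exists2 K, 1 <= K &
  forall x, 1 <= x -> psi_tilde psi (2 * x) <= K * (psi_tilde psi x + 1).
Proof.
have [K K1 hK] := psi_double.
pose T := psi_tilde psi.
have p2 : 0 <= psi 2 by apply: psi_ge0; lra.
exists (1 + psi 2 + psi 4 + K * (4 * K)) => [|x x1].
  have p4 : 0 <= psi 4 by apply: psi_ge0; lra.
  nra.
have p4 : 0 <= psi 4 by apply: psi_ge0; lra.
have T0 := psi_tilde_ge0 x1.
have h1 : T (2 * x) - T x <= psi (2 * x).
  apply: (le_trans (psi_tilde_upper x1 _)); first lra.
  by rewrite (_ : _ / x = psi (2 * x)) //; field; lra.
rewrite -/T in T0 *.
have [x2|x2] := leP x 2.
  have : psi (2 * x) <= psi 4 by apply: psi_le; lra.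
  nra.
have h2 : psi (2 * x) <= K * (psi x + 1) by apply: hK.
have h3 : psi x <= K * (psi (x / 2) + 1).
  by have := hK (x / 2); rewrite mulrCA divff ?mulr1 //; apply; lra.
have h4 : psi (x / 2) / 2 <= T x - T (x / 2).
  apply: le_trans (psi_tilde_lower _ _); try lra.
  by rewrite (_ : _ / x = psi (x / 2) / 2) //; field; lra.
have h5 : 0 <= T (x / 2) by apply: psi_tilde_ge0; lra.
have h6 : psi (x / 2) <= 2 * T x by lra.
have h7 : psi x <= K * (2 * T x + 1) by apply: (le_trans h3); rewrite ler_wpM2l; lra.
have h8 : psi (2 * x) <= K * (K * (2 * T x + 1) + 1).
  by apply: (le_trans h2); rewrite ler_wpM2l; lra.
have : 0 <= K * K * T x by rewrite !mulr_ge0 //; lra.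
nra.
Qed.

(** Once psi exceeds 2 A, each doubling of x adds at least psi(x) / 2 >= A to T, while it adds ln 2
    <= 1 to ln x. *)
Lemma psi_tilde_superlog A : exists2 B, 0 <= B &
  forall x, 1 <= x -> A * ln x <= psi_tilde psi x + B.
Proof.
wlog A0 : A / 0 <= A.
  move=> h; have [A0|A0] := leP 0 A; first exact: h.
  have [B B0 hB] := h 0 (lexx _).
  exists B => // x x1; apply: le_trans (hB x x1); rewrite mul0r.
  by rewrite mulr_le0_ge0 ?ln_ge0 // ltW.
have [x0 x01 hx0] := psi_unbounded (2 * A).
pose T := psi_tilde psi.
have step n : A * n%:R <= T (x0 * 2 ^+ n).
  elim: n => [|n ih]; first by rewrite mulr0 psi_tilde_ge0 // expr0 mulr1.
  have y0 : x0 <= x0 * 2 ^+ n by rewrite ler_peMr ?exprn_ege1 //; lra.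
  have y1 : 1 <= x0 * 2 ^+ n by lra.
  rewrite exprS (mulrCA x0); set y := x0 * 2 ^+ n in ih y0 y1 *.
  have h1 := psi_le x01 y0.
  have h2 : psi y * (2 * y - y) / (2 * y) <= T (2 * y) - T y.
    by apply: psi_tilde_lower => //; lra.
  rewrite (_ : psi _ * _ / _ = psi y / 2) in h2; last by field; lra.
  by rewrite -natr1 mulrDr mulr1; lra.
have l2 : ln 2 <= 1 :> R by have := @le_ln1Dx R 1; rewrite (_ : 1 + 1 = 2) //; apply; lra.
exists (A * (ln x0 + 1)) => [|x x1].
  by rewrite mulr_ge0 // addr_ge0 // ln_ge0.
have Tx := psi_tilde_ge0 x1; have lx0 := ln_ge0 x01.
have [xx|xx] := leP x x0.
  have : A * ln x <= A * ln x0 by rewrite ler_wpM2l // ler_ln ?posrE //; lra.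
  nra.
have [n /andP[n1 n2]] : exists n : nat, 2 ^+ n <= x / x0 < 2 ^+ n.+1.
  by exists (dylog (x / x0)); apply: dylogP; rewrite ler_pdivlMr; lra.
rewrite ler_pdivlMr in n1; last lra.
rewrite ltr_pdivrMr in n2; last lra.
have h1 : ln x <= ln x0 + n.+1%:R.
  apply: (@le_trans _ _ (ln (2 ^+ n.+1 * x0))).
    by rewrite ler_ln ?posrE ?mulr_gt0 ?exprn_gt0 //; lra.
  rewrite lnM ?posrE ?exprn_gt0 //; last lra.
  by rewrite lnXn // addrC lerD2l -[n.+1%:R]/(1 *+ n.+1) lerMn2r l2 orbT.
have h2 := step n.
have h3 : T (x0 * 2 ^+ n) <= T x.
  apply: psi_tilde_le; last by rewrite mulrC.
  have : x0 <= x0 * 2 ^+ n by rewrite ler_peMr ?exprn_ege1 //; lra.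
  lra.
have h4 : A * ln x <= A * (ln x0 + n.+1%:R) by rewrite ler_wpM2l.
rewrite -natr1 in h4; rewrite -/T.
nra.
Qed.

(** For j < J the bound psi(2^j) <= 2 (T(2^(j+1)) - T(2^j)) telescopes. The terms j = J and j = J +
    1 lie beyond T(2^J) and come from doubling. *)
Lemma sum_psi_le : exists2 K, 0 <= K & forall J,
  \sum_(0 <= j < J.+2) psi (2 ^+ j) <= K * (psi_tilde psi (2 ^+ J) + 1).
Proof.
have [K K1 hK] := psi_double.
pose T := psi_tilde psi.
have e1 j : 1 <= 2 ^+ j :> R by rewrite exprn_ege1 // ler1n.
have step j : psi (2 ^+ j) <= 2 * (T (2 ^+ j.+1) - T (2 ^+ j)).
  rewrite exprS; have y1 := e1 j; set y := 2 ^+ j in y1 *.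
  have h2 : psi y * (2 * y - y) / (2 * y) <= T (2 * y) - T y.
    by apply: psi_tilde_lower => //; lra.
  rewrite (_ : psi _ * _ / _ = psi y / 2) in h2; last by field; lra.
  by lra.
have sumT J : \sum_(0 <= j < J) psi (2 ^+ j) <= 2 * T (2 ^+ J).
  elim: J => [|J ih]; first by rewrite big_nil mulr_ge0 // psi_tilde_ge0.
  by rewrite big_nat_recr //=; have := step J; lra.
have last2 J : psi (2 ^+ J.+1) <= K * (psi (2 ^+ J) + 1) by rewrite exprS; apply: hK.
have p1 : 0 <= psi 1 by apply: psi_ge0.
exists (2 + 4 * (K + 1) * (K + 1) + (K + 1) * (psi 1 + 1)) => [|J]; first by nra.
rewrite !big_nat_recr //=.
have T0 := psi_tilde_ge0 (e1 J); rewrite -/T in T0 *.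
have pJ : psi (2 ^+ J) <= 2 * K * T (2 ^+ J) + K + psi 1.
  case: J T0 => [|J] T0; first by rewrite expr0 in T0 *; nra.
  have := last2 J; have := step J; have := psi_tilde_ge0 (e1 J); rewrite -/T => a1 a2 a3.
  have : K * (psi (2 ^+ J) + 1) <= K * (2 * T (2 ^+ J.+1) + 1).
    by rewrite ler_wpM2l; lra.
  lra.
have a1 := sumT J; have a2 := last2 J.
have a3 : K * (psi (2 ^+ J) + 1) <= K * (2 * K * T (2 ^+ J) + K + psi 1 + 1).
  by rewrite ler_wpM2l; lra.
have b1 : 0 <= K * T (2 ^+ J) by rewrite mulr_ge0; lra.
have b2 : 0 <= K * K * T (2 ^+ J) by rewrite mulrAC mulr_ge0 //; lra.
have b3 : 0 <= psi 1 * T (2 ^+ J) by rewrite mulr_ge0.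
have b4 : 0 <= K * psi 1 * T (2 ^+ J) by rewrite mulrAC mulr_ge0.
have b5 : 0 <= K * K by rewrite mulr_ge0; lra.
have b6 : 0 <= K * psi 1 by rewrite mulr_ge0; lra.
by lra.
Qed.

End Growth.

(** * The Polya order and the growth of psi at dyadic points *)

Section PolyaOrder.
Variable R : realType.

Lemma ltr_powR (a x y : R) : 1 < a -> x < y -> a `^ x < a `^ y.
Proof.
move=> a1 xy; rewrite /powR gt_eqF; last lra.
by rewrite ltr_expR ltr_pM2r // ln_gt0.
Qed.

Variable psi : R -> R.
Hypothesis psi_ge0 : forall x, 1 <= x -> 0 <= psi x.
Hypothesis psi_nd : {in `[1, +oo[ &, {homo psi : x y / x <= y}}.
Hypothesis psi_unbounded : forall A : R, exists2 x, 1 <= x & A < psi x.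
Hypothesis psi_doubling : exists2 K : R, 0 < K &
     \forall x \near +oo, psi (2 * x) <= K * psi x.

Let polya_set : set R := [set rho : R | \forall x \near +oo & C \near +oo,
                       psi (C * x) <= C `^ rho * psi x].

Let polya_setP rho : polya_set rho <->
  exists2 A, 1 <= A & forall x C, A < x -> A < C -> psi (C * x) <= C `^ rho * psi x.
Proof.
rewrite /polya_set /=; split.
  case=> [[P Q] /= [[A [_ hA]] [B [_ hB]]] sub].
  exists (Num.max 1 (Num.max A B)); first by rewrite le_max lexx.
  move=> x C; rewrite !gt_max => /and3P[_ xA _] /and3P[_ _ CB].
  by have := sub (x, C); apply; split; [apply: hA|apply: hB].
move=> [A A1 h]; exists ([set x | A < x], [set x | A < x]) => /=.
  by split; exists A; split; rewrite ?num_real.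
by move=> [x C] [/= xA CA]; apply: h.
Qed.

(** If K <= 2^k, iterated doubling yields psi(C x) <= (2^(i+1))^k psi(x) for 2^i <= C < 2^(i+1), and
    2^(i+1) <= 2 C <= C^2 for C >= 2; hence the exponent 2 k. *)
Let polya_set_nonempty : polya_set !=set0.
Proof.
have [K K0 [A [_ hA]]] := psi_doubling.
pose k := Num.bound K.
have Kk : K <= 2 ^+ k.
  apply/ltW; apply: lt_le_trans (_ : k%:R <= _).
    by have := archi_boundP (ltW K0).
  by rewrite -natrX ler_nat ltnW // ltn_expl.
pose B := Num.max 2 (A + 1).
have [B2 BA] : 2 <= B /\ A < B by rewrite !le_max lexx lt_max ltrDl ltr01 orbT.
have step i x : B < x -> psi (2 ^+ i * x) <= 2 ^+ (k * i) * psi x.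
  move=> Bx; elim: i => [|i ih]; first by rewrite muln0 !expr0 !mul1r.
  have xi : x <= 2 ^+ i * x by rewrite ler_peMl ?exprn_ege1 //; lra.
  rewrite exprS -mulrA; apply: (le_trans (hA _ _)); first lra.
  rewrite mulnS exprD -mulrA; apply: ler_pM => //; first exact: ltW.
  by apply: psi_ge0; lra.
exists (2 * k)%:R; apply/polya_setP; exists B; first lra.
move=> x C Bx BC.
have [i /andP[i1 i2]] : exists i, 2 ^+ i <= C < 2 ^+ i.+1 by exists (dylog C); apply: dylogP; lra.
have x0 : 1 <= x by lra.
apply: (@le_trans _ _ (psi (2 ^+ i.+1 * x))).
  apply: psi_le => //; last by rewrite ler_wpM2r //; lra.
  by rewrite -[leLHS]mulr1 ler_pM //; lra.
apply: (le_trans (step _ _ Bx)); rewrite ler_wpM2r ?psi_ge0 //.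
rewrite powR_mulrn; last lra.
rewrite mulnC exprM [leRHS]exprM lerXn2r ?nnegrE ?exprn_ge0 //; try lra.
by rewrite exprS expr2 ler_pM //; lra.
Qed.

(** A negative exponent would give psi(C x) < psi(x) at a point where psi is positive, against
    monotonicity. *)
Let polya_set_ge0 rho : polya_set rho -> 0 <= rho.
Proof.
move=> /polya_setP[A A1 h]; rewrite leNgt; apply/negP => r0.
have [x x1 px] := psi_unbounded 0.
pose y := Num.max x (A + 1).
have [xy Ay] : x <= y /\ A < y by rewrite le_max lexx lt_max ltrDl ltr01 orbT.
have py : 0 < psi y by apply: lt_le_trans px _; apply: psi_le.
have A1' : A < A + 1 by lra.
have := h y (A + 1) Ay A1'.
have : psi y <= psi ((A + 1) * y) by apply: psi_le; [|lra|rewrite ler_peMl //; lra].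
have : (A + 1) `^ rho < 1.
  by rewrite -[ltRHS](powRr0 (A + 1)) ltr_powR //; lra.
move=> h1 h2 h3.
have : (A + 1) `^ rho * psi y < 1 * psi y by rewrite ltr_pM2r.
lra.
Qed.

Variable s : nat.
Hypothesis s_ge : Num.floor (polya_order psi) + 1 <= s%:Z.

Let polya_lt : polya_order psi < s%:R.
Proof.
have := floorD1_gt (polya_order psi) => h; apply: lt_le_trans h _.
by have := s_ge; rewrite -(ler_int R).
Qed.

Let polya_exponent : exists2 rho, 0 <= rho < s%:R & exists2 A, 1 <= A &
   forall x C, A < x -> A < C -> psi (C * x) <= C `^ rho * psi x.
Proof.
have [rho h r] := inf_lt polya_set_nonempty polya_lt.
by exists rho; [rewrite polya_set_ge0|apply/polya_setP].
Qed.

Lemma polya_s_gt0 : (0 < s)%N.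
Proof.
have [rho /andP[r0 rs] _] := polya_exponent.
by rewrite -(ltr0n R); lra.
Qed.

(** An exponent rho strictly below s gives the ratio th = 2^rho / 2^s < 1. The condition that base
    point and dilation exceed a threshold A < 2^q is removed at the cost of a constant, by enlarging
    short dilations to 2^q and raising low base points to 2^q. *)
Lemma psi_dyadic_growth : exists K th : R, [/\ 0 <= K, 0 <= th, th < 1 &
  forall J i, psi (2 ^+ (J + i)) <= K * (2 ^+ s * th) ^+ i * (psi (2 ^+ J) + 1)].
Proof.
have [rho /andP[r0 rs] [A A1 h]] := polya_exponent.
pose q := Num.bound (A * 1).
have qA : A < 2 ^+ q.
  apply: lt_le_trans (_ : q%:R <= _).
    by rewrite -[X in X < _](mulr1 A); apply: archi_boundP; lra.
  by rewrite -natrX ler_nat ltnW // ltn_expl.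
pose b : R := 2 `^ rho.
have b1 : 1 <= b by rewrite -(powRr0 2) ler_powR //; lra.
have bp n : (2 ^+ n) `^ rho = b ^+ n.
  rewrite -powR_mulrn; last lra.
  by rewrite -powRrM mulrC powRrM powR_mulrn // powR_ge0.
have e1 j : 1 <= 2 ^+ j :> R by rewrite exprn_ege1 // ler1n.
(* for x > A, steps shorter than q cost the constant b^q *)
have big J i : A < 2 ^+ J -> psi (2 ^+ (J + i)) <= b ^+ q * b ^+ i * psi (2 ^+ J).
  move=> AJ; have p0 : 0 <= psi (2 ^+ J) by apply: psi_ge0.
  have g n : (q <= n)%N -> psi (2 ^+ (J + n)) <= b ^+ n * psi (2 ^+ J).
    move=> qn; rewrite -bp addnC exprD; apply: h => //.
    by apply: lt_le_trans qA _; rewrite ler_weXn2l // ler1n.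
  have [qi|iq] := leqP q i.
    apply: (le_trans (g _ qi)); rewrite ler_wpM2r // ler_peMl ?exprn_ge0 //; try lra.
    by rewrite exprn_ege1.
  apply: (@le_trans _ _ (psi (2 ^+ (J + q)))).
    by apply: psi_le => //; rewrite ler_weXn2l ?ler1n // leq_add2l ltnW.
  apply: (le_trans (g _ (leqnn q))); rewrite ler_wpM2r // ler_peMr ?exprn_ge0 //; try lra.
  by rewrite exprn_ege1.
have pq : 0 <= psi (2 ^+ q) by apply: psi_ge0.
have bq i : 0 <= b ^+ i by rewrite exprn_ge0 //; lra.
exists (b ^+ q * (1 + psi (2 ^+ q))), (b / 2 ^+ s); split.
- by rewrite mulr_ge0 //; lra.
- by rewrite divr_ge0 ?exprn_ge0 //; lra.
- rewrite ltr_pdivrMr ?exprn_gt0 // mul1r -powR_mulrn; last lra.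
  by rewrite ltr_powR //; lra.
move=> J i; rewrite mulrCA divff ?mulr1; last by rewrite expf_neq0 // pnatr_eq0.
have p0 : 0 <= psi (2 ^+ J) by apply: psi_ge0.
have [AJ|JA] := ltP A (2 ^+ J).
  apply: (le_trans (big _ _ AJ)).
  rewrite -!mulrA ler_wpM2l // mulrCA ler_wpM2l //.
  by have := mulr_ge0 pq p0; nra.
have Jq : (J <= q)%N.
  have : 2 ^+ J < 2 ^+ q :> R by lra.
  by rewrite ltr_eXn2l ?ltr1n // => /ltnW.
apply: (@le_trans _ _ (psi (2 ^+ (q + i)))).
  by apply: psi_le => //; rewrite ler_weXn2l ?ler1n // leq_add2r.
apply: (le_trans (big _ _ qA)).
rewrite -!mulrA ler_wpM2l // mulrCA ler_wpM2l //.
by have := mulr_ge0 pq p0; nra.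
Qed.

End PolyaOrder.

(** * Sums of psi over dyadic levels against decaying weights *)

Section WeightSums.
Variable R : realType.

(** The integral test in telescoped form: (x + 1)^-(s+1) <= x^-s - (x + 1)^-s. The factor 2 pays for
    the term d = 0. *)
Lemma sum_inv_pow_le (s D : nat) (Y : R) : (0 < s)%N -> 0 <= Y ->
  \sum_(0 <= d < D) (1 + d%:R + Y) ^- s.+1 <= 2 * (1 + Y) ^- s.
Proof.
move=> s0 Y0.
have pos (x : R) n : 0 < x -> 0 < x ^- n by move=> x0; rewrite invr_gt0 exprn_gt0.
case: D => [|D]; first by rewrite big_nil mulr_ge0 // ltW // pos; lra.
suff h : \sum_(0 <= d < D.+1) (1 + d%:R + Y) ^- s.+1 <= 2 * (1 + Y) ^- s - (1 + D%:R + Y) ^- s.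
  by apply: (le_trans h); rewrite gerBl ltW // pos; have := ler0n R D; lra.
elim: D => [|D ih].
  rewrite big_nat1 addr0 exprS invfM.
  have h : 0 < (1 + Y) ^- s by apply: pos; lra.
  have h' : (1 + Y)^-1 <= 1 by rewrite invf_le1; lra.
  have : (1 + Y)^-1 * (1 + Y) ^- s <= 1 * (1 + Y) ^- s by rewrite ler_wpM2r // ltW.
  lra.
rewrite big_nat_recr //=; apply: (le_trans (lerD ih (lexx _))).
have -> : 1 + D.+1%:R + Y = (1 + D%:R + Y) + 1 by rewrite -natr1; ring.
set x := 1 + D%:R + Y.
have x1 : 1 <= x by rewrite /x; have := ler0n R D; lra.
suff key : (x + 1) ^- s.+1 <= x ^- s - (x + 1) ^- s by lra.
rewrite -subr_ge0.
case: s s0 {ih} => // s _.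
have h1 : x ^+ s <= (x + 1) ^+ s by rewrite lerXn2r ?nnegrE //; lra.
(* This is [key] with denominators cleared; it follows from x (x + 2) <= (x + 1)^2. *)
have h2 : x ^+ s.+1 * (x + 2) <= (x + 1) ^+ s.+2.
  rewrite !exprS (mulrC x) -mulrA.
  apply: (@le_trans _ _ ((x + 1) ^+ s * (x * (x + 2)))).
    by rewrite ler_wpM2r // mulr_ge0; lra.
  rewrite [leRHS]mulrA [leRHS]mulrC ler_wpM2l ?exprn_ge0 //; first by lra.
  by nra.
rewrite [leRHS](_ : _ = ((x + 1) ^+ s.+2 - x ^+ s.+1 * (x + 2)) / (x ^+ s.+1 * (x + 1) ^+ s.+2)).
  by apply: divr_ge0; [rewrite subr_ge0|apply: mulr_ge0; apply: exprn_ge0; lra].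
rewrite !(exprS (x + 1)) exprS; field.
by rewrite !expf_neq0 //=; lra.
Qed.

Variable psi : R -> R.
Hypothesis psi_ge0 : forall x, 1 <= x -> 0 <= psi x.
Hypothesis psi_nd : {in `[1, +oo[ &, {homo psi : x y / x <= y}}.
Hypothesis psi_unbounded : forall A : R, exists2 x, 1 <= x & A < psi x.
Hypothesis psi_doubling : exists2 K : R, 0 < K &
     \forall x \near +oo, psi (2 * x) <= K * psi x.
Variable s : nat.
Hypothesis s_ge : Num.floor (polya_order psi) + 1 <= s%:Z.

(** Here j is a dyadic level and del stands for 1 - |z|. Up to the level N with 2^N comparable to 1
    / del the weights are at most 1 and [sum_psi_le] applies. Beyond it they decay like 2^(-s i),
    which beats the growth of psi and leaves a geometric series of ratio th. *)
Lemma sum_psi_weight_le : exists2 K, 0 <= K & forall (del : R) J, 0 < del -> del <= 1 ->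
  \sum_(0 <= j < J) psi (2 ^+ j.+1) * (1 + 2 ^+ j * del) ^- s
    <= K * (psi_tilde psi del^-1 + 1).
Proof.
have [K1 K10 hK1] := sum_psi_le psi_ge0 psi_nd psi_doubling.
have [K2 [th [K20 th0 th1 hK2]]] := psi_dyadic_growth psi_ge0 psi_nd psi_unbounded psi_doubling s_ge.
have e1 j : 1 <= 2 ^+ j :> R by rewrite exprn_ege1 // ler1n.
have p0 j : 0 <= psi (2 ^+ j) by apply: psi_ge0.
pose L := (1 - th)^-1.
have L0 : 0 <= L by rewrite invr_ge0; lra.
pose K3 := K2 * 2 ^+ s * L.
have K30 : 0 <= K3 by rewrite !mulr_ge0 ?exprn_ge0.
exists (K1 + K3 * (K1 + 1)) => [|del J d0 d1]; first by nra.
have D1 : 1 <= del^-1 by rewrite invf_ge1.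
pose N := dylog del^-1; have /andP[N1 N2] := dylogP D1; rewrite -/N in N1 N2.
pose t j := psi (2 ^+ j.+1) * (1 + 2 ^+ j * del) ^- s.
have den j : 1 <= 1 + 2 ^+ j * del by rewrite lerDl mulr_ge0 // ltW.
have t0 j : 0 <= t j.
  by rewrite mulr_ge0 // invr_ge0 exprn_ge0 //; have := den j; lra.
have T0 : 0 <= psi_tilde psi (2 ^+ N) by apply: psi_tilde_ge0.
have TT : psi_tilde psi (2 ^+ N) <= psi_tilde psi del^-1 by apply: psi_tilde_le.
(* The range is lengthened so that it can be cut at N + 1 whatever J is. *)
apply: (@le_trans _ _ (\sum_(0 <= j < N.+1 + J) t j)).
  rewrite (@big_cat_nat _ _ _ J 0 (N.+1 + J)) ?leq_addl //=.
  by rewrite lerDl sumr_ge0.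
rewrite (@big_cat_nat _ _ _ N.+1 0) ?leq_addr //=.
have s1 : \sum_(0 <= j < N.+1) t j <= K1 * (psi_tilde psi (2 ^+ N) + 1).
  apply: le_trans (hK1 N).
  rewrite [leRHS]big_nat_recl //=.
  apply: (@le_trans _ _ (\sum_(0 <= i < N.+1) psi (2 ^+ i.+1))); last by rewrite lerDr.
  apply: ler_sum => j _; rewrite /t ler_piMr // invf_le1 ?exprn_gt0 ?exprn_ege1 //.
  by have := den j; lra.
have pN : psi (2 ^+ N.+1) <= K1 * (psi_tilde psi (2 ^+ N) + 1).
  by apply: le_trans (hK1 N); rewrite big_nat_recr //= lerDr sumr_ge0.
have s2 : \sum_(N.+1 <= j < N.+1 + J) t j <= K3 * (psi (2 ^+ N.+1) + 1).
  rewrite -{1}[N.+1]add0n big_addn addKn.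
  have step i : t (i + N.+1)%N <= K2 * 2 ^+ s * (psi (2 ^+ N.+1) + 1) * th ^+ i.
    have dj : 2 ^+ i <= 1 + 2 ^+ (i + N.+1) * del.
      rewrite exprD -mulrA.
      have : 1 <= 2 ^+ N.+1 * del by rewrite -ler_pdivrMr // mul1r ltW.
      move=> h; have : 2 ^+ i * 1 <= 2 ^+ i * (2 ^+ N.+1 * del) by rewrite ler_wpM2l // exprn_ge0.
      lra.
    have h1 : (1 + 2 ^+ (i + N.+1) * del) ^- s <= ((2 ^+ i) ^+ s)^-1.
      rewrite lef_pV2 ?posrE ?exprn_gt0 //.
        by rewrite lerXn2r ?nnegrE ?exprn_ge0 //; have := den (i + N.+1)%N; lra.
      by have := den (i + N.+1)%N; lra.
    have h2 : psi (2 ^+ (i + N.+1).+1) <= K2 * (2 ^+ s * th) ^+ i.+1 * (psi (2 ^+ N.+1) + 1).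
      by have := hK2 N.+1 i.+1; rewrite addnC.
    apply: (@le_trans _ _ (K2 * (2 ^+ s * th) ^+ i.+1 * (psi (2 ^+ N.+1) + 1) * ((2 ^+ i) ^+ s)^-1)).
      by rewrite ler_pM // invr_ge0 exprn_ge0 //; have := den (i + N.+1)%N; lra.
    rewrite -exprM mulnC exprM exprS exprMn.
    have -> : K2 * (2 ^+ s * th * ((2 ^+ s) ^+ i * th ^+ i)) * (psi (2 ^+ N.+1) + 1) / (2 ^+ s) ^+ i =
       K2 * 2 ^+ s * (psi (2 ^+ N.+1) + 1) * th ^+ i * th.
      by field; rewrite !expf_neq0 // pnatr_eq0.
    rewrite ler_piMr //; last exact: ltW.
    by rewrite !mulr_ge0 ?exprn_ge0 //; have := p0 N.+1; lra.
  apply: (le_trans (ler_sum _ (fun i _ => step i))).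
  rewrite -mulr_sumr.
  have g : \sum_(0 <= i < J) th ^+ i <= L.
    rewrite big_mkord /L.
    have := subrX1 th J => h.
    have : (1 - th) * \sum_(i < J) th ^+ i <= 1.
      rewrite -opprB mulNr -h opprB; have := @exprn_ge0 R J th th0; lra.
    by move=> h'; rewrite -ler_pdivlMl ?mulr1 in h'; lra.
  have q0 : 0 <= K2 * 2 ^+ s * (psi (2 ^+ N.+1) + 1).
    by rewrite !mulr_ge0 ?exprn_ge0 //; have := p0 N.+1; lra.
  apply: (le_trans (ler_wpM2l q0 g)).
  by rewrite /K3 -!mulrA ler_wpM2l // ler_wpM2l ?exprn_ge0 // mulrC.
have b : K3 * (psi (2 ^+ N.+1) + 1) <= K3 * (K1 * (psi_tilde psi (2 ^+ N) + 1) + 1).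
  by rewrite ler_wpM2l //; lra.
have b1 : 0 <= K1 * K3 * psi_tilde psi (2 ^+ N) by rewrite !mulr_ge0.
have b2 : K1 * psi_tilde psi (2 ^+ N) <= K1 * psi_tilde psi del^-1 by rewrite ler_wpM2l.
have b3 : K1 * K3 * psi_tilde psi (2 ^+ N) <= K1 * K3 * psi_tilde psi del^-1.
  by rewrite ler_wpM2l // mulr_ge0.
have b4 : 0 <= K3 * psi_tilde psi del^-1 by rewrite mulr_ge0 //; lra.
by lra.
Qed.

End WeightSums.

(** * Counting in dyadic boxes *)

Section Boxes.
Variable R : realType.
Implicit Types (w z : R[i]).

Lemma truncn_eq_dist (x y : R) : 0 <= x -> 0 <= y ->
  Num.truncn x = Num.truncn y -> `|x - y| <= 1.
Proof.
move=> x0 y0 xy; have /andP[a1 a2] := truncn_itv x0; have /andP[b1 b2] := truncn_itv y0.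
rewrite xy -natr1 in a1 a2; rewrite -natr1 in b2.
by rewrite ler_norml; apply/andP; split; lra.
Qed.

(** In the sector |y| <= x, the modulus and y control x, because (x - x') (x + x') = (r - r') (r +
    r') - (y - y') (y + y'). Since r <= 2 x there, the two terms contribute 2 h and h. *)
Lemma sector_close (x y x' y' r r' h : R) :
  0 <= r -> 0 <= r' -> r ^+ 2 = x ^+ 2 + y ^+ 2 -> r' ^+ 2 = x' ^+ 2 + y' ^+ 2 ->
  `|y| <= x -> `|y'| <= x' -> 0 <= h -> `|r - r'| <= h -> `|y - y'| <= h ->
  `|x - x'| <= 3 * h.
Proof.
move=> r0 r0' rE rE' yx yx' h0 rr yy.
have x0 : 0 <= x by apply: le_trans yx.
have x0' : 0 <= x' by apply: le_trans yx'.
have [S0|S0] := eqVneq (x + x') 0.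
  have -> : x = 0 by lra.
  have -> : x' = 0 by lra.
  by rewrite subr0 normr0 mulr_ge0.
have S1 : 0 < x + x' by rewrite lt_def S0 addr_ge0.
have aux (u v w : R) : 0 <= u -> u ^+ 2 = v ^+ 2 + w ^+ 2 -> `|w| <= v -> u <= 2 * v.
  move=> u0 uE wv; have v0 : 0 <= v by apply: le_trans wv.
  rewrite -(@ler_pXn2r _ 2) ?nnegrE ?mulr_ge0 // uE exprMn.
  have : w ^+ 2 <= v ^+ 2 by rewrite -(real_normK (num_real w)) lerXn2r ?nnegrE.
  have := sqr_ge0 v; lra.
have r2 := aux _ _ _ r0 rE yx; have r2' := aux _ _ _ r0' rE' yx'.
have E : (x - x') * (x + x') = (r - r') * (r + r') - (y - y') * (y + y').
  by rewrite -!subr_sqr rE rE'; ring.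
have : `|x - x'| * (x + x') <= 3 * h * (x + x').
  rewrite -[in leLHS](ger0_norm (ltW S1)) -normrM E.
  apply: (le_trans (ler_normB _ _)); rewrite !normrM.
  have h1 : `|r - r'| * `|r + r'| <= h * (2 * (x + x')).
    by rewrite ler_pM // ger0_norm ?addr_ge0 //; lra.
  have h2 : `|y - y'| * `|y + y'| <= h * (x + x').
    by rewrite ler_pM // (le_trans (ler_normD _ _)) // lerD.
  lra.
by rewrite ler_pM2r.
Qed.

(** The boolean treats both coordinate axes at once: [box_axis w] selects the coordinate of smaller
    absolute value, and the other one is recovered from the modulus by [sector_close]. *)
Definition axis (b : bool) w : R := if b then complex.Im w else complex.Re w.

Lemma axis_le b w : `|axis b w| <= cmod w.
Proof. by case: b; [apply: Im_le_cmod|apply: Re_le_cmod]. Qed.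

Lemma axisB b w z : axis b (w - z) = axis b w - axis b z.
Proof. by case: b; case: w; case: z. Qed.

Lemma cmod_le_axes b w : cmod w <= `|axis b w| + `|axis (~~ b) w|.
Proof. by have := cmod_le_ReIm w; case: b => /=; rewrite 1?addrC. Qed.

Lemma cmod_sqr_axes b w : cmod w ^+ 2 = axis (~~ b) w ^+ 2 + axis b w ^+ 2.
Proof. by rewrite cmod_sqr; case: b => /=; rewrite 1?addrC. Qed.

(* Points of the disk are sorted by their dyadic distance 2^-j to the circle,
   which is refined by [box_ring], by the quadrant around the coordinate axes
   in which they lie, and by the size d of the coordinate [axis b] of w - z, in
   units of 2^-j / 16. *)
Definition box_level w : nat := dylog (1 - cmod w)^-1.
Definition box_ring w : nat := Num.truncn ((1 - cmod w) * 2 ^+ box_level w * 16).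
Definition box_axis w : bool := `|complex.Im w| <= `|complex.Re w|.
Definition box_sign w : bool := 0 <= axis (~~ box_axis w) w.
Definition box_side z w : bool := 0 <= axis (box_axis w) (w - z).
Definition box_dist z w : nat :=
  Num.truncn (`|axis (box_axis w) (w - z)| * 2 ^+ box_level w * 16).

Lemma box_levelP w : in_disk w ->
  2 ^+ box_level w * (1 - cmod w) <= 1 < 2 ^+ (box_level w).+1 * (1 - cmod w).
Proof.
rewrite /in_disk => w1.
have /dylogP : 1 <= (1 - cmod w)^-1 by rewrite invf_ge1 ?subr_gt0 // gerBl cmod_ge0.
rewrite -/(box_level w) -(ler_pdivlMr _ _ (_ : 0 < 1 - cmod w)) ?subr_gt0 // div1r.
by rewrite -(ltr_pdivrMr _ _ (_ : 0 < 1 - cmod w)) ?subr_gt0 // div1r.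
Qed.

Lemma box_ring_lt w : in_disk w -> (box_ring w < 17)%N.
Proof.
move=> w1; have /andP[h _] := box_levelP w1.
have u0 : 0 <= (1 - cmod w) * 2 ^+ box_level w * 16.
  by rewrite !mulr_ge0 ?exprn_ge0 // subr_ge0 ltW.
have /andP[h1 _] := truncn_itv u0.
rewrite /box_ring -(ltr_nat R); apply: le_lt_trans h1 _.
by rewrite (mulrC (1 - _)); lra.
Qed.

Lemma box_axis_sector w : `|axis (box_axis w) w| <= `|axis (~~ box_axis w) w|.
Proof.
rewrite /box_axis; case: (leP `|complex.Im w| `|complex.Re w|) => [|/ltW] h; exact: h.
Qed.

(** The unit 2^-j / 16 is chosen for this. With h = 2^-j / 16, the smaller coordinates differ by at
    most h and the larger ones by at most 3 h; the sum 2^-j / 4 is below (1 - |w'|) / 2, the radius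
    in the density condition. *)
Lemma box_close z w w' : in_disk w -> in_disk w' ->
  box_level w = box_level w' -> box_ring w = box_ring w' ->
  box_axis w = box_axis w' -> box_sign w = box_sign w' ->
  box_side z w = box_side z w' -> box_dist z w = box_dist z w' ->
  cmod (w - w') <= (1 - cmod w') / 2.
Proof.
move=> w1 w1' El Er Ea Eg Es Ed.
pose P : R := 2 ^+ box_level w'.
have P0 : 0 < P by rewrite exprn_gt0.
have /andP[_ lev] := box_levelP w1'; rewrite exprS -/P in lev.
pose h : R := (P * 16)^-1.
have h0 : 0 < h by rewrite invr_gt0; lra.
have hP : h * (P * 16) = 1 by rewrite mulVf // gt_eqF //; lra.
have scale : forall x y : R, `|x * (P * 16) - y * (P * 16)| <= 1 -> `|x - y| <= h.
  move=> x y; rewrite -mulrBl normrM [X in _ * X]ger0_norm; last lra.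
  by rewrite -(ler_pdivlMr _ _ (_ : 0 < P * 16)) ?div1r //; lra.
have PP : 0 <= P * 16 by lra.
have rr : `|cmod w - cmod w'| <= h.
  rewrite distrC -[X in `|X|](_ : (1 - cmod w) - (1 - cmod w') = _); last by ring.
  apply: scale; rewrite !mulrA; apply: truncn_eq_dist.
  - by rewrite -mulrA mulr_ge0 // subr_ge0 ltW.
  - by rewrite -mulrA mulr_ge0 // subr_ge0 ltW.
  - by move: Er; rewrite /box_ring El.
pose b := box_axis w'.
have yy : `|axis b w - axis b w'| <= h.
  have -> : axis b w - axis b w' = axis b (w - z) - axis b (w' - z).
    by rewrite !axisB; ring.
  have d1 : `| `|axis b (w - z)| - `|axis b (w' - z)| | <= h.
    apply: scale; rewrite !mulrA; apply: truncn_eq_dist; rewrite -?mulrA ?mulr_ge0 //.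
    - exact: ltW.
    - exact: ltW.
    - by move: Ed; rewrite /box_dist El Ea -!mulrA.
  move: Es d1; rewrite /box_side Ea -/b.
  have [s1|s1] := leP 0 (axis b (w - z)); have [s2|s2] := leP 0 (axis b (w' - z)) => // _.
    by rewrite (ger0_norm s1) (ger0_norm s2).
  by rewrite !(ltr0_norm s1) !(ltr0_norm s2) -opprD normrN.
have xx : `|axis (~~ b) w - axis (~~ b) w'| <= 3 * h.
  have c1 : `| `|axis (~~ b) w| - `|axis (~~ b) w'| | <= 3 * h.
    apply: (@sector_close _ (axis b w) _ (axis b w') (cmod w) (cmod w')).
    - exact: cmod_ge0.
    - exact: cmod_ge0.
    - by rewrite (cmod_sqr_axes b) real_normK ?num_real.
    - by rewrite (cmod_sqr_axes b) real_normK ?num_real.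
    - by rewrite /b -Ea; apply: box_axis_sector.
    - exact: box_axis_sector.
    - exact: ltW.
    - exact: rr.
    - exact: yy.
  move: Eg c1; rewrite /box_sign Ea -/b.
  have [s1|s1] := leP 0 (axis (~~ b) w); have [s2|s2] := leP 0 (axis (~~ b) w') => // _.
    by rewrite (ger0_norm s1) (ger0_norm s2).
  by rewrite !(ltr0_norm s1) !(ltr0_norm s2) -opprD normrN.
apply: (le_trans (cmod_le_axes b _)); rewrite !axisB.
have : 4 * h <= (1 - cmod w') / 2.
  rewrite -(ler_pM2r (_ : 0 < P * 16)); last lra.
  by rewrite -mulrA hP; lra.
lra.
Qed.

(** Let X = |1 - conj w z| and P = 2^j. Then 1 <= 2 P X, d <= 16 P X and P (1 - |z|) <= P X, so the
    new denominator is at most 19 P X. The numerator is at most 2 (1 - |w|) with P (1 - |w|) <= 1,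
    whence 38 = 2 times 19. *)
Lemma box_weight z w : in_disk w -> in_disk z ->
  cmod (disk_weight w z) <=
  38 / (1 + (box_dist z w)%:R + 2 ^+ box_level w * (1 - cmod z)).
Proof.
move=> w1 z1; have z1' := ltW z1.
rewrite cmod_disk_weight //.
set P := 2 ^+ box_level w; set X := cmod (1 - _); set d := box_dist z w.
have P0 : 0 < P by rewrite exprn_gt0.
have /andP[l1 l2] := box_levelP w1; rewrite exprS -/P in l1 l2.
have X1 : 1 - cmod w <= X by apply: disk_den_ge_l.
have X2 : 1 - cmod z <= X by apply: disk_den_ge_r.
have X3 : cmod (w - z) <= X by apply: disk_den_ge_dist.
have X0 : 0 < X by apply: lt_le_trans X1; rewrite subr_gt0.
have d0 : 0 <= d%:R :> R by rewrite ler0n.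
have z0 : 0 < 1 - cmod z by rewrite subr_gt0.
have dX : d%:R <= X * P * 16.
  have u0 : 0 <= `|axis (box_axis w) (w - z)| * P * 16 by rewrite !mulr_ge0 // ltW.
  have /andP[h1 _] := truncn_itv u0.
  apply: (le_trans h1); rewrite -!mulrA ler_wpM2r ?mulr_ge0 ?(ltW P0) //.
  exact: le_trans (axis_le _ _) X3.
have Pz : P * (1 - cmod z) <= P * X by rewrite ler_wpM2l // ltW.
have Pw : P * (1 - cmod w) <= P * X by rewrite ler_wpM2l // ltW.
have D : 1 + d%:R + P * (1 - cmod z) <= 19 * (P * X) by lra.
have D0 : 0 < 1 + d%:R + P * (1 - cmod z).
  by have := mulr_gt0 P0 z0; lra.
rewrite ler_pdivrMr // mulrAC ler_pdivlMr //.
have nw := disk_weight_num_le w1.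
have nw0 : 0 <= 1 - cmod w ^+ 2.
  by rewrite subr_ge0 expr_le1 ?cmod_ge0 // ltW.
apply: (@le_trans _ _ (2 * (1 - cmod w) * (19 * (P * X)))).
  by rewrite ler_pM // ltW.
have : P * (1 - cmod w) * X <= 1 * X by rewrite ler_wpM2r // ltW.
lra.
Qed.

End Boxes.

(** * From the density condition to the bound on sums of weights *)

Section DensityCount.
Variable R : realType.

Lemma counting_ge_size (A : set nat) (F : seq nat) : uniq F ->
  (forall k, k \in F -> A k) -> ((size F)%:R%:E <= counting A :> \bar R)%E.
Proof.
move=> uF FA; rewrite /counting; case: asboolP => [fA|_]; last exact: leey.
rewrite lee_fin ler_nat; apply: uniq_leq_size => // k kF.
by rewrite in_fset_set // inE; apply: FA.
Qed.

Variables (a : nat -> R[i]) (psi : R -> R).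
Hypothesis a_disk : forall n, in_disk (a n).
Hypothesis density : exists2 C : R, 0 < C & forall w : R[i], in_disk w ->
     (ncount a w ((1 - cmod w) / 2) <= (C * psi (1 - cmod w)^-1)%:E)%E.

Lemma density_size : exists2 C : R, 0 < C & forall (w : R[i]) (F : seq nat), in_disk w ->
  uniq F -> (forall k, k \in F -> cmod (a k - w) <= (1 - cmod w) / 2) ->
  (size F)%:R <= C * psi (1 - cmod w)^-1.
Proof.
have [C C0 h] := density; exists C => // w F w1 uF Fw.
rewrite -lee_fin; apply: le_trans (h w w1).
exact: counting_ge_size.
Qed.

Hypothesis psi_ge0 : forall x, 1 <= x -> 0 <= psi x.
Hypothesis psi_nd : {in `[1, +oo[ &, {homo psi : x y / x <= y}}.
Hypothesis psi_unbounded : forall A : R, exists2 x, 1 <= x & A < psi x.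
Hypothesis psi_doubling : exists2 K : R, 0 < K &
     \forall x \near +oo, psi (2 * x) <= K * psi x.
Variable s : nat.
Hypothesis s_ge : Num.floor (polya_order psi) + 1 <= s%:Z.

(** A box at level j holds at most C psi(2^(j+1)) points. Summing over d turns the exponent s + 1
    into s, and the sum over j is [sum_psi_weight_le]. The factor 8 times 17 counts the three
    booleans and the rings. *)
Lemma sum_disk_weight_le : exists2 K : R, 0 <= K & forall (z : R[i]) m, in_disk z ->
  \sum_(0 <= k < m) cmod (disk_weight (a k) z) ^+ s.+1
   <= K * (psi_tilde psi (1 - cmod z)^-1 + 1).
Proof.
have s0 := polya_s_gt0 psi_ge0 psi_nd psi_unbounded psi_doubling s_ge.
have [K K0 hK] := sum_psi_weight_le psi_ge0 psi_nd psi_unbounded psi_doubling s_ge.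
have [C C0 hC] := density_size.
pose K1 := (8 * 17) * (C * 38 ^+ s.+1 * 2).
have K10 : 0 <= K1 by rewrite !mulr_ge0 ?exprn_ge0 // ltW.
exists (K1 * K) => [|z m z1]; first by rewrite mulr_ge0.
(* Only the first m points are present, so finitely many boxes suffice; the final bound is free of J
   and D. *)
pose J := (\max_(k < m) box_level (a k)).+1.
pose D := (\max_(k < m) box_dist z (a k)).+1.
have Jk (k : 'I_m) : (box_level (a k) < J)%N by rewrite ltnS leq_bigmax_cond.
have Dk (k : 'I_m) : (box_dist z (a k) < D)%N by rewrite ltnS leq_bigmax_cond.
pose B : finType := ((bool * bool * bool * 'I_17) * ('I_J * 'I_D))%type.
pose box (k : 'I_m) : B :=
  ((box_axis (a k), box_sign (a k), box_side z (a k), inord (box_ring (a k))),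
   (Ordinal (Jk k), Ordinal (Dk k))).
pose Y (j : nat) : R := 2 ^+ j * (1 - cmod z).
have z0 : 0 < 1 - cmod z by rewrite subr_gt0.
have Y0 j : 0 <= Y j by rewrite mulr_ge0 ?exprn_ge0 // ltW.
pose W (j d : nat) : R := C * psi (2 ^+ j.+1) * (38 / (1 + d%:R + Y j)) ^+ s.+1.
have e1 j : 1 <= 2 ^+ j :> R by rewrite exprn_ege1 // ler1n.
have cell (b : B) : \sum_(k < m | box k == b) cmod (disk_weight (a k) z) ^+ s.+1
    <= W b.2.1 b.2.2.
  have den : 0 < 1 + b.2.2%:R + Y b.2.1 by have := Y0 b.2.1; have := ler0n R b.2.2; lra.
  have w0 : 0 <= (38 / (1 + b.2.2%:R + Y b.2.1)) ^+ s.+1.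
    by rewrite exprn_ge0 // divr_ge0 // ltW.
  apply: (@le_trans _ _ (\sum_(k < m | box k == b) (38 / (1 + b.2.2%:R + Y b.2.1)) ^+ s.+1)).
    apply: ler_sum => k /eqP <- /=.
    by rewrite lerXn2r ?nnegrE ?cmod_ge0 ?divr_ge0 ?box_weight //
      -?[_ + _]/(1 + (box_dist z (a k))%:R + Y (box_level (a k)));
      have := Y0 (box_level (a k)); have := ler0n R (box_dist z (a k)); lra.
  rewrite sumr_const -[leLHS]mulr_natl; rewrite ler_wpM2r //.
  pose F := [seq val k | k <- enum [pred k | box k == b]].
  have sF : size F = #|[pred k | box k == b]| by rewrite size_map -cardE.
  rewrite -sF.
  have uF : uniq F by rewrite map_inj_uniq ?enum_uniq //; exact: val_inj.
  (* The density condition is applied at a point of the box itself, so no centres of boxes have to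
     be constructed. *)
  have [k0 /eqP k0b|none] := pickP [pred k | box k == b]; last first.
    rewrite sF (eq_card0 none) mulr_ge0 ?psi_ge0 // ltW //.
  have Fb k : k \in F -> cmod (a k - a k0) <= (1 - cmod (a k0)) / 2.
    move=> /mapP[l]; rewrite mem_enum inE => /eqP lb ->.
    have E : box l = box k0 by rewrite lb k0b.
    move: E; rewrite /box => -[E1 E2 E3 /(congr1 val) E4 E5 E6].
    rewrite /= !inordK ?box_ring_lt // in E4.
    by apply: (@box_close _ z).
  apply: (le_trans (hC _ _ (a_disk k0) uF Fb)).
  rewrite ler_wpM2l ?(ltW C0) //.
  have -> : b.2.1 = box_level (a k0) :> nat by rewrite -k0b.
  have ak := a_disk k0; have ak0 : 0 < 1 - cmod (a k0) by rewrite subr_gt0.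
  apply: psi_le => //; first by rewrite invf_ge1 // gerBl cmod_ge0.
  have /andP[_ /ltW h] := box_levelP ak.
  by rewrite -(ler_pM2r ak0) mulVf // gt_eqF.
rewrite big_mkord (partition_big box xpredT) //=.
apply: (le_trans (ler_sum _ (fun b _ => cell b))).
rewrite -(pair_bigA _ (fun c (jd : 'I_J * 'I_D) => W jd.1 jd.2)) /=.
rewrite sumr_const !card_prod !card_bool !card_ord.
rewrite -(pair_bigA _ (fun j d => W (val j) (val d))) /=.
rewrite -[leLHS]mulr_natl -mulrA -mulrA.
have -> : (2 * 2 * 2 * 17)%N%:R = 8 * 17 :> R by rewrite -natrM.
rewrite ler_wpM2l //.
apply: (@le_trans _ _ (\sum_(j < J) C * 38 ^+ s.+1 * 2 * (psi (2 ^+ j.+1) * (1 + Y j) ^- s))).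
  apply: ler_sum => j _.
  have := @sum_inv_pow_le R s D (Y j) s0 (Y0 j); rewrite big_mkord => h.
  under eq_bigr do rewrite /W expr_div_n mulrA.
  rewrite -mulr_sumr.
  have q0 : 0 <= C * psi (2 ^+ j.+1) * 38 ^+ s.+1.
    by rewrite !mulr_ge0 ?exprn_ge0 ?psi_ge0 // ltW.
  apply: (le_trans (ler_wpM2l q0 h)).
  by rewrite le_eqVlt; apply/orP; left; apply/eqP; ring.
rewrite -mulr_sumr; rewrite ler_wpM2l ?mulr_ge0 ?exprn_ge0 ?(ltW C0) //.
have := hK (1 - cmod z) J z0; rewrite big_mkord; apply.
by rewrite gerBl cmod_ge0.
Qed.

End DensityCount.

(** * Canonical products and the interpolation series *)

Section Products.
Variable R : realType.

Lemma expRN1_ge : 4^-1 <= expR (-1) :> R.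
Proof.
have h := @expR_ge1Dx R (- 2^-1).
rewrite (_ : -1 = 2%:R * - 2^-1 :> R); last by lra.
rewrite expRM_natl (_ : 4^-1 = 2^-1 ^+ 2 :> R); last by rewrite expr2; lra.
by rewrite lerXn2r ?nnegrE ?expR_ge0 //; lra.
Qed.

Lemma cvgn_eventually_cst (u : nat -> R[i]) (l : R[i]) N :
  (forall m, (N <= m)%N -> u m = l) -> u @ \oo --> l.
Proof.
move=> h; apply/cvg_cmodP => e e0; exists N => // m /= Nm.
by rewrite h // subrr cmod0.
Qed.

Lemma dd_bounded_sub (U V : set R[i]) f (M : R) : V `<=` U ->
  dd_bounded U f M -> dd_bounded V f M.
Proof. by move=> VU h x0 x1 y1 x2 y2 z2 *; apply: h; apply: VU. Qed.

Lemma dd_bounded_disk_derivable (f : R[i] -> R[i]) (c : R[i]) (M : R) : in_disk c ->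
  dd_bounded [set x | cmod x <= 1 - (1 - cmod c) / 2] f M -> derivable f c 1.
Proof.
rewrite /in_disk => c1 h.
apply: (@dd_bounded_derivable _ _ _ ((1 - cmod c) / 2) M); first lra.
apply: dd_bounded_sub h => x /=.
by have := cmodD (x - c) c; rewrite subrK; lra.
Qed.

Variables (a : nat -> R[i]) (s : nat).
Hypothesis a_disk : forall n, in_disk (a n).
Variables (T : R -> R) (K0 : R).
Hypothesis K0_ge0 : 0 <= K0.
Hypothesis T1 : T 1 = 0.
Hypothesis T_le : forall x y, 1 <= x -> x <= y -> T x <= T y.
Hypothesis T_double : exists2 K, 1 <= K & forall x, 1 <= x -> T (2 * x) <= K * (T x + 1).
Hypothesis T_superlog : forall A, exists2 B, 0 <= B & forall x, 1 <= x -> A * ln x <= T x + B.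
Local Notation Td z := (T (1 - cmod z)^-1).
Hypothesis weight_sum : forall (z : R[i]) m, in_disk z ->
  \sum_(0 <= k < m) cmod (disk_weight (a k) z) ^+ s.+1 <= K0 * (Td z + 1).

Implicit Types (Q : pred nat).

Let T_ge0 x : 1 <= x -> 0 <= T x.
Proof. by move=> x1; rewrite -T1 T_le. Qed.

Let Td_ge0 z : in_disk z -> 0 <= Td z.
Proof. by move=> z1; rewrite T_ge0 ?in_disk_inv_ge1. Qed.

(** The bound on the weights at z = 0, where the weight is 1 - |a_k|^2 and T(1) = 0. *)
Lemma sum_one_sub_cmod m : \sum_(0 <= k < m) (1 - cmod (a k)) ^+ s.+1 <= K0.
Proof.
have d0 : in_disk (0 : R[i]) by rewrite /in_disk cmod0.
have := weight_sum m d0; rewrite cmod0 subr0 invr1 T1 add0r mulr1.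
apply: le_trans; apply: ler_sum => k _.
have ak := a_disk k.
rewrite cmod_disk_weight // mulr0 subr0 cmod1 divr1.
move: ak; rewrite /in_disk => ak; have c0 := cmod_ge0 (a k).
have h : 1 - cmod (a k) <= 1 - cmod (a k) ^+ 2 by nra.
by rewrite lerXn2r // nnegrE; lra.
Qed.

(** The predicate lets [P], the B_n and the products without a zero at the origin share the same
    estimates, with constants independent of Q. *)
Definition partial_product Q m z : R[i] :=
  \prod_(0 <= k < m | Q k) canonical_factor a s k z.

Lemma partial_productS Q m z : partial_product Q m.+1 z =
  partial_product Q m z * (if Q m then canonical_factor a s m z else 1).
Proof. by rewrite /partial_product !(big_mkcond Q) big_nat_recr. Qed.

Definition product_lim Q z : R[i] := limn (fun m => partial_product Q m z).

Let c2 := primary_const s (2 : R).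

Let c2_ge0 : 0 <= c2.
Proof. by rewrite /c2 /primary_const mulr_ge0 ?expR_ge0. Qed.

Lemma factor_sub1_le k z : in_disk z ->
  cmod (canonical_factor a s k z - 1) <= c2 * cmod (disk_weight (a k) z) ^+ s.+1.
Proof.
move=> z1; rewrite canonical_factorE; apply: primary_factor_sub1; first lra.
by apply: cmod_disk_weight_le2; rewrite ?ltW //; apply: a_disk.
Qed.

Lemma factor_le k z : in_disk z ->
  cmod (canonical_factor a s k z) <= expR (c2 * cmod (disk_weight (a k) z) ^+ s.+1).
Proof.
move=> z1; apply: le_trans (expR_ge1Dx _).
have := cmodD 1 (canonical_factor a s k z - 1); rewrite addrC subrK cmod1 => h.
by apply: (le_trans h); rewrite lerD2l factor_sub1_le.
Qed.

Lemma partial_product_le Q m z : in_disk z ->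
  cmod (partial_product Q m z) <= expR (c2 * K0 * (Td z + 1)).
Proof.
move=> z1; rewrite /partial_product cmod_prod.
apply: (@le_trans _ _ (\prod_(0 <= k < m | Q k) expR (c2 * cmod (disk_weight (a k) z) ^+ s.+1))).
  by apply: ler_prod => k _; rewrite cmod_ge0 factor_le.
rewrite -expR_sum ler_expR -mulr_sumr -mulrA ler_wpM2l //.
apply: le_trans (weight_sum m z1); rewrite [leLHS]big_mkcond /=.
by apply: ler_sum => k _; case: ifP => // _; rewrite exprn_ge0 ?cmod_ge0.
Qed.

Lemma product_lim_cvg Q z : in_disk z ->
  partial_product Q m z @[m --> \oo] --> product_lim Q z.
Proof.
move=> z1; set M := expR (c2 * K0 * (Td z + 1)).
apply: (@cvgn_cmod_summable R (fun m => partial_product Q m z)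
  (fun m => M * (c2 * cmod (disk_weight (a m) z) ^+ s.+1)) (M * (c2 * (K0 * (Td z + 1))))) => m.
  rewrite partial_productS.
  have q0 : 0 <= M * (c2 * cmod (disk_weight (a m) z) ^+ s.+1).
    by rewrite !mulr_ge0 ?expR_ge0 ?exprn_ge0 ?cmod_ge0.
  rewrite -[X in _ - X]mulr1 -mulrBr; case: ifP => _; last first.
    by rewrite subrr mulr0 cmod0.
  by apply: cmodM_le; [exact: partial_product_le|exact: factor_sub1_le].
rewrite -!mulr_sumr ler_wpM2l ?expR_ge0 // ler_wpM2l //.
exact: weight_sum.
Qed.

Lemma product_lim_le Q z : in_disk z ->
  cmod (product_lim Q z) <= expR (c2 * K0 * (Td z + 1)).
Proof.
move=> z1; apply: cvgn_cmod_le (product_lim_cvg (Q := Q) z1) _ => m.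
exact: partial_product_le.
Qed.

Lemma product_lim0 Q k : Q k -> product_lim Q (a k) = 0.
Proof.
move=> Qk; apply: (@cvg_lim _ (@norm_hausdorff _ R[i])).
apply: (@cvgn_eventually_cst _ _ k.+1) => m km.
rewrite /partial_product (big_cat_nat _ km) //= -/(partial_product Q k.+1 _) partial_productS Qk.
by rewrite canonical_factorE disk_weight_diag // primary_factor1 mulr0 mul0r.
Qed.

(** Each factor is 1 plus a term of norm O((1 - |a_k|)^(s+1)), so its norm is at most an
    exponential; submultiplicativity and [sum_one_sub_cmod] bound all partial products at once. *)
Lemma dd_bounded_product_lim (del : R) : 0 < del -> del <= 1 -> exists2 M, 0 <= M &
  forall Q, dd_bounded [set z | cmod z <= 1 - del] (product_lim Q) M.
Proof.
move=> d0 d1; pose X := 6 / del ^+ 3.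
have d30 : 0 < del ^+ 3 by rewrite exprn_gt0.
have d31 : del ^+ 3 <= 1 by rewrite exprn_ile1 // ltW.
have X1 : 1 <= X by rewrite /X ler_pdivlMr //; lra.
have X0 : 0 <= X by lra.
pose c := primary_const s X.
have c0 : 0 <= c by rewrite mulr_ge0 ?expR_ge0 //; lra.
pose U : set R[i] := [set z | cmod z <= 1 - del].
have ak0 k : 0 < 1 - cmod (a k) by rewrite subr_gt0; apply: a_disk.
have fac k : dd_bounded U (canonical_factor a s k)
    (expR (c * X ^+ s.+1 * (1 - cmod (a k)) ^+ s.+1)).
  have E : 6 * (1 - cmod (a k)) / del ^+ 3 = X * (1 - cmod (a k)) by rewrite /X; ring.
  have h := dd_bounded_disk_weight (a_disk k) d0 d1; rewrite E in h.
  have h1 : 0 <= X * (1 - cmod (a k)) by rewrite mulr_ge0 // ltW.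
  have h2 : X * (1 - cmod (a k)) <= X by rewrite ler_piMr // gerBl cmod_ge0.
  have h3 := dd_bounded_primary_factor s X1 h1 h2 h.
  apply: (@dd_bounded_ext _ _ (fun z => 1 + (primary_factor (disk_weight (a k) z) s - 1))).
    by move=> x _; rewrite addrC subrK.
  apply: dd_bounded_le (expR_ge1Dx _) _.
  rewrite -mulrA -exprMn -{1}(cmod1 R).
  exact: dd_boundedD (dd_bounded_cst 1) h3.
pose M := expR (c * X ^+ s.+1 * K0).
exists M => [|Q]; first exact: expR_ge0.
apply: (@dd_bounded_lim _ _ (partial_product Q) _ (fun=> M)); last exact: cvg_cst.
  move=> x Ux; apply: product_lim_cvg; rewrite /in_disk.
  by move: Ux => /=; lra.
move=> m; apply: dd_bounded_le (dd_bounded_prod _ (fun k _ => fac k)).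
rewrite -expR_sum ler_expR -mulr_sumr ler_wpM2l //.
  by apply: mulr_ge0 => //; apply: exprn_ge0.
apply: le_trans (sum_one_sub_cmod m); rewrite [leLHS]big_mkcond /=.
by apply: ler_sum => k _; case: ifP => // _; rewrite exprn_ge0 // ltW.
Qed.

Lemma product_lim_derivable Q z : in_disk z -> derivable (product_lim Q) z 1.
Proof.
move=> z1; have z1' : cmod z < 1 by [].
have := @dd_bounded_product_lim ((1 - cmod z) / 2).
case; [lra|by have := cmod_ge0 z; lra|move=> M _ h].
exact: dd_bounded_disk_derivable z1 (h Q).
Qed.

(** T outgrows (s + 1) log, so summability of (1 - |a_k|)^(s+1) passes to exp(-T_k), the majorant of
    the interpolation series. *)
Lemma exp_opp_T_le : exists2 B, 0 <= B &
  forall k, expR (- Td (a k)) <= B * (1 - cmod (a k)) ^+ s.+1.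
Proof.
have [B B0 hB] := T_superlog s.+1%:R.
exists (expR B) => [|k]; first exact: expR_ge0.
have ak := a_disk k.
have u0 : 0 < 1 - cmod (a k) by rewrite subr_gt0.
have h := hB _ (in_disk_inv_ge1 ak); rewrite lnV ?posrE // in h.
rewrite -[X in _ * X ^+ _]lnK ?posrE // -expRM_natl -expRD ler_expR.
lra.
Qed.

Lemma sum_exp_opp_T : exists2 B, 0 <= B &
  forall m, \sum_(0 <= k < m) expR (- Td (a k)) <= B.
Proof.
have [B B0 hB] := exp_opp_T_le.
exists (B * K0) => [|m]; first exact: mulr_ge0.
apply: (le_trans (ler_sum _ (fun k _ => hB k))).
by rewrite -mulr_sumr ler_wpM2l // sum_one_sub_cmod.
Qed.

(** Iterated doubling; the factor K 2 instead of K absorbs the summand 1 at each step. *)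
Lemma T_scale (x0 : R) : 1 <= x0 -> exists2 K, 0 <= K &
  forall x, 1 <= x -> T (x0 * x) <= K * (T x + 1).
Proof.
move=> x01; have [K K1 hK] := T_double.
have step n x : 1 <= x -> T (2 ^+ n * x) <= (K * 2) ^+ n * (T x + 1).
  move=> x1; have Tx := T_ge0 x1.
  elim: n => [|n ih]; first by rewrite !expr0 !mul1r; lra.
  have y1 : 1 <= 2 ^+ n * x.
    by rewrite -[leLHS]mulr1 ler_pM // exprn_ege1 // ler1n.
  rewrite exprS -mulrA; apply: (le_trans (hK _ y1)).
  have p1 : 1 <= (K * 2) ^+ n by rewrite exprn_ege1 //; lra.
  have : K * (T (2 ^+ n * x) + 1) <= K * ((K * 2) ^+ n * (T x + 1) + (K * 2) ^+ n * (T x + 1)).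
    by rewrite ler_wpM2l; [|lra|]; rewrite // lerD // -[leLHS]mulr1 ler_pM //; lra.
  by move=> h; apply: (le_trans h); rewrite exprS le_eqVlt; apply/orP; left; apply/eqP; ring.
pose n := Num.bound x0.
exists ((K * 2) ^+ n) => [|x x1]; first by rewrite exprn_ge0 //; lra.
apply: le_trans (step n x x1); apply: T_le.
  by rewrite -[leLHS]mulr1 ler_pM.
rewrite ler_wpM2r //; first lra.
apply/ltW; apply: (@lt_le_trans _ _ n%:R); first by apply: archi_boundP; lra.
by rewrite -natrX ler_nat ltnW // ltn_expl.
Qed.

(* The power of the weight attached to a point: either the weight is at most
   1/e, and the power absorbs the interpolation data, or [T] is controlled. *)
Lemma weight_power_le (C1 t X X0 T0 : R) (k : nat) : 0 <= C1 -> 0 <= t -> 0 <= T0 ->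
  1 <= X0 -> 0 <= X -> X <= X0 -> (2 * C1 + 1) * (t + 1) <= k%:R ->
  k%:R <= (2 * C1 + 1) * (t + 1) + 1 -> (expR (-1) < X -> t <= T0) ->
  expR (2 * C1 * (t + 1)) * X ^+ k <=
  expR (X0 * ((2 * C1 + 1) * (T0 + 1) + 1) + 2 * C1 * (T0 + 1) + T0) * expR (- t).
Proof.
move=> C10 t0 T00 X01 X00 XX k1 k2 alt; rewrite -expRD.
(* Of the exponent (2 C1 + 1) (t + 1), the part 2 C1 (t + 1) cancels the coefficient and the rest
   leaves exp(-t) for the summation over the points. *)
have [Xe|eX] := leP X (expR (-1)).
  have h : X ^+ k <= expR (- ((2 * C1 + 1) * (t + 1))).
    apply: (@le_trans _ _ (expR (-1) ^+ k)).
      by rewrite lerXn2r ?nnegrE ?expR_ge0.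
    by rewrite -expRM_natl ler_expR; lra.
  apply: (@le_trans _ _ (expR (2 * C1 * (t + 1)) * expR (- ((2 * C1 + 1) * (t + 1))))).
    by rewrite ler_wpM2l // expR_ge0.
  rewrite -expRD ler_expR.
  have : 0 <= X0 * ((2 * C1 + 1) * (T0 + 1) + 1) by rewrite mulr_ge0 ?addr_ge0 ?mulr_ge0 //; lra.
  have : 0 <= 2 * C1 * (T0 + 1) by rewrite !mulr_ge0 //; lra.
  lra.
have tT := alt eX.
have h : X ^+ k <= expR (X0 * k%:R).
  apply: (@le_trans _ _ (expR X0 ^+ k)); last by rewrite -expRM_natl mulrC.
  rewrite lerXn2r ?nnegrE ?expR_ge0 //; apply: (le_trans XX).
  by apply: le_trans (expR_ge1Dx _); lra.
apply: (@le_trans _ _ (expR (2 * C1 * (t + 1)) * expR (X0 * k%:R))).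
  by rewrite ler_wpM2l // expR_ge0.
rewrite -expRD ler_expR.
have h1 : 2 * C1 * (t + 1) <= 2 * C1 * (T0 + 1) by rewrite ler_wpM2l ?mulr_ge0 //; lra.
have h2 : X0 * k%:R <= X0 * ((2 * C1 + 1) * (T0 + 1) + 1).
  rewrite ler_wpM2l //; first lra.
  apply: (le_trans k2); rewrite lerD2r ler_wpM2l //; lra.
lra.
Qed.

(** The factor of a point at the origin is identically 0, so it must be left out for the product to
    be nonzero at a n. *)
Definition other_zeros n : pred nat := fun k => (k != n) && (a k != 0).

Let G n := product_lim (other_zeros n).

(** The coefficient exp(2 C1 (T_n + 1)) counts C1 once for b_n and once for the lower bound.
    [weight_power_le] is used twice: on |w_n(z)| with bound 2 for the growth, and on the
    divided-difference bound of w_n with bound 6 / del^3 for the analyticity. That C precedes b lets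
    the data be changed later by quantities depending on C. *)
Lemma interpolation_from_lower_bound (C1 : R) : 0 <= C1 ->
  (forall n, a n != 0 -> expR (- (C1 * (Td (a n) + 1))) <= cmod (G n (a n))) ->
  injective a ->
  exists2 C, 0 <= C & forall b : nat -> R[i],
    (forall n, a n != 0 -> cmod (b n) <= expR (C1 * (Td (a n) + 1))) ->
    exists f, [/\ analytic_in_disk f, forall n, a n != 0 -> f (a n) = b n &
      forall z, in_disk z -> cmod (f z) <= expR (C * (Td z + 1))].
Proof.
move=> C10 low a_inj.
have [B B0 hB] := sum_exp_opp_T.
(* If |w_n(z)| > 1/e >= 1/4, then (1 - |z|) / 4 <= 2 (1 - |a_n|), whence the dilation 8. *)
have [K8 K80 hK8] := @T_scale 8 ltac:(lra).
pose T0 z := K8 * (Td z + 1).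
pose Cz := 2 * ((2 * C1 + 1) * (K8 + 1) + 1) + 2 * C1 * (K8 + 1) + K8.
have cK0 : 0 <= c2 * K0 by exact: mulr_ge0.
have Cz0 : 0 <= Cz by have := mulr_ge0 C10 K80; rewrite /Cz; lra.
exists (c2 * K0 + Cz + B) => [|b hb]; first lra.
pose k n := (Num.truncn ((2 * C1 + 1) * (Td (a n) + 1))).+1.
have t0 n : 0 <= Td (a n) by apply/Td_ge0/a_disk.
have kP n : (2 * C1 + 1) * (Td (a n) + 1) <= (k n)%:R /\
    (k n)%:R <= (2 * C1 + 1) * (Td (a n) + 1) + 1.
  have u0 : 0 <= (2 * C1 + 1) * (Td (a n) + 1).
    by rewrite mulr_ge0 ?addr_ge0 ?mulr_ge0.
  have /andP[h1 h2] := truncn_itv u0.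
  by split; [exact: ltW|rewrite /k -natr1 lerD2r].
pose nz n := a n != 0.
pose term n z := if nz n then
  b n / G n (a n) * (G n z * disk_weight (a n) z ^+ k n) else 0.
have coefP n : nz n -> cmod (b n / G n (a n)) <= expR (2 * C1 * (Td (a n) + 1)).
  move=> an; rewrite -mulrA mulr_natl mulr2n expRD.
  apply: cmodM_le; first exact: hb.
  rewrite cmodV -[leRHS]invrK lef_pV2 ?posrE ?invr_gt0 ?expR_gt0 //.
    by rewrite -expRN; apply: low.
  by apply: lt_le_trans (low n an); apply: expR_gt0.
have termP n z : in_disk z ->
    cmod (term n z) <= expR ((c2 * K0 + Cz) * (Td z + 1)) * expR (- Td (a n)).
  move=> z1; have Tz := Td_ge0 z1; rewrite /term; case: ifP => an; last first.
    by rewrite cmod0 mulr_ge0 ?expR_ge0.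
  rewrite mulrCA (mulrDl (c2 * K0)) expRD -mulrA.
  apply: cmodM_le; first exact: product_lim_le.
  have [k1 k2] := kP n; have ak := a_disk n.
  have alt : expR (-1) < cmod (disk_weight (a n) z) -> Td (a n) <= T0 z.
    move=> h; apply: le_trans (hK8 _ (in_disk_inv_ge1 z1)); apply: T_le; first exact: in_disk_inv_ge1.
    have z0 : 0 < 1 - cmod z by rewrite subr_gt0.
    have an0 : 0 < 1 - cmod (a n) by rewrite subr_gt0.
    have dz := disk_den_ge_r ak (ltW z1).
    rewrite cmod_disk_weight // in h.
    rewrite ltr_pdivlMr in h; last by apply: lt_le_trans dz.
    have nw := disk_weight_num_le ak.
    have e4 := expRN1_ge.
    rewrite -(ler_pM2r an0) mulVf ?gt_eqF // mulrAC -(ler_pM2r z0) mul1r.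
    rewrite mulfVK ?gt_eqF //.
    have : 4^-1 * (1 - cmod z) <= expR (-1) * cmod (1 - conjc (a n) * z).
      by rewrite ler_pM //; lra.
    lra.
  have W2 := cmod_disk_weight_le2 ak (ltW z1).
  have T00 : 0 <= T0 z by rewrite mulr_ge0 // addr_ge0.
  have key := weight_power_le C10 (t0 n) T00 (ler1n R 2) (cmod_ge0 _) W2 k1 k2 alt.
  rewrite cmodM cmodX; apply: (@le_trans _ _
    (expR (2 * C1 * (Td (a n) + 1)) * cmod (disk_weight (a n) z) ^+ k n)).
    by rewrite ler_wpM2r ?exprn_ge0 ?cmod_ge0 // coefP.
  apply: (le_trans key); rewrite ler_wpM2r ?expR_ge0 // ler_expR /Cz /T0.
  have : 0 <= C1 * Td z by rewrite mulr_ge0.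
  lra.
pose F m z := \sum_(0 <= n < m) term n z.
have Fcvg z : in_disk z -> cvgn (fun m => F m z).
  move=> z1; set M := expR ((c2 * K0 + Cz) * (Td z + 1)).
  apply: (@cvgn_cmod_summable R (fun m => F m z) (fun m => M * expR (- Td (a m))) (M * B)) => m.
    by rewrite /F big_nat_recr //= [X in X - _]addrC addrK; apply: termP.
  by rewrite -mulr_sumr ler_wpM2l ?expR_ge0.
pose f z := limn (fun m => F m z).
exists f; split.
- move=> z z1.
  have z1' : cmod z < 1 by [].
  pose del := (1 - cmod z) / 2.
  have d0 : 0 < del by rewrite /del; lra.
  have d1 : del <= 1 by rewrite /del; have := cmod_ge0 z; lra.
  have [M M0 hM] := dd_bounded_product_lim d0 d1.
  pose X := 6 / del ^+ 3.
  have d30 : 0 < del ^+ 3 by rewrite exprn_gt0.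
  have d31 : del ^+ 3 <= 1 by rewrite exprn_ile1 // ltW.
  have X1 : 1 <= X by rewrite /X ler_pdivlMr //; lra.
  (* If X (1 - |a_n|) > 1/e, then 1 / (1 - |a_n|) < x0, so T_n <= T x0 on this disk. *)
  pose x0 := X * expR 1.
  have x01 : 1 <= x0.
    by rewrite -[leLHS]mulr1 ler_pM // -expR0 ler_expR.
  pose U : set R[i] := [set x | cmod x <= 1 - del].
  pose E := expR (X * ((2 * C1 + 1) * (T x0 + 1) + 1) + 2 * C1 * (T x0 + 1) + T x0).
  have bound n : dd_bounded U (term n) (M * E * expR (- Td (a n))).
    have q0 : 0 <= M * E * expR (- Td (a n)) by rewrite !mulr_ge0 ?expR_ge0.
    have [an|an] := boolP (nz n); last first.
      have -> : term n = fun=> 0 by apply/funext => x; rewrite /term (negPf an).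
      apply: (@dd_bounded_le _ _ _ 0) => //.
      by rewrite -[X in dd_bounded _ _ X](cmod0 R); apply: dd_bounded_cst.
    have -> : term n = fun z => b n / G n (a n) * (G n z * disk_weight (a n) z ^+ k n).
      by apply/funext => x; rewrite /term an.
    have [k1 k2] := kP n; have ak := a_disk n.
    have an0 : 0 < 1 - cmod (a n) by rewrite subr_gt0.
    have wE : 6 * (1 - cmod (a n)) / del ^+ 3 = X * (1 - cmod (a n)) by rewrite /X; ring.
    have h := dd_bounded_disk_weight ak d0 d1; rewrite wE in h.
    have w0 : 0 <= X * (1 - cmod (a n)) by rewrite mulr_ge0 ?(ltW an0) //; lra.
    have wX : X * (1 - cmod (a n)) <= X by rewrite ler_piMr ?gerBl ?cmod_ge0 //; lra.
    have alt : expR (-1) < X * (1 - cmod (a n)) -> Td (a n) <= T x0.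
      move=> g; apply: T_le; first exact: in_disk_inv_ge1.
      rewrite -(ler_pM2r an0) mulVf ?gt_eqF // /x0 mulrAC.
      rewrite -(ler_pM2l (expR_gt0 (-1))) mulr1 mulrCA -expRD addNr expR0 mulr1.
      exact: ltW.
    have key := weight_power_le C10 (t0 n) (T_ge0 x01) X1 w0 wX k1 k2 alt.
    pose Xk := (X * (1 - cmod (a n))) ^+ k n.
    have st1 : expR (2 * C1 * (Td (a n) + 1)) * (M * Xk) <= M * E * expR (- Td (a n)).
      by rewrite mulrCA -(mulrA M) ler_wpM2l.
    have st2 : cmod (b n / G n (a n)) * (M * Xk) <= expR (2 * C1 * (Td (a n) + 1)) * (M * Xk).
      by rewrite ler_wpM2r ?coefP // mulr_ge0 // exprn_ge0.
    apply: (dd_bounded_le (le_trans st2 st1)).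
    exact: (dd_boundedM (dd_bounded_cst _) (dd_boundedM (hM _) (dd_boundedX _ h))).
  apply: (@dd_bounded_disk_derivable f z (M * E * B) z1).
  apply: (@dd_bounded_lim _ _ F _ (fun=> M * E * B)); last exact: cvg_cst.
    move=> x /= xd; apply: Fcvg; rewrite /in_disk.
    by move: xd; lra.
  move=> m; apply: dd_bounded_le (dd_bounded_sum _ (fun n _ => bound n)).
  by rewrite -mulr_sumr ler_wpM2l // mulr_ge0 ?expR_ge0.
- move=> n an; apply: (@cvg_lim _ (@norm_hausdorff _ R[i])).
  apply: (@cvgn_eventually_cst _ _ n.+1) => m nm.
  rewrite /F (bigD1_seq n) ?mem_index_iota ?iota_uniq //= big1 ?addr0.
    rewrite /term /nz an disk_weight_diag ?expr1n ?mulr1 ?divfK //.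
    by rewrite -cmod_gt0; apply: lt_le_trans (low n an); apply: expR_gt0.
  move=> l ln; rewrite /term; case: ifP => // al.
  rewrite /G (@product_lim0 (other_zeros l) n) ?mul0r ?mulr0 //.
  by rewrite /other_zeros an andbT eq_sym.
- move=> z z1; have Tz := Td_ge0 z1.
  apply: (@cvgn_cmod_le _ (fun m => F m z)); first exact: Fcvg.
  move=> m; apply: (@le_trans _ _ (expR ((c2 * K0 + Cz) * (Td z + 1)) * B)).
    apply: (le_trans (cmod_sum _ _ _)).
    apply: (le_trans (ler_sum _ (fun n _ => termP n z z1))).
    by rewrite -mulr_sumr ler_wpM2l ?expR_ge0.
  rewrite (mulrDl _ B) expRD ler_wpM2l ?expR_ge0 //.
  apply: le_trans (expR_ge1Dx _).
  have : 0 <= B * Td z by rewrite mulr_ge0.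
  lra.
Qed.

End Products.

(** * Lower bounds for the products *)

Section IntegratedCount.
Variable R : realType.
Import HBNNSimple.
Local Notation mu := (@lebesgue_measure R).

(** The integral of a nonnegative function is a supremum over the simple functions below it; this
    spares a measurability proof for the counting function. *)
Lemma ge0_le_integral_nomeas (D : set R) (f g : R -> \bar R) :
  (forall x, D x -> 0 <= f x)%E -> (forall x, D x -> f x <= g x)%E ->
  (\int[mu]_(x in D) f x <= \int[mu]_(x in D) g x)%E.
Proof.
move=> f0 fg.
have g0 x : D x -> (0 <= g x)%E by move=> Dx; apply: le_trans (f0 x Dx) (fg x Dx).
rewrite !ge0_integralE //; apply: le_ereal_sup => _ [h hf <-].
exists h => // x; apply: le_trans (hf x) _.
by apply: lee_restrict.
Qed.

Lemma integral_inv (d r : R) : 0 < d -> d <= r ->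
  (\int[mu]_(t in `[d, r]) (t^-1)%:E = (ln r - ln d)%:E)%E.
Proof.
move=> d0; rewrite le_eqVlt => /predU1P[<-|dr].
  by rewrite set_itv1 integral_set1 subrr.
rewrite (@continuous_FTC2 _ (fun t => t^-1) (@ln R)) //.
- apply: continuous_in_subspaceT => x; rewrite inE /= in_itv /= => /andP[dx _].
  by apply: inv_continuous; rewrite gt_eqF //; lra.
- split.
  + move=> x; rewrite in_itv /= => /andP[dx _].
    by apply: ex_derive; apply: is_derive1_ln; lra.
  + apply: cvg_at_right_filter; apply: continuous_ln; lra.
  + apply: cvg_at_left_filter; apply: continuous_ln; lra.
- move=> x; rewrite in_itv /= => /andP[dx _]; rewrite derive1E.
  by have [_ ->] := @is_derive1_ln R x ltac:(lra).
Qed.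

(** As in Jensen's formula, each point at distance d_k from a n contributes the integral of 1 / t
    over [d_k, r], that is ln r - ln d_k. *)
Lemma Ncount_lower (a : nat -> R[i]) (n : nat) (r c : R) (F : seq nat) : 0 < r ->
  injective a -> (Ncount a (a n) r <= c%:E)%E -> uniq F ->
  (forall k, k \in F -> k != n /\ cmod (a k - a n) <= r) ->
  \sum_(k <- F) (ln r - ln (cmod (a k - a n))) <= c.
Proof.
move=> r0 a_inj Nc uF hF.
pose d k := cmod (a k - a n).
have d0 k : k \in F -> 0 < d k.
  move=> /hF[kn _]; rewrite /d cmod_gt0 subr_eq0.
  by apply: contra_neq kn => /a_inj.
pose g k := (fun t : R => (t^-1)%:E : \bar R) \_ `[d k, r].
have g0 k t : 0 <= t -> (0 <= g k t)%E.
  by move=> t0; rewrite /g /patch; case: ifP => // _; rewrite lee_fin invr_ge0.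
have mg k : k \in F -> measurable_fun `[0, r] (g k).
  move=> kF; apply/measurable_restrict => //.
  apply/measurable_EFinP.
  have sub : `[0, r] `&` `[d k, r] `<=` `[d k, r] by move=> x [].
  apply: (measurable_funS _ sub) => //.
  apply: subspace_continuous_measurable_fun => //.
  apply: continuous_in_subspaceT => x; rewrite inE /= in_itv /= => /andP[dx _].
  by apply: inv_continuous; rewrite gt_eqF //; have := d0 k kF; lra.
have gI k : k \in F -> (\int[mu]_(t in `[0%R, r]) g k t = (ln r - ln (d k))%:E)%E.
  move=> kF; rewrite /g -integral_mkcondr.
  have [_ dr] := hF k kF; have d0k := d0 k kF.
  rewrite (_ : _ `&` _ = `[d k, r]%classic); first exact: integral_inv.
  apply/seteqP; split => x /=; first by case.
  rewrite !in_itv /= => /andP[h1 h2]; split; rewrite ?h1 ?h2 // andbT; lra.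
rewrite -lee_fin; apply: le_trans Nc; rewrite /Ncount.
rewrite -sumEFin [leLHS]big_seq.
under eq_bigr => k kF do rewrite -(gI k kF).
rewrite -big_seq.
have {}mg' k : measurable_fun `[0%R, r] (if k \in F then g k else cst 0%E).
  by case: ifP => [/mg //|_]; exact: measurable_cst.
rewrite [leLHS](_ : _ = \sum_(k <- F) (\int[mu]_(t in `[0%R, r]) (if k \in F then g k else cst 0%E) t))%E; last first.
  by rewrite big_seq [RHS]big_seq; apply: eq_bigr => k ->.
rewrite -ge0_integral_sum //; last first.
  move=> k t /=; rewrite in_itv /= => /andP[t0 _]; case: ifP => // _; exact: g0.
apply: ge0_le_integral_nomeas => t /=; rewrite in_itv /= => /andP[t0 tr].
  by apply: sume_ge0 => k _; case: ifP => // _; exact: g0.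
(* At t = 0 both integrands are 0, as the inverse of 0 is 0. *)
have [->|tn0] := eqVneq t 0.
  rewrite invr0 mule0 big_seq big1 // => k kF; rewrite kF /g /patch mem_setE in_itv /=.
  by case: ifP => // _; rewrite invr0.
have tp : 0 < t by rewrite lt_def tn0.
pose Ft := [seq k <- F | d k <= t].
have -> : (\sum_(k <- F) (if k \in F then g k else cst 0) t = ((size Ft)%:R * t^-1)%:E)%E.
  transitivity (\sum_(k <- F) (if d k <= t then t^-1 else 0)%:E)%E.
    rewrite big_seq [RHS]big_seq; apply: eq_bigr => k kF.
    by rewrite kF /g /patch mem_setE in_itv /= tr andbT; case: ifP.
  rewrite sumEFin; congr EFin; rewrite -big_mkcond /= -big_filter.
  by rewrite big_const_seq count_predT iter_addr_0 mulr_natl.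
rewrite EFinM; apply: lee_wpmul2r; first by rewrite lee_fin invr_ge0.
rewrite le_max; apply/orP; left.
rewrite -[leRHS]/(ncount a (a n) t - 1)%E leeBrDr //.
(* The index n itself joins the list; this matches the 1 subtracted in [Ncount]. *)
have -> : ((size Ft)%:R%:E + 1 = (size (n :: Ft))%:R%:E :> \bar R)%E.
  by rewrite /= -natr1 EFinD.
apply: counting_ge_size.
  rewrite /= filter_uniq // andbT mem_filter negb_and; apply/orP; right.
  by apply/negP => /hF[]; rewrite eqxx.
move=> k; rewrite inE => /predU1P[->|].
  by rewrite /= subrr cmod0.
by rewrite mem_filter => /andP[].
Qed.

(** Exponential form of the preceding bound: truncation at 1 lets the product run over all k
    different from n, the points farther than r contributing 1. *)
Lemma Ncount_prod (a : nat -> R[i]) (n : nat) (r c : R) (m : nat) : 0 < r ->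
  injective a -> (Ncount a (a n) r <= c%:E)%E ->
  expR (- c) <= \prod_(0 <= k < m | k != n) Num.min 1 (cmod (a k - a n) / r).
Proof.
move=> r0 a_inj Nc.
pose F := [seq k <- index_iota 0 m | (k != n) && (cmod (a k - a n) <= r)].
have uF : uniq F by rewrite filter_uniq // iota_uniq.
have hF k : k \in F -> k != n /\ cmod (a k - a n) <= r.
  by rewrite mem_filter => /andP[/andP[]].
have h := Ncount_lower r0 a_inj Nc uF hF.
apply: (@le_trans _ _ (expR (- \sum_(k <- F) (ln r - ln (cmod (a k - a n)))))).
  by rewrite ler_expR lerN2.
rewrite -sumrN expR_sum big_filter big_mkcondr /=.
apply: ler_prod => k kn; rewrite fun_if expR_ge0.
have dk : 0 < cmod (a k - a n).
  by rewrite cmod_gt0 subr_eq0; apply: contra_neq kn => /a_inj.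
case: ifP => kr; first rewrite opprB expRB !lnK ?posrE //.
  by rewrite le_min lexx andbT ler_pdivrMr ?mul1r // kr divr_ge0 // ltW.
rewrite ler01 le_min lexx ler_pdivlMr // mul1r ltW // ltNge kr //.
Qed.

End IntegratedCount.

(** * Lower bounds at the points from each of the three conditions *)

Section LowerBounds.
Variable R : realType.

Lemma one_sub_ge_expR (x : R) : 0 <= x -> x <= 2^-1 -> expR (- (2 * x)) <= 1 - x.
Proof.
move=> x0 x2; have e := expR_ge1Dx (2 * x).
rewrite expRN -[leRHS]invrK lef_pV2 ?posrE ?expR_gt0 ?invr_gt0 //; last lra.
apply: le_trans e; rewrite -[leLHS]mul1r ler_pdivrMr; last lra.
nra.
Qed.

Lemma derive1_cmod_le (f : R[i] -> R[i]) (w : R[i]) (L M rho : R) : derivable f w 1 ->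
  0 < rho -> (forall h, h != 0 -> cmod h < rho ->
    cmod ((f (h + w) - f w) / h) <= L + M * cmod h) -> cmod (derive1 f w) <= L.
Proof.
move=> df rho0 hq; apply/ler_addgt0Pr => e e0.
have c : (fun h => h^-1 *: (f (h + w) - f w)) @ (0 : R[i])^' --> derive1 f w.
  have := df; rewrite /derivable.
  by under eq_fun do rewrite [_ *: 1]mulr1.
move/cvgrPdist_lt : c => /(_ (e / 2)%:C%C).
rewrite ltcR => /(_ ltac:(lra)).
rewrite near_withinE /= near_simpl => /nbhs_ballP [del /= del0 hdel].
have /complex_realP [dl dlE] : del \is Num.real by rewrite gtr0_real.
rewrite dlE ltcR in del0.
pose M1 := `|M| + 1; have M10 : 0 < M1 by rewrite /M1; have := normr_ge0 M; lra.
pose t := Num.min (rho / 2) (Num.min (dl / 2) (e / 2 / M1)).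
have t0 : 0 < t by rewrite !lt_min !divr_gt0.
pose h : R[i] := t%:C%C.
have ht : cmod h = t by rewrite cmodR gtr0_norm.
have h0 : h != 0 by rewrite -cmod_gt0 ht.
have t1 : t <= rho / 2 by rewrite ge_min lexx.
have t2 : t <= dl / 2 by rewrite !ge_min lexx orbT.
have t3 : t <= e / 2 / M1 by rewrite !ge_min lexx !orbT.
have hb : ball 0 del h by rewrite /ball /= sub0r normrN norm_cmod dlE ltcR ht; lra.
have := hdel h hb h0; rewrite norm_cmod ltcR /GRing.scale /= mulrC => q1.
have q2 := hq h h0 ltac:(rewrite ht; lra); rewrite ht in q2.
have q3 : M * t <= e / 2.
  apply: (@le_trans _ _ (M1 * t)); last by rewrite mulrC -ler_pdivlMr.
  by rewrite ler_wpM2r ?(ltW t0) // /M1; have := ler_norm M; lra.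
have := cmodD (derive1 f w - (f (h + w) - f w) / h) ((f (h + w) - f w) / h).
by rewrite subrK; lra.
Qed.

Variables (a : nat -> R[i]) (s : nat).
Hypothesis a_disk : forall n, in_disk (a n).
Hypothesis a_inj : injective a.
Variables (T : R -> R) (K0 : R).
Hypothesis K0_ge0 : 0 <= K0.
Hypothesis T1 : T 1 = 0.
Hypothesis T_le : forall x y, 1 <= x -> x <= y -> T x <= T y.
Local Notation Td z := (T (1 - cmod z)^-1).
Hypothesis weight_sum : forall (z : R[i]) m, in_disk z ->
  \sum_(0 <= k < m) cmod (disk_weight (a k) z) ^+ s.+1 <= K0 * (Td z + 1).

Let Td_ge0 z : in_disk z -> 0 <= Td z.
Proof. by move=> z1; rewrite -T1 T_le ?in_disk_inv_ge1. Qed.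

(** Only finitely many points have modulus below 1/2. The bound is wanted because 1 - w_k(z) carries
    the factor conj a_k. *)
Lemma nonzero_points_away : exists2 al : R, 0 < al <= 1 &
  forall k, a k != 0 -> al <= cmod (a k).
Proof.
have S := sum_one_sub_cmod a_disk T1 weight_sum.
have ak0 k : 0 < 1 - cmod (a k) by rewrite subr_gt0; apply: a_disk.
have c : cvgn (series (fun k => (1 - cmod (a k)) ^+ s.+1)).
  apply: nondecreasing_is_cvgn.
    apply: (nondecreasing_series (P := xpredT) (m := 0)) => n _ _.
    by rewrite exprn_ge0 // ltW.
  by exists K0 => _ [n _ <-]; apply: S.
have /cvgrPdist_lt /(_ (2^-1 ^+ s.+1)) := cvg_series_cvg_0 c.
case; first by rewrite exprn_gt0.
move=> N _ hN.
have tail k : (N <= k)%N -> 2^-1 <= cmod (a k).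
  move=> /hN /=; rewrite sub0r normrN ger0_norm ?exprn_ge0 ?(ltW (ak0 k)) //.
  by rewrite ltr_pXn2r ?nnegrE ?(ltW (ak0 k)) //; lra.
have [al al0 hal] : exists2 al : R, 0 < al <= 2^-1 &
    forall k, (k < N)%N -> a k != 0 -> al <= cmod (a k).
  elim: (N) => [|m [al al0 hal]]; first by exists 2^-1 => //; lra.
  have [am|am] := eqVneq (a m) 0.
    exists al => // k; rewrite ltnS leq_eqVlt => /predU1P[->|]; last exact: hal.
    by rewrite am eqxx.
  exists (Num.min al (cmod (a m))).
    by rewrite lt_min ge_min cmod_gt0 am andbT; move/andP : al0 => [-> ->].
  move=> k; rewrite ltnS leq_eqVlt => /predU1P[->|km] ak; rewrite ge_min ?lexx ?orbT //.
  by rewrite hal.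
exists al => [|k ak]; first lra.
have [kN|Nk] := ltnP k N; first exact: hal.
by have := tail k Nk; lra.
Qed.

Lemma canonical_factor_origin k z : a k = 0 -> canonical_factor a s k z = 0.
Proof.
move=> ak; rewrite canonical_factorE ak /disk_weight conjc0 mul0r cmod0 expr0n /= !subr0 divr1.
exact: primary_factor1.
Qed.

Let c2 : R := primary_const s 2.

Let c2_ge0 : 0 <= c2.
Proof. by rewrite /c2 /primary_const mulr_ge0 ?expR_ge0. Qed.

(** If c2 u <= 1/2, the factor is within 1/2 of 1 and is at least exp(-2 c2 u). Otherwise 1 < 2 c2
    u, so the constant loss exp(-L) can be charged to the weight as exp(-2 c2 u L); the sum of the
    weights then controls all such losses, without counting the points concerned. *)
Lemma factor_lower : exists2 c3, 0 <= c3 & forall n k, k != n -> a k != 0 ->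
  expR (- (c3 * cmod (disk_weight (a k) (a n)) ^+ s.+1)) *
    Num.min 1 (cmod (a k - a n) / ((1 - cmod (a n)) / 2))
  <= cmod (canonical_factor a s k (a n)).
Proof.
have [al /andP[al0 al1] hal] := nonzero_points_away.
pose p2 : R := pnorm (logpoly R s) 2.
have p20 : 0 <= p2 by apply: pnorm_ge0.
pose L := p2 + ln (5 / al).
have al5 : 1 <= 5 / al by rewrite ler_pdivlMr //; lra.
have L0 : 0 <= L by rewrite addr_ge0 // ln_ge0.
exists (2 * c2 * (1 + L)) => [|n k kn ak].
  by apply: mulr_ge0; [apply: mulr_ge0|lra].
set u := cmod (disk_weight _ _) ^+ _; set d := cmod (a k - a n).
set r := (1 - cmod (a n)) / 2.
have an1 : cmod (a n) < 1 by apply: a_disk.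
have r0 : 0 < r by rewrite /r; lra.
have d0 : 0 < d by rewrite /d cmod_gt0 subr_eq0; apply: contra_neq kn => /a_inj.
have u0 : 0 <= u by rewrite exprn_ge0 ?cmod_ge0.
have m0 : 0 <= Num.min 1 (d / r) by rewrite le_min ler01 divr_ge0 // ltW.
have m1 : Num.min 1 (d / r) <= 1 by rewrite ge_min lexx.
have W2 : cmod (disk_weight (a k) (a n)) <= 2 by apply: cmod_disk_weight_le2; rewrite ?ltW.
have cu0 : 0 <= c2 * u by exact: mulr_ge0.
have cuL : 0 <= c2 * u * L by exact: mulr_ge0.
have [cu|cu] := leP (c2 * u) 2^-1.
  have h1 : 1 - c2 * u <= cmod (canonical_factor a s k (a n)).
    have := factor_sub1_le s a_disk k (z := a n) an1; rewrite -/c2 -/u cmodC => h.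
    by have := cmodD (1 - canonical_factor a s k (a n)) (canonical_factor a s k (a n));
      rewrite subrK cmod1; lra.
  apply: le_trans h1; apply: le_trans (one_sub_ge_expR cu0 cu).
  rewrite -[leRHS]mulr1 ler_pM ?expR_ge0 // ler_expR; lra.
rewrite canonical_factorE.
apply: le_trans (primary_factor_ge s W2); rewrite -/p2.
have den0 : 0 < cmod (1 - conjc (a k) * a n).
  by rewrite cmod_gt0 disk_den_neq0 // ltW.
(* By 1 - conj a_k a_n = (1 - |a_n|^2) + conj (a_n - a_k) a_n and 1 - |a_n|^2 <= 4 r. *)
have den : cmod (1 - conjc (a k) * a n) <= 4 * r + d.
  have -> : 1 - conjc (a k) * a n = (1 - (cmod (a n) ^+ 2)%:C%C) + conjc (a n - a k) * a n.
    have -> : (cmod (a n) ^+ 2)%:C%C = conjc (a n) * a n.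
      by rewrite cmod_sqr add_Re2_Im2 sqr_normc mulrC.
    by rewrite rmorphB /=; ring.
  apply: (le_trans (cmodD _ _)); apply: lerD.
    by rewrite disk_weight_num //; have := disk_weight_num_le (a_disk n); rewrite /r; lra.
  rewrite -[leRHS]mulr1; apply: cmodM_le; last exact: ltW.
  by rewrite cmodJ cmodC.
have w1 : al / 5 * Num.min 1 (d / r) <= cmod (1 - disk_weight (a k) (a n)).
  rewrite one_sub_disk_weight ?(ltW an1) // !cmodM cmodV cmodJ -/d ler_pdivlMr //.
  apply: (@le_trans _ _ (al / 5 * Num.min 1 (d / r) * (4 * r + d))).
    by rewrite ler_wpM2l // mulr_ge0 // divr_ge0 // ltW.
  have key : Num.min 1 (d / r) * (4 * r + d) <= 5 * d.
    have [dr|rd] := leP r d.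
      by apply: (@le_trans _ _ (1 * (4 * r + d))); [rewrite ler_wpM2r //; lra|lra].
    apply: (@le_trans _ _ (d / r * (5 * r))).
      rewrite ler_pM //; first by lra.
        by rewrite ge_min lexx orbT.
      by lra.
    by rewrite le_eqVlt; apply/orP; left; apply/eqP; field; lra.
  have := hal k ak.
  have : al / 5 * (Num.min 1 (d / r) * (4 * r + d)) <= al / 5 * (5 * d).
    by rewrite ler_wpM2l // divr_ge0 // ltW.
  move=> g1 g2; have : al * d <= cmod (a k) * d by rewrite ler_wpM2r // ltW.
  lra.
apply: (@le_trans _ _ (al / 5 * Num.min 1 (d / r) * expR (- p2))); last first.
  by rewrite ler_wpM2r ?expR_ge0.
rewrite [leRHS]mulrAC ler_wpM2r //.
apply: (@le_trans _ _ (expR (- L))).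
  by rewrite ler_expR lerN2; nra.
rewrite /L opprD expRD mulrC; apply: ler_pM; rewrite ?expR_ge0 //.
by rewrite expRN lnK ?posrE ?divr_gt0 // invf_div.
Qed.

Lemma product_lower_of_Ncount :
  (exists2 C : R, 0 < C & forall n,
     (Ncount a (a n) ((1 - cmod (a n)) / 2) <= (C * Td (a n))%:E)%E) ->
  exists2 C1, 0 <= C1 & forall n,
     expR (- (C1 * (Td (a n) + 1))) <= cmod (product_lim a s (other_zeros a n) (a n)).
Proof.
move=> [C C0 hC]; have [c3 c30 h3] := factor_lower.
exists (c3 * K0 + C) => [|n]; first by rewrite addr_ge0 ?mulr_ge0 // ltW.
have an1 : cmod (a n) < 1 by apply: a_disk.
have t0 := Td_ge0 (a_disk n).
have pc := cvg_cmod (product_lim_cvg a_disk weight_sum (Q := other_zeros a n) (a_disk n)).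
rewrite -(cvg_lim _ pc) //; apply: limr_ge; first by apply/cvg_ex; eexists; exact: pc.
apply: nearW => m.
have r0 : 0 < (1 - cmod (a n)) / 2 by lra.
have Nm := Ncount_prod m r0 a_inj (hC n).
apply: (@le_trans _ _ (expR (- (c3 * K0 * (Td (a n) + 1))) * expR (- (C * Td (a n))))).
  rewrite -expRD ler_expR mulrDl -opprD lerN2; lra.
apply: (@le_trans _ _ (expR (- (c3 * K0 * (Td (a n) + 1))) *
   \prod_(0 <= k < m | k != n) Num.min 1 (cmod (a k - a n) / ((1 - cmod (a n)) / 2)))).
  by rewrite ler_wpM2l ?expR_ge0.
have mn k : 0 <= Num.min 1 (cmod (a k - a n) / ((1 - cmod (a n)) / 2)).
  by rewrite le_min ler01 divr_ge0 ?cmod_ge0 // ltW.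
have mle k : Num.min 1 (cmod (a k - a n) / ((1 - cmod (a n)) / 2)) <= 1.
  by rewrite ge_min lexx.
apply: (@le_trans _ _ ((\prod_(0 <= k < m | other_zeros a n k)
    expR (- (c3 * cmod (disk_weight (a k) (a n)) ^+ s.+1))) *
   \prod_(0 <= k < m | other_zeros a n k) Num.min 1 (cmod (a k - a n) / ((1 - cmod (a n)) / 2)))).
  apply: ler_pM; rewrite ?expR_ge0 ?prodr_ge0 //.
    rewrite -expR_sum ler_expR sumrN lerN2 -mulr_sumr -mulrA ler_wpM2l //.
    apply: le_trans (weight_sum m (a_disk n)); rewrite [leLHS]big_mkcond /=.
    by apply: ler_sum => k _; case: ifP => // _; rewrite exprn_ge0 ?cmod_ge0.
  (* Leaving out a point at the origin can only increase this product, its factors being at most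
     1. *)
  rewrite big_mkcond [leRHS]big_mkcond /=; apply: ler_prod => k _; rewrite /other_zeros.
  by case: (k != n) => /=; case: (a k != 0); rewrite ?mn ?mle ?ler01 ?lexx.
rewrite -big_split /= /partial_product cmod_prod.
apply: ler_prod => k /andP[kn ak].
by rewrite mulr_ge0 ?expR_ge0 ?mn //=; apply: h3.
Qed.

(** If the origin were one of the points, the other B_n would vanish identically and the left side
    of the condition would be +oo. Hence B_n is exactly the product over [other_zeros]. *)
Lemma product_lower_of_without :
  (exists2 C : R, 0 < C & forall n,
     (- lne (cmod (canonical_product_without a s n (a n)))%:E <= (C * Td (a n))%:E)%E) ->
  (forall k, a k != 0) /\
  exists2 C1, 0 <= C1 & forall n,
     expR (- (C1 * (Td (a n) + 1))) <= cmod (product_lim a s (other_zeros a n) (a n)).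
Proof.
move=> [C C0 hC].
have W n : expR (- (C * Td (a n))) <= cmod (canonical_product_without a s n (a n)).
  have := hC n; rewrite /lne; case: ifPn => [_|]; first by rewrite /= leye_eq.
  rewrite -ltNge => p; rewrite -EFinN lee_fin => h.
  by rewrite -[leRHS]lnK ?posrE // ler_expR; lra.
have nz k : a k != 0.
  apply/negP => /eqP ak.
  have f0 z : canonical_factor a s k z = 0 by apply: canonical_factor_origin.
  have := W k.+1; rewrite /canonical_product_without.
  suff -> : limn (fun m => \prod_(0 <= l < m | l != k.+1) canonical_factor a s l (a k.+1)) = 0.
    by rewrite cmod0 leNgt expR_gt0.
  apply: (@cvg_lim _ (@norm_hausdorff _ R[i])).
  apply: (@cvgn_eventually_cst _ _ _ k.+1) => m km.
  rewrite big_mkcond (bigD1_seq k) ?mem_index_iota ?iota_uniq //=.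
  by rewrite neq_ltn ltnSn f0 mul0r.
split=> //; exists C => [|n]; first exact: ltW.
apply: (@le_trans _ _ (expR (- (C * Td (a n))))); first by rewrite ler_expR; lra.
apply: (le_trans (W n)); rewrite /canonical_product_without /product_lim /partial_product.
rewrite (_ : other_zeros a n = (fun k => k != n)) //.
by apply/funext => k; rewrite /other_zeros nz andbT.
Qed.

(** Near a n, P = E(w_n, s) G with |E(w_n(z), s)| <= exp(p2) |z - a_n| / (1 - |a_n|). Bounding the
    difference quotients of P gives (1 - |a_n|) |P'(a_n)| <= exp(p2) |G(a_n)|, with no need for the
    derivative of the factor. The origin is excluded because P would vanish identically. *)
Lemma product_lower_of_derivative :
  (exists2 C : R, 0 < C & forall n,
     (- lne ((1 - cmod (a n)) * cmod (derive1 (canonical_product a s) (a n)))%:E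
        <= (C * Td (a n))%:E)%E) ->
  (forall k, a k != 0) /\
  exists2 C1, 0 <= C1 & forall n,
     expR (- (C1 * (Td (a n) + 1))) <= cmod (product_lim a s (other_zeros a n) (a n)).
Proof.
move=> [C C0 hC].
have W n : expR (- (C * Td (a n))) <= (1 - cmod (a n)) * cmod (derive1 (canonical_product a s) (a n)).
  have := hC n; rewrite /lne; case: ifPn => [_|]; first by rewrite /= leye_eq.
  rewrite -ltNge => p; rewrite -EFinN lee_fin => h.
  by rewrite -[leRHS]lnK ?posrE // ler_expR; lra.
have PE : canonical_product a s = product_lim a s xpredT by [].
have nz k : a k != 0.
  apply/negP => /eqP ak.
  have f0 z : canonical_factor a s k z = 0 by apply: canonical_factor_origin.
  have P0 : canonical_product a s = cst 0.
    apply/funext => z; apply: (@cvg_lim _ (@norm_hausdorff _ R[i])).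
    apply: (@cvgn_eventually_cst _ _ _ k.+1) => m km.
    by rewrite (bigD1_seq k) ?mem_index_iota ?iota_uniq //= ?f0 ?mul0r //.
  have := W k; rewrite P0 derive1_cst cmod0 mulr0.
  by rewrite leNgt expR_gt0.
split=> //.
pose p2 : R := pnorm (logpoly R s) 2.
have p20 : 0 <= p2 by apply: pnorm_ge0.
exists (C + p2) => [|n]; first lra.
have an1 : cmod (a n) < 1 by apply: a_disk.
have an0 : 0 < 1 - cmod (a n) by lra.
have t0 := Td_ge0 (a_disk n).
pose G := product_lim a s (other_zeros a n).
have PG z : in_disk z -> canonical_product a s z = canonical_factor a s n z * G z.
  move=> z1; apply: (@cvg_lim _ (@norm_hausdorff _ R[i])).
  have c := product_lim_cvg a_disk weight_sum (Q := other_zeros a n) z1.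
  have : canonical_factor a s n z * partial_product a s (other_zeros a n) m z @[m --> \oo] -->
     canonical_factor a s n z * G z by apply: cvgMr.
  apply: cvg_trans; apply: near_eq_cvg; exists n.+1 => // m /= nm.
  rewrite /partial_product [RHS](bigD1_seq n) ?mem_index_iota ?iota_uniq //=.
  by congr (_ * _); apply: eq_bigl => k; rewrite /other_zeros nz andbT.
pose del := (1 - cmod (a n)) / 2.
have del0 : 0 < del by rewrite /del; lra.
have del1 : del <= 1 by rewrite /del; have := cmod_ge0 (a n); lra.
have [M M0 hM] := dd_bounded_product_lim a_disk T1 weight_sum del0 del1.
have Kp : 0 <= expR p2 / (1 - cmod (a n)) by rewrite divr_ge0 ?expR_ge0 // ltW.
have D : cmod (derive1 (canonical_product a s) (a n)) <=
    expR p2 / (1 - cmod (a n)) * cmod (G (a n)).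
  apply: (@derive1_cmod_le _ _ _ (expR p2 / (1 - cmod (a n)) * M) del) => //.
    by rewrite PE; exact: (product_lim_derivable a_disk T1 weight_sum).
  move=> h h0 hdel.
  have hz : cmod (h + a n) <= 1 - del by have := cmodD h (a n); rewrite /del in hdel *; lra.
  have hz1 : cmod (h + a n) <= 1 by lra.
  rewrite !PG //; last by rewrite /in_disk; lra.
  have -> : canonical_factor a s n (a n) = 0.
    by rewrite canonical_factorE disk_weight_diag // primary_factor1.
  rewrite mul0r subr0 mulrAC.
  rewrite [leRHS](_ : _ = expR p2 / (1 - cmod (a n)) * (cmod (G (a n)) + M * cmod h)); last by ring.
  apply: cmodM_le; last first.
    have := dd_bounded_dd1 (hM (other_zeros a n)) hz (_ : cmod (a n) <= 1 - del).
    move=> /(_ ltac:(rewrite /del; lra)); rewrite /dd1 addrK cmodM cmodV.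
    rewrite ler_pdivrMr ?cmod_gt0 // => e.
    have t := cmodD (G (h + a n) - G (a n)) (G (a n)); rewrite subrK in t.
    by apply: (le_trans t); rewrite addrC lerD2l.
  rewrite cmodM cmodV ler_pdivrMr ?cmod_gt0 // canonical_factorE.
  have W2 : cmod (disk_weight (a n) (h + a n)) <= 2 by apply: cmod_disk_weight_le2.
  apply: (le_trans (primary_factor_le s W2)); rewrite -/p2.
  have wle : cmod (1 - disk_weight (a n) (h + a n)) <= cmod h / (1 - cmod (a n)).
    rewrite one_sub_disk_weight // !cmodM cmodV cmodJ.
    have -> : a n - (h + a n) = - h by ring.
    rewrite cmodN; apply: ler_pM; rewrite ?mulr_ge0 ?invr_ge0 ?cmod_ge0 //.
      by rewrite ler_piMl ?cmod_ge0 // ltW.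
    have dg := disk_den_ge_l (a_disk n) hz1.
    by rewrite lef_pV2 ?posrE // (lt_le_trans an0).
  rewrite (mulrAC (expR p2)) mulrC -mulrA ler_wpM2l ?expR_ge0 //.
apply: (@le_trans _ _ (expR (- p2) * expR (- (C * Td (a n))))).
  by rewrite -expRD ler_expR; have := mulr_ge0 p20 t0; lra.
apply: (@le_trans _ _ (expR (- p2) * (expR p2 * cmod (G (a n))))); last first.
  by rewrite mulrA -expRD addNr expR0 mul1r.
rewrite ler_wpM2l ?expR_ge0 //; apply: (le_trans (W n)).
apply: (le_trans (ler_wpM2l (ltW an0) D)).
by rewrite mulrA mulrCA divff ?mulr1 // gt_eqF.
Qed.

End LowerBounds.

(** * Removing the additive constant *)

Section Assembly.
Variable R : realType.

Lemma analyticM (f g : R[i] -> R[i]) : analytic_in_disk f -> analytic_in_disk g ->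
  analytic_in_disk (fun z => f z * g z).
Proof. by move=> hf hg z z1; apply: derivableM; [apply: hf|apply: hg]. Qed.

Lemma analytic_id : analytic_in_disk (@id R[i]).
Proof. by move=> z _; apply: derivable_id. Qed.

Lemma analytic_cst (c : R[i]) : analytic_in_disk (fun=> c).
Proof. by move=> z _; apply: derivable_cst. Qed.

Lemma analyticD (f g : R[i] -> R[i]) : analytic_in_disk f -> analytic_in_disk g ->
  analytic_in_disk (fun z => f z + g z).
Proof. by move=> hf hg z z1; apply: derivableD; [apply: hf|apply: hg]. Qed.

Lemma analyticX (f : R[i] -> R[i]) m : analytic_in_disk f ->
  analytic_in_disk (fun z => f z ^+ m).
Proof.
move=> hf; elim: m => [|m ih].
  by under eq_fun do rewrite expr0; apply: analytic_cst.
by under eq_fun do rewrite exprS; apply: analyticM.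
Qed.

Lemma lne_le (x : \bar R) (y : R) : (x <= (expR y)%:E)%E -> (lne x <= y%:E)%E.
Proof.
case: x => [r|h|h]; [|by rewrite leye_eq in h|exact: leNye].
rewrite lee_fin /= => ry; case: ifPn => [_|]; first by rewrite leNye.
by rewrite -ltNge lee_fin => r0; rewrite -ler_expR lnK ?posrE.
Qed.

Lemma lne_le_cmod (w : R[i]) (y : R) : (lne (cmod w)%:E <= y%:E)%E -> cmod w <= expR y.
Proof.
rewrite /=; case: ifPn => [w0 _|]; first by apply: le_trans w0 (expR_ge0 _).
by rewrite -ltNge lee_fin => w0 h; rewrite -[leLHS]lnK ?posrE // ler_expR.
Qed.

Lemma max_modulus_le (f : R[i] -> R[i]) (r y : R) :
  (forall w, cmod w = r -> cmod (f w) <= expR y) -> (lne (max_modulus r f) <= y%:E)%E.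
Proof.
move=> h; apply: lne_le; apply: ge_ereal_sup => _ [w wr <-].
by rewrite lee_fin h.
Qed.

Variables (a : nat -> R[i]) (psi : R -> R).
Hypothesis a_disk : forall n, in_disk (a n).
Hypothesis density : exists2 C : R, 0 < C & forall w : R[i], in_disk w ->
     (ncount a w ((1 - cmod w) / 2) <= (C * psi (1 - cmod w)^-1)%:E)%E.
Hypothesis psi_ge0 : forall x, 1 <= x -> 0 <= psi x.
Hypothesis psi_nd : {in `[1, +oo[ &, {homo psi : x y / x <= y}}.
Hypothesis psi_unbounded : forall A : R, exists2 x, 1 <= x & A < psi x.
Local Notation T := (psi_tilde psi).
Local Notation Td z := (psi_tilde psi (1 - cmod z)^-1).

Let Td_ge0 z : in_disk z -> 0 <= Td z.
Proof. by move=> z1; rewrite psi_tilde_ge0 ?in_disk_inv_ge1. Qed.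

(** A disk of the density condition that contains a point has count at least 1. *)
Lemma psi_at_point_gt0 w n : in_disk w -> cmod (a n - w) <= (1 - cmod w) / 2 ->
  0 < psi (1 - cmod w)^-1.
Proof.
move=> w1 anw; have [C C0 h] := density_size density.
have := h w [:: n] w1 isT; rewrite /= => /(_ _) g.
have : 1%:R <= C * psi (1 - cmod w)^-1.
  by apply: g => k; rewrite inE => /eqP ->.
by move=> h1; rewrite -(pmulr_rgt0 _ C0); lra.
Qed.

Lemma psi_tilde_ge_lin z : in_disk z -> psi 1 * cmod z <= Td z.
Proof.
move=> z1; have h := psi_tilde_lower psi_ge0 psi_nd (lexx 1) (in_disk_inv_ge1 z1).
rewrite psi_tilde1 subr0 in h; apply: le_trans h.
have z0 : 0 < 1 - cmod z by rewrite subr_gt0.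
rewrite -mulrA ler_wpM2l ?psi_ge0 // invrK mulrBl mulVf ?gt_eqF // mul1r.
lra.
Qed.

(* If psi 1 = 0, no point lies where psi vanishes; this leaves a gap between
   the points and the disk on which psi_tilde is 0. *)
Lemma point_gap (al : R) : 0 < al <= 1 -> (forall n, al <= cmod (a n)) ->
  exists r r' : R, [/\ 0 < r', r' < r, r <= 1, forall n, r <= cmod (a n) &
    0 < T (1 - r')^-1].
Proof.
move=> /andP[al0 al1] hal.
have [p0|p1] := eqVneq (psi 1) 0; last first.
  have p1' : 0 < psi 1 by rewrite lt_def p1 psi_ge0.
  exists al, (al / 2); split=> //; try lra.
  have z1 : in_disk ((al / 2)%:C%C : R[i]) by rewrite /in_disk cmodR ger0_norm; lra.
  have := psi_tilde_ge_lin z1; rewrite cmodR ger0_norm; last lra.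
  apply: lt_le_trans; rewrite mulr_gt0 //; lra.
(* Let y be the last power of q before psi becomes positive. The density condition pushes the points
   out to modulus 1 - 1 / (2 y), so q must be below 2 for psi to become positive before 2 y. *)
pose q : R := 3 / 2.
have [x x1 px] := psi_unbounded 0.
have exq : exists i, 0 < psi (q ^+ i).
  have bern i : 1 + i%:R / 2 <= q ^+ i.
    elim: i => [|i ih]; first by rewrite mul0r addr0 expr0.
    rewrite exprS -natr1; have : q * (1 + i%:R / 2) <= q * q ^+ i by rewrite ler_wpM2l // /q; lra.
    by have := ler0n R i; rewrite {1}/q; lra.
  exists (Num.bound (2 * x)); apply: lt_le_trans px _; apply: (psi_le psi_nd x1).
  apply: le_trans (bern _).
  by have := @archi_boundP R (2 * x) ltac:(lra); lra.
have [i pi imin] := ex_minnP exq.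
have i0 : (0 < i)%N.
  by rewrite lt0n; apply/eqP => i0; rewrite i0 expr0 p0 ltxx in pi.
pose y := q ^+ i.-1.
have y1 : 1 <= y by rewrite exprn_ege1 // /q; lra.
have py : psi y = 0.
  apply/eqP; rewrite eq_le psi_ge0 // andbT leNgt; apply/negP => h.
  by have := imin _ h; rewrite -ltnS prednK // ltnn.
have pqy : 0 < psi (q * y) by rewrite /y -exprS prednK.
have iy : 0 < y^-1 <= 1 by rewrite invr_gt0 invf_le1; lra.
have van u : 1 <= u -> u <= y -> psi u = 0.
  by move=> u1 uy; apply/eqP; rewrite eq_le psi_ge0 // andbT -py (psi_le psi_nd).
pose rho := 1 - y^-1.
have rho0 : 0 <= rho by rewrite /rho; lra.
have away n : 1 - y^-1 / 2 <= cmod (a n).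
  rewrite leNgt; apply/negP => an.
  have an1 := a_disk n; have an1' : cmod (a n) < 1 by [].
  have [h|h] := leP (cmod (a n)) rho.
    have := @psi_at_point_gt0 (a n) n an1.
    rewrite subrr cmod0 van ?ltxx ?in_disk_inv_ge1 //.
      by move=> /(_ _) g; have : false by apply: g; lra.
    by rewrite -[leRHS]invrK lef_pV2 ?posrE; rewrite /rho in h; lra.
  have an0 : 0 < cmod (a n) by lra.
  (* The radial projection of a n to the circle where psi takes the value psi y = 0; a n would lie
     in the density disk around it. *)
  pose w := (rho / cmod (a n))%:C%C * a n.
  have cw : cmod w = rho.
    by rewrite cmodM cmodR ger0_norm ?divr_ge0 ?cmod_ge0 // divfK // gt_eqF.
  have w1 : in_disk w by rewrite /in_disk cw /rho; lra.
  have := @psi_at_point_gt0 w n w1; rewrite cw.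
  have -> : (1 - rho)^-1 = y by rewrite /rho opprB addrC subrK invrK.
  rewrite py ltxx => g; have : false by apply: g; rewrite /w; 
    rewrite -{1}[a n]mul1r -mulrBl cmodM -[1]/(1%:C%C) -rmorphB cmodR ger0_norm;
    [rewrite mulrBl mul1r divfK ?gt_eqF //; rewrite /rho in h *; lra|
     rewrite subr_ge0 ler_pdivrMr // mul1r ltW].
  by [].
have yi : (7 / 4 * y)^-1 = 4 / 7 * y^-1 by field; lra.
(* The value 7/4 lies between q = 3/2 and 2: T is positive at (7 / 4) y, since psi is already
   positive from q y on. *)
exists (1 - y^-1 / 2), (1 - (7 / 4 * y)^-1); split=> //.
- by rewrite yi; lra.
- by rewrite yi; lra.
- lra.
- rewrite subKr invrK.
  have h := @psi_tilde_lower _ _ psi_ge0 psi_nd (q * y) (7 / 4 * y).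
  have h1 : 0 < psi (q * y) * (7 / 4 * y - q * y) / (7 / 4 * y).
    by rewrite divr_gt0 ?mulr_gt0 //; rewrite /q; lra.
  have q1 : 1 <= q * y by rewrite /q; lra.
  have := h q1; rewrite /q => /(_ ltac:(lra)).
  have := psi_tilde_ge0 psi_ge0 psi_nd q1; rewrite /q in h1 *; lra.
Qed.

(** Take f = (z / r)^m g with g interpolating b_n (r / a_n)^m; as r <= |a_n|, these data obey the
    same bound as b. On |z| <= r' the factor (r' / r)^m outweighs the additive constant, and outside
    T_z >= tau > 0 absorbs it. *)
Lemma bounded_interpolation_nonzero (al C C1 : R) (b : nat -> R[i]) : 0 < al <= 1 -> 0 <= C ->
  (forall n, al <= cmod (a n)) ->
  (forall b : nat -> R[i], (forall n, cmod (b n) <= expR (C1 * (Td (a n) + 1))) ->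
     exists f, [/\ analytic_in_disk f, forall n, f (a n) = b n &
      forall z, in_disk z -> cmod (f z) <= expR (C * (Td z + 1))]) ->
  (forall n, cmod (b n) <= expR (C1 * (Td (a n) + 1))) ->
  exists2 f, analytic_in_disk f /\ (forall n, f (a n) = b n) &
    exists2 D, 0 < D & forall z, in_disk z -> cmod (f z) <= expR (D * Td z).
Proof.
move=> al01 C0 hal interp hb.
have [r [r' [r'0 rr r1 har Tr]]] := point_gap al01 hal.
have r0 : 0 < r by lra.
pose lam := ln (r / r').
have lam0 : 0 < lam by rewrite ln_gt0 // ltr_pdivlMr // mul1r.
set tau := T (1 - r')^-1 in Tr.
(* Chosen so that (r' / r)^m exp(C (tau + 1)) <= 1. *)
pose m := Num.bound (C * (tau + 1) / lam).
have hm : C * (tau + 1) <= lam * m%:R.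
  rewrite [leRHS]mulrC -ler_pdivrMr //; apply/ltW; apply: archi_boundP.
  by rewrite divr_ge0 ?mulr_ge0 // ltW //; lra.
pose rc : R[i] := r%:C%C.
have crc : cmod rc = r by rewrite cmodR ger0_norm // ltW.
have rc0 : rc != 0 by rewrite -cmod_gt0 crc.
have an0 n : a n != 0 by rewrite -cmod_gt0; apply: lt_le_trans (har n).
have [g [ga gi gb]] : exists f, [/\ analytic_in_disk f, forall n, f (a n) = b n * (rc / a n) ^+ m &
      forall z, in_disk z -> cmod (f z) <= expR (C * (Td z + 1))].
  apply: interp => n; apply: le_trans (hb n).
  rewrite cmodM -[leRHS]mulr1 ler_wpM2l ?cmod_ge0 // cmodX cmodM cmodV crc.
  rewrite exprn_ile1 ?divr_ge0 ?cmod_ge0 ?(ltW r0) //.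
  by rewrite ler_pdivrMr ?mul1r ?(lt_le_trans r0).
exists (fun z => (z / rc) ^+ m * g z).
  split=> [|n].
    exact: (analyticM (@analyticX _ m (analyticM (@analytic_id) (@analytic_cst rc^-1))) ga).
  rewrite gi mulrCA -exprMn (_ : a n / rc * (rc / a n) = 1) ?expr1n ?mulr1 //.
  by field; rewrite an0 rc0.
have l1 : 0 <= ln r^-1 by rewrite ln_ge0 // invf_ge1.
pose D := C + (C + m%:R * ln r^-1) / tau + 1.
have q0 : 0 <= (C + m%:R * ln r^-1) / tau.
  by rewrite divr_ge0 ?addr_ge0 ?mulr_ge0 // ltW.
have D0 : 0 < D by rewrite ltr_pwDr // addr_ge0.
exists D => // z z1.
have t0 := Td_ge0 z1; have z1' : cmod z < 1 by [].
rewrite cmodM cmodX cmodM cmodV crc.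
have [zr|rz] := leP (cmod z) r'.
  apply: (@le_trans _ _ 1); last first.
    by rewrite -[leLHS]expR0 ler_expR mulr_ge0 // ltW.
  apply: (@le_trans _ _ (expR (- (lam * m%:R)) * expR (C * (tau + 1)))).
    apply: ler_pM; rewrite ?cmod_ge0 ?exprn_ge0 ?divr_ge0 ?cmod_ge0 ?(ltW r0) //.
      rewrite -mulNr [X in expR X]mulrC expRM_natl lerXn2r ?nnegrE ?expR_ge0 ?divr_ge0 ?cmod_ge0 ?(ltW r0) //.
      rewrite expRN lnK ?posrE ?divr_gt0 // invf_div.
      by rewrite ler_pM2r ?invr_gt0.
    apply: (le_trans (gb z z1)); rewrite ler_expR ler_wpM2l // lerD2r.
    apply: psi_tilde_le => //; first exact: in_disk_inv_ge1.
    by rewrite lef_pV2 ?posrE; lra.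
  by rewrite -expRD -[leRHS]expR0 ler_expR; lra.
have tz : tau <= Td z.
  apply: psi_tilde_le => //; first by rewrite invf_ge1; lra.
  by rewrite lef_pV2 ?posrE; lra.
apply: (@le_trans _ _ (expR (m%:R * ln r^-1) * expR (C * (Td z + 1)))).
  apply: ler_pM; rewrite ?cmod_ge0 ?exprn_ge0 ?divr_ge0 ?cmod_ge0 ?(ltW r0) //; last exact: gb.
  rewrite expRM_natl lnK ?posrE ?invr_gt0 //.
  rewrite lerXn2r ?nnegrE ?divr_ge0 ?cmod_ge0 ?invr_ge0 ?(ltW r0) //.
  by rewrite -[leRHS]mul1r ler_pM2r ?invr_gt0 // ltW.
rewrite -expRD ler_expR /D.
have : (C + m%:R * ln r^-1) / tau * tau <= (C + m%:R * ln r^-1) / tau * Td z.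
  by rewrite ler_wpM2l.
rewrite divfK ?gt_eqF //; lra.
Qed.

(** T(1) = 0 forces |b_n0| <= 1, and f = b_n0 + z g with g interpolating (b_n - b_n0) / a_n; the
    difference and the division cost 2 / al. A point at the origin makes psi 1 positive, so T_z >=
    psi 1 |z|, which compensates the factor z. *)
Lemma bounded_interpolation_zero (al C C1 Cb : R) (n0 : nat) (b : nat -> R[i]) :
  a n0 = 0 -> injective a -> 0 < al <= 1 -> 0 <= C -> 0 <= Cb ->
  (forall n, a n != 0 -> al <= cmod (a n)) -> Cb + ln (2 / al) <= C1 ->
  (forall b : nat -> R[i], (forall n, a n != 0 -> cmod (b n) <= expR (C1 * (Td (a n) + 1))) ->
     exists f, [/\ analytic_in_disk f, forall n, a n != 0 -> f (a n) = b n &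
      forall z, in_disk z -> cmod (f z) <= expR (C * (Td z + 1))]) ->
  (forall n, cmod (b n) <= expR (Cb * Td (a n))) ->
  exists2 f, analytic_in_disk f /\ (forall n, f (a n) = b n) &
    exists2 D, 0 < D & forall z, in_disk z -> cmod (f z) <= expR (D * Td z).
Proof.
move=> a0 a_inj /andP[al0 al1] C0 Cb0 hal hC1 interp hb.
have d0 : in_disk (0 : R[i]) by rewrite /in_disk cmod0.
have b0 : cmod (b n0) <= 1.
  by have := hb n0; rewrite a0 cmod0 subr0 invr1 psi_tilde1 mulr0 expR0.
have p1 : 0 < psi 1.
  have := @psi_at_point_gt0 0 n0 d0.
  by rewrite a0 subrr !cmod0 subr0 invr1; apply; lra.
have [g [ga gi gb]] : exists f, [/\ analytic_in_disk f,
      forall n, a n != 0 -> f (a n) = (b n - b n0) / a n &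
      forall z, in_disk z -> cmod (f z) <= expR (C * (Td z + 1))].
  apply: interp => n an; have t0 := Td_ge0 (a_disk n).
  have e1 : 1 <= expR (Cb * Td (a n)) by rewrite -[leLHS]expR0 ler_expR mulr_ge0.
  apply: (@le_trans _ _ (expR (Cb * Td (a n) + ln (2 / al)))).
    rewrite expRD lnK ?posrE ?divr_gt0 // mulrA; apply: cmodM_le.
      by apply: (le_trans (cmodB _ _)); have := hb n; lra.
    by rewrite cmodV lef_pV2 ?posrE ?cmod_gt0 ?hal.
  rewrite ler_expR; apply: (@le_trans _ _ ((Cb + ln (2 / al)) * (Td (a n) + 1))).
    have l0 : 0 <= ln (2 / al) by rewrite ln_ge0 // ler_pdivlMr //; lra.
    by have := mulr_ge0 l0 t0; lra.
  by rewrite ler_wpM2r //; lra.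
exists (fun z => b n0 + z * g z).
  split=> [|n].
    exact: (analyticD (@analytic_cst (b n0)) (analyticM (@analytic_id) ga)).
  have [an|an] := eqVneq (a n) 0.
    by rewrite an mul0r addr0; congr b; apply: a_inj; rewrite an a0.
  by rewrite gi // mulrC divfK // addrC subrK.
pose E := expR (2 * C).
have E0 : 0 < E by apply: expR_gt0.
have Ep : 0 < E / psi 1 by rewrite divr_gt0.
exists (E / psi 1 + 2 * C + 1) => [|z z1]; first lra.
have t0 := Td_ge0 z1; have z1' : cmod z < 1 by [].
have tz := psi_tilde_ge_lin z1.
apply: (le_trans (cmodD _ _)); rewrite cmodM.
apply: (@le_trans _ _ (1 + cmod z * expR (C * (Td z + 1)))).
  by apply: lerD => //; rewrite ler_wpM2l ?cmod_ge0 // gb.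
(* For T_z <= 1, |z| E is at most (E / psi 1) T_z and 1 + x <= exp(x) applies; for T_z > 1 additive
   constants are multiples of T_z. *)
have [t1|t1] := leP (Td z) 1.
  apply: (@le_trans _ _ (1 + E / psi 1 * Td z)).
    rewrite lerD2l; apply: (@le_trans _ _ (cmod z * E)).
      rewrite ler_wpM2l ?cmod_ge0 // ler_expR.
      by rewrite [leRHS]mulrC ler_wpM2l //; lra.
    rewrite [leLHS]mulrC -mulrA ler_wpM2l ?(ltW E0) // [leRHS]mulrC ler_pdivlMr //.
    by rewrite [leLHS]mulrC.
  apply: (le_trans (expR_ge1Dx _)); rewrite ler_expR ler_wpM2r //; lra.
apply: (@le_trans _ _ (expR (1 + C * (Td z + 1)))).
  have e1 : 1 <= expR (C * (Td z + 1)) by rewrite -[leLHS]expR0 ler_expR mulr_ge0 //; lra.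
  have e2 : 1 + 1 <= expR 1 :> R := expR_ge1Dx 1.
  rewrite expRD; apply: (@le_trans _ _ ((1 + 1) * expR (C * (Td z + 1)))).
    have : cmod z * expR (C * (Td z + 1)) <= 1 * expR (C * (Td z + 1)).
      by rewrite ler_wpM2r ?expR_ge0 // ltW.
    lra.
  by rewrite ler_wpM2r ?expR_ge0.
rewrite ler_expR.
have h1 : 0 <= E / psi 1 * Td z by rewrite mulr_ge0 // ltW.
have h2 : C * 1 <= C * Td z by rewrite ler_wpM2l // ltW.
lra.
Qed.

End Assembly.

Unset Implicit Arguments.

Theorem theorem1 (R : realType) (z : nat -> R[i]) (psi : R -> R) (s : nat)
  (z_disk : forall n, in_disk (z n))
  (z_distinct : injective z)
  (psi_ge0 : forall x, 1 <= x -> 0 <= psi x)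
  (psi_nd : {in `[1, +oo[ &, {homo psi : x y / x <= y}})
  (psi_unbounded : forall A : R, exists2 x, 1 <= x & A < psi x)
  (psi_doubling : exists2 K : R, 0 < K &
     \forall x \near +oo, psi (2 * x) <= K * psi x)
  (s_ge : Num.floor (polya_order psi) + 1 <= s%:Z)
  (density : exists2 C : R, 0 < C & forall w : R[i], in_disk w ->
     (ncount z w ((1 - cmod w) / 2) <= (C * psi (1 - cmod w)^-1)%:E)%E)
  (abc :
     [\/ exists2 C : R, 0 < C & forall n,
           (Ncount z (z n) ((1 - cmod (z n)) / 2)
             <= (C * psi_tilde psi (1 - cmod (z n))^-1)%:E)%E,
         exists2 C : R, 0 < C & forall n,
           (- lne ((1 - cmod (z n))
                    * cmod (derive1 (canonical_product z s) (z n)))%:E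
             <= (C * psi_tilde psi (1 - cmod (z n))^-1)%:E)%E
       | exists2 C : R, 0 < C & forall n,
           (- lne (cmod (canonical_product_without z s n (z n)))%:E
             <= (C * psi_tilde psi (1 - cmod (z n))^-1)%:E)%E])
  (b : nat -> R[i])
  (b_growth : exists2 C : R, 0 < C & forall n,
     (lne (cmod (b n))%:E <= (C * psi_tilde psi (1 - cmod (z n))^-1)%:E)%E) :
  exists f : R[i] -> R[i],
    [/\ analytic_in_disk f,
        forall n, f (z n) = b n
      & exists2 C : R, 0 < C & forall r : R, 0 < r < 1 ->
          (lne (max_modulus r f) <= (C * psi_tilde psi (1 - r)^-1)%:E)%E].
Proof.
have [K0 K00 wsum] := sum_disk_weight_le z_disk density psi_ge0 psi_nd psi_unbounded
  psi_doubling s_ge.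
have T1 : psi_tilde psi 1 = 0 by exact: psi_tilde1.
have T_le : forall x y, 1 <= x -> x <= y -> psi_tilde psi x <= psi_tilde psi y.
  by move=> x y; apply: psi_tilde_le.
have [C1 C10 low] : exists2 C1, 0 <= C1 & forall n,
     expR (- (C1 * (psi_tilde psi (1 - cmod (z n))^-1 + 1)))
       <= cmod (product_lim z s (other_zeros z n) (z n)).
  case: abc => [h|h|h].
  - exact: (product_lower_of_Ncount z_disk z_distinct K00 T1 T_le wsum).
  - by have [] := product_lower_of_derivative z_disk T1 T_le wsum h.
  - by have [] := product_lower_of_without h.
have [al al01 hal] := nonzero_points_away z_disk T1 wsum.
have [Cb Cb0 hb'] := b_growth.
have hb n : cmod (b n) <= expR (Cb * psi_tilde psi (1 - cmod (z n))^-1).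
  exact: lne_le_cmod.
have t0 n : 0 <= psi_tilde psi (1 - cmod (z n))^-1.
  rewrite psi_tilde_ge0 // invf_ge1 ?gerBl ?cmod_ge0 // subr_gt0.
  exact: z_disk.
(* One constant for the lower bounds, for the data b, and for the data (b_n - b_n0) / a_n of the
   case with a point at the origin. *)
pose C2 := C1 + Cb + ln (2 / al).
have l0 : 0 <= ln (2 / al).
  by rewrite ln_ge0 //; case/andP: al01 => a0 a1; rewrite ler_pdivlMr //; lra.
have C20 : 0 <= C2 by rewrite /C2; lra.
have low2 n : z n != 0 -> expR (- (C2 * (psi_tilde psi (1 - cmod (z n))^-1 + 1)))
       <= cmod (product_lim z s (other_zeros z n) (z n)).
  move=> _; apply: le_trans (low n); rewrite ler_expR lerN2 ler_wpM2r //.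
    by have := t0 n; lra.
  by rewrite /C2; lra.
have [C C0 interp] := interpolation_from_lower_bound z_disk K00 T1 T_le
  (psi_tilde_double psi_ge0 psi_nd psi_doubling) (psi_tilde_superlog psi_ge0 psi_nd psi_unbounded)
  wsum C20 low2 z_distinct.
have [f [fa fi] [D D0 fD]] : exists2 f, analytic_in_disk f /\ (forall n, f (z n) = b n) &
    exists2 D, 0 < D & forall w, in_disk w -> cmod (f w) <= expR (D * psi_tilde psi (1 - cmod w)^-1).
  have [[n0 zn0]|nz] := pselect (exists n0, z n0 = 0).
    apply: (@bounded_interpolation_zero _ z psi z_disk density psi_ge0 psi_nd al C C2 Cb n0) => //.
      exact: ltW.
    by rewrite /C2; lra.
  have nz' n : z n != 0 by apply/eqP => zn; apply: nz; exists n.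
  apply: (@bounded_interpolation_nonzero _ z psi z_disk density psi_ge0 psi_nd psi_unbounded al C C2) => //.
  - by move=> n; apply: hal.
  - move=> b' hb2; have [g [ga gi gb]] := interp b' (fun n _ => hb2 n).
    by exists g; split=> // n; apply: gi.
  - move=> n; apply: le_trans (hb n) _; rewrite ler_expR.
    have c1 : 0 <= (C1 + ln (2 / al)) * psi_tilde psi (1 - cmod (z n))^-1.
      by rewrite mulr_ge0 //; lra.
    by rewrite /C2; lra.
exists f; split=> //; exists D => // r /andP[r0 r1].
apply: max_modulus_le => w wr; rewrite -wr; apply: fD.
by rewrite /in_disk wr.
Qed.
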